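(* The following functions of $x\in(0,+\infty)$ are completely monotonic. (a) For every $\alpha\in(0,1]$, the function $$x\mapsto\frac{e^x}{\alpha}-E_\alpha(x^\alpha).$$ (b) For every $\alpha\in(0,1]$ and $\beta>1$, the functions $$x\mapsto\frac{x^{1-\beta}e^x\gamma(\beta-1,x)}{\alpha\Gamma(\beta-1)}-F_{\alpha,\beta}(x)\qquad\text{and}\qquad x\mapsto\mathcal{L}_\beta F_{\alpha,\beta}(x)-\frac{x^{1-\beta}e^x\gamma(\beta-1,x)}{\alpha\Gamma(\beta-1)}.$$ (c) For every $\alpha\in[1,2]$, the function $$x\mapsto E_\alpha(x^\alpha)-\frac{e^x}{\alpha}.$$ (d) For every $\alpha\in[1,2]$ and $\beta>1$, the functions $$x\mapsto F_{\alpha,\beta}(x)-\frac{x^{1-\beta}e^x\gamma(\beta-1,x)}{\alpha\Gamma(\beta-1)}\qquad\text{and}\qquad x\mapsto\frac{x^{1-\beta}e^x\gamma(\beta-1,x)}{\alpha\Gamma(\beta-1)}-\mathcal{L}_\beta F_{\alpha,\beta}(x).$$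
   Context: A smooth function $f$ on $(0,+\infty)$ is completely monotonic (CM) if $(-1)^n f^{(n)}(x)\ge 0$ for all $n\ge 0$ and $x>0$ (in particular the zero function is CM). For $\alpha,\beta>0$ the Mittag-Leffler functions are the entire functions $E_\alpha(z)=\sum_{n\ge 0}\frac{z^n}{\Gamma(1+\alpha n)}$ and $E_{\alpha,\beta}(z)=\sum_{n\ge 0}\frac{z^n}{\Gamma(\beta+\alpha n)}$. Set $F_{\alpha,\beta}(x)=E_{\alpha,\beta}(x^\alpha)$ for $x>0$, with $F_{\alpha,\beta}(0)=1/\Gamma(\beta)$. The differential-difference operator $\mathcal{L}_\beta$ is $\mathcal{L}_\beta f(x)=f'(x)+\frac{\beta-1}{x}\,(f(x)-f(0))$. The incomplete Gamma function is $\gamma(u,x)=\int_0^x t^{u-1}e^{-t}\,dt$ for $u,x>0$. *)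

(* Defs.v *)
(* MathComp-Analysis: everything is stated over an arbitrary R : realType. *)
From mathcomp Require Import all_boot all_order all_algebra.
From mathcomp Require Import all_classical all_reals all_analysis.

Set Implicit Arguments.
Unset Strict Implicit.
Unset Printing Implicit Defensive.

Import Order.TTheory GRing.Theory Num.Theory.
Import numFieldNormedType.Exports.

Local Open Scope classical_set_scope.
Local Open Scope ring_scope.

(* Only the germs of f at points x > 0 matter: the (arbitrary) values of the
   total function f on x <= 0 play no role. *)
Definition completely_monotonic (R : realType) (f : R -> R) : Prop :=
  forall (n : nat) (x : R), 0 < x ->
    derivable f^`(n)%classic x 1 /\ 0 <= (-1) ^+ n * f^`(n)%classic x.

(* The integral is finite, hence not a junk value, exactly for 0 < s, the only
   range in which Gamma is used. *)
Definition Gamma (R : realType) (s : R) : R :=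
  \int[lebesgue_measure]_(t in `]0, +oo[) (t `^ (s - 1) * expR (- t)).

Definition lower_gamma (R : realType) (u x : R) : R :=
  \int[lebesgue_measure]_(t in `]0, x]) (t `^ (u - 1) * expR (- t)).

(* Restrictions to the real line of the entire functions E_{alpha,beta} and
   E_alpha = E_{alpha,1}; the series converges for alpha, beta > 0. *)
Definition mittag_leffler2 (R : realType) (alpha beta z : R) : R :=
  limn (series (fun n : nat => z ^+ n / Gamma (beta + alpha * n%:R))).

Definition mittag_leffler (R : realType) (alpha z : R) : R :=
  mittag_leffler2 alpha 1 z.

Definition mlF (R : realType) (alpha beta x : R) : R :=
  mittag_leffler2 alpha beta (x `^ alpha).

(* 0 `^ alpha = 0 for alpha != 0, so mlF has the prescribed value at 0. *)
Lemma mlF0 (R : realType) (alpha beta : R) :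
  0 < alpha -> mlF alpha beta 0 = (Gamma beta)^-1.
Proof.
move=> a0; rewrite /mlF /mittag_leffler2 powR0 ?gt_eqF//.
apply: cvg_lim => //; rewrite -cvg_shiftS.
apply: cvg_near_cst; near=> n.
rewrite /series /= big_nat_recl //= expr0 mulr0 addr0 mul1r.
by rewrite big1 ?addr0// => i _; rewrite expr0n mul0r.
Unshelve. all: by end_near. Qed.

Definition Lop (R : realType) (beta : R) (f : R -> R) (x : R) : R :=
  f^`()%classic x + (beta - 1) / x * (f x - f 0).

(* Main.v *)
(* Let c_n(s) be the coefficients of (1 - x)^(-s). For a small step eta, with
   theta = eta^alpha, the sequence u_n = sum_k theta^k c_n(alpha k + 1) tends
   to E_alpha(x^alpha) when eta n -> x. It satisfies a renewal recursion, which
   makes u_{m+n} and u_{m+n+1} Gram matrices of two quadratic forms built on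
   Hankel matrices of c_n(alpha - 1). By the Beta integral, the Hankel form of
   c_n(s) is positive semidefinite for 0 <= s <= 1 and negative semidefinite
   for -1 <= s <= 0. So, according to the sign of alpha - 1, each of the forms
   with Gram matrices u_{m+n} and u_{m+n+1} - u_{m+n} is positive semidefinite
   or of Lorentz signature, and the direct or reversed Cauchy-Schwarz
   inequality against the common eigenvector ((1 - eta)^i)_i compares alpha
   u_{m+n} with (1 - eta)^(-m-n), that is, alpha E_alpha(x^alpha) with e^x, as
   kernels in x + y. Hence g(x) = e^x / alpha - E_alpha(x^alpha) and -g', or
   their opposites, are positive definite functions of x + y; their finite
   differences of even order, and so their derivatives of even order, are
   nonnegative, and g or -g is completely monotonic. The functions of (b) and
   (d) are the averages int_0^1 (1 - s)^(beta - 2) f(s x) ds / Gamma(beta - 1)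
   with f = g, -g, g', -g'. *)

Require Import Defs.
From mathcomp Require Import all_boot all_order all_algebra.
From mathcomp Require Import all_classical all_reals all_analysis.
From mathcomp Require Import ring lra measurable_realfun.

Import Order.TTheory GRing.Theory Num.Theory.
Import numFieldNormedType.Exports.

Set Implicit Arguments.
Unset Strict Implicit.
Unset Printing Implicit Defensive.

Local Open Scope classical_set_scope.
Local Open Scope ring_scope.

(** * Negative binomial coefficients and renewal forms *)

(** Classically the defect is a Laplace transform whose density carries the factor sin(pi alpha),
    found by a contour integral. The discretisation replaces that by algebra. The generating
    function of u_n is U(x) = 1 / ((1 - x) - theta (1 - x)^(1 - alpha)), which is 1 / eta times the
    Laplace transform s^(alpha - 1) / (s^alpha - 1) of E_alpha(x^alpha), at s = (1 - x) / eta. Its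
    pole s = 1 becomes x = z = 1 - eta, with polar part 1 / (alpha (z - x)): the exponential and the
    constant 1 / alpha both come from there. Write 1 / U(x) = L - x B(x), where B has coefficients
    b_n. These are explicit, whence a renewal recursion and Hankel forms in b alone; z is a zero of
    1 / U, whence the geometric vector; and the self-pairing of that vector is (x B)'(z) = alpha.
    Removing the pole amounts to removing the component along the geometric vector, which is what
    Cauchy-Schwarz does. *)

Section NegBin.
Variable R : realFieldType.
Implicit Types (s t : R) (n m : nat).

(* The coefficient of [x ^+ n] in [(1 - x) `^ (- s)]. *)
Definition negbin s n : R := \prod_(i < n) ((s + i%:R) / i.+1%:R).

Lemma negbin0 s : negbin s 0 = 1.
Proof. by rewrite /negbin big_ord0. Qed.

Lemma negbinS s n : n.+1%:R * negbin s n.+1 = (s + n%:R) * negbin s n.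
Proof.
rewrite /negbin big_ord_recr /= mulrC -mulrA divfK ?pnatr_eq0 //.
by rewrite mulrC.
Qed.

(** Coefficient form of the derivative of (1 - x)^(-s), which is s (1 - x)^(-s - 1). *)
Lemma negbin_shift s n : n.+1%:R * negbin s n.+1 = s * negbin (s + 1) n.
Proof.
elim: n => [|n IH]; first by rewrite negbinS !negbin0 addr0.
apply: (mulfI (x := n.+1%:R)); first by rewrite pnatr_eq0.
rewrite negbinS mulrCA IH [RHS]mulrCA negbinS -natr1; ring.
Qed.

Lemma negbin_diff s n : negbin s n.+1 - negbin s n = negbin (s - 1) n.+1.
Proof.
apply: (mulfI (x := n.+1%:R)); first by rewrite pnatr_eq0.
rewrite mulrBr negbinS negbin_shift subrK -natr1; ring.
Qed.

(** Product of two binomial series. The factor n+1 = j + (n+1-j) acts as the Leibniz rule, and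
    [negbinS] absorbs each half. *)
Lemma negbin_Vandermonde s t n :
  \sum_(j < n.+1) negbin s j * negbin t (n - j) = negbin (s + t) n.
Proof.
elim: n => [|n IH]; first by rewrite big_ord1 !negbin0 mulr1.
apply: (mulfI (x := n.+1%:R)); first by rewrite pnatr_eq0.
rewrite negbinS -IH !mulr_sumr.
transitivity (\sum_(j < n.+2) (j%:R * negbin s j * negbin t (n.+1 - j)
      + negbin s j * ((n.+1 - j)%:R * negbin t (n.+1 - j)))).
  apply: eq_bigr => j _; rewrite natrB; last by rewrite -ltnS.
  by ring.
rewrite big_split /= big_ord_recl /= !mul0r add0r.
rewrite [X in _ + X]big_ord_recr /= subnn mul0r mulr0 addr0 -big_split /=.
apply: eq_bigr => j _; rewrite /bump /= add1n subSS negbinS subSn; last by rewrite -ltnS.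
rewrite negbinS natrB; last by rewrite -ltnS.
ring.
Qed.

Lemma negbin_gt0 s n : 0 < s -> 0 < negbin s n.
Proof.
move=> s0; apply: prodr_gt0 => i _; rewrite divr_gt0 ?ltr0n //.
by rewrite ltr_wpDr.
Qed.

Lemma negbin1 n : negbin 1 n = 1.
Proof. by rewrite /negbin big1 // => i _; rewrite nat1r divff // pnatr_eq0. Qed.

Lemma negbin_0S n : negbin 0 n.+1 = 0.
Proof. by apply: (mulfI (x := n.+1%:R)); rewrite ?pnatr_eq0 // negbin_shift mul0r mulr0. Qed.

Lemma negbin_N1SS n : negbin (-1) n.+2 = 0.
Proof.
apply: (mulfI (x := n.+2%:R)); rewrite ?pnatr_eq0 //.
by rewrite negbin_shift addNr negbin_0S !mulr0.
Qed.

Lemma ler_negbin s t n : 0 <= s <= t -> negbin s n <= negbin t n.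
Proof.
move=> /andP[s0 st]; apply: ler_prod => i _; rewrite divr_ge0 ?addr_ge0 //=.
by rewrite ler_pM2r ?invr_gt0 ?ltr0n // lerD2r.
Qed.

Lemma negbin_ge0 s n : 0 <= s -> 0 <= negbin s n.
Proof.
rewrite le_eqVlt => /orP[/eqP <-|/negbin_gt0 s0]; last exact: ltW.
by case: n => [|n]; rewrite ?negbin0 ?negbin_0S.
Qed.

Lemma negbin_le0 s n : -1 <= s <= 0 -> negbin s n.+1 <= 0.
Proof.
move=> /andP[s1 s0]; rewrite -(ler_pM2l (ltr0Sn R n)) mulr0 negbin_shift mulr_le0_ge0 //.
by apply: negbin_ge0; rewrite -lerBlDr sub0r.
Qed.

Lemma negbin2 n : negbin 2 n = n.+1%:R.
Proof.
elim: n => [|n IH]; first by rewrite negbin0.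
apply: (mulfI (x := n.+1%:R)); first by rewrite pnatr_eq0.
by rewrite negbinS IH -!natr1; ring.
Qed.

Lemma negbin_le s n : 0 <= s -> negbin (s + 1) n <= (s + 1) ^+ n.
Proof.
move=> s0; rewrite -[n in X in _ <= X]card_ord -prodr_const; apply: ler_prod => i _.
rewrite divr_ge0 ?addr_ge0 //= ler_pdivrMr ?ltr0n //.
have i0 : 0 <= i%:R :> R by [].
rewrite -natr1; nra.
Qed.

End NegBin.

(** * Gram matrices produced by a renewal recursion *)

Section RenewalForms.
Variable R : realFieldType.
Variables (L : R) (b u : nat -> R).
Hypothesis u0 : L * u 0 = 1.
Hypothesis uS : forall n, L * u n.+1 = \sum_(j < n.+1) b j * u (n - j)%N.

(* The renewal recursion makes [u (m + n)] and [u (m + n).+1] the Gram matrices of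
   [form0] and [form1] on the vectors [past m]. *)
Definition form0 K (x y : nat -> R) : R :=
  L * x 0%N * y 0%N + \sum_(i < K) \sum_(j < K) b (i + j).+1 * x i.+1 * y j.+1.

Definition form1 K (x y : nat -> R) : R :=
  \sum_(i < K.+1) \sum_(j < K.+1) b (i + j)%N * x i * y j.

Definition past m i : R := if (i <= m)%N then u (m - i)%N else 0.

Lemma form1C K x y : form1 K x y = form1 K y x.
Proof.
rewrite /form1 exchange_big; apply: eq_bigr => i _; apply: eq_bigr => j _.
by rewrite addnC; ring.
Qed.

Lemma form0C K x y : form0 K x y = form0 K y x.
Proof.
rewrite /form0 exchange_big; congr (_ + _); first by ring.
by apply: eq_bigr => i _; apply: eq_bigr => j _; rewrite addnC; ring.
Qed.

Lemma sum_past K m (a : nat -> R) : (m <= K)%N ->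
  \sum_(i < K.+1) a i * past m i = \sum_(i < m.+1) a i * u (m - i)%N.
Proof.
move=> mK; rewrite (big_ord_widen K.+1 (fun i => a i * u (m - i)%N)) ?ltnS //.
rewrite [RHS]big_mkcond; apply: eq_bigr => i _; rewrite /past ltnS.
by case: ifP => // _; rewrite mulr0.
Qed.

(** [past m.+1] is [past m] moved one place, and its new zeroth entry is, by the renewal recursion,
    row 0 of [form1] applied to [past m]. *)
Lemma form0_pastS K m y : (m < K)%N -> form0 K (past m.+1) y = form1 K (past m) y.
Proof.
move=> mK; rewrite /form0 /form1.
have -> : L * past m.+1 0 = \sum_(i < K.+1) b i * past m i.
  by rewrite sum_past ?(ltnW mK) // -uS.
rewrite mulr_suml.
under [RHS]eq_bigr do rewrite big_ord_recl /= addn0.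
rewrite big_split /=; congr (_ + _).
(* The extra row K of [form1] meets [past m] beyond its support, since m < K. *)
rewrite [RHS]big_ord_recr /= [X in _ + X]big1 ?addr0; last first.
  by move=> j _; rewrite /past leqNgt mK /= mulr0 mul0r.
by apply: eq_bigr => i _; apply: eq_bigr => j _; rewrite addnS.
Qed.

Lemma form0_past0 K y : form0 K (past 0) y = y 0%N.
Proof.
rewrite /form0 /past /= u0 mul1r big1 ?addr0 // => i _.
by rewrite big1 // => j _; rewrite mulr0 mul0r.
Qed.

(** Time steps pass from the first argument to the second: [form0] at (m+1, n) is [form1] at (m, n),
    which is [form0] at (m, n+1). At m = 0 the form reads off the zeroth entry. *)
Lemma form0_past K m n : (m + n <= K)%N -> form0 K (past m) (past n) = u (m + n)%N.
Proof.
elim: m n => [|m IH] n; first by rewrite form0_past0 /past subn0.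
rewrite addSnnS => mnK; have mK : (m < K)%N.
  by rewrite (leq_trans _ mnK) // addnS ltnS leq_addr.
have nK : (n < K)%N by rewrite (leq_trans _ mnK) // leq_addl.
by rewrite -IH // form0_pastS // form1C -form0_pastS // form0C.
Qed.

Lemma form1_past K m n : (m + n < K)%N -> form1 K (past m) (past n) = u (m + n).+1.
Proof.
move=> mnK; rewrite -form0_pastS ?form0_past //.
by rewrite (leq_ltn_trans _ mnK) // leq_addr.
Qed.

Definition geom_row z K i : R := \sum_(j < K.+1) b (i + j)%N * z ^+ j.

Lemma form1_past_geom K m z : (m <= K)%N ->
  form1 K (past m) (fun i => z ^+ i) = \sum_(i < m.+1) geom_row z K i * u (m - i)%N.
Proof.
move=> mK; rewrite -(sum_past _ mK); apply: eq_bigr => i _.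
by rewrite /geom_row mulr_suml; apply: eq_bigr => j _; ring.
Qed.

(** Here rho i stands for the tail sum of b_(i+j) z^j, and rho 0 = L / z makes z a zero of L - x
    B(x), hence a pole of the generating function of u. Pairing a past with the powers of z then
    gives a pure power of 1 / z: these powers form an eigenvector of [form0] relative to [form1]. *)
Lemma past_geom (rho : nat -> R) z m : z != 0 ->
  rho 0%N = L / z -> (forall i, rho i = b i + z * rho i.+1) ->
  \sum_(i < m.+1) rho i * u (m - i)%N = z ^- m.+1.
Proof.
move=> z0 rho0 rhoE; elim: m => [|m IH].
  by rewrite big_ord1 rho0 mulrAC u0 div1r.
rewrite big_ord_recl subn0 /= rho0.
have -> : \sum_(i < m.+1) rho (bump 0 i) * u (m.+1 - bump 0 i)%N
   = z^-1 * (z ^- m.+1 - L * u m.+1).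
  rewrite -IH uS -sumrB mulr_sumr; apply: eq_bigr => i _.
  by rewrite /bump /= add1n subSS (rhoE i); field.
by rewrite [in RHS](exprS z) invfM; ring.
Qed.

End RenewalForms.

Lemma ler_sum_widen (R : numDomainType) (F : nat -> R) m n : (m <= n)%N ->
  (forall i, (m <= i)%N -> 0 <= F i) -> \sum_(i < m) F i <= \sum_(i < n) F i.
Proof.
move=> mn F0; rewrite -!(big_mkord predT F) (big_cat_nat (leq0n m) mn) //= lerDl.
by rewrite big_nat_cond sumr_ge0 // => i /andP[/andP[mi _] _]; exact: F0.
Qed.

Lemma cvg_sumr (R : realType) (T I : Type) (F : set_system T) (r : seq I)
    (f : I -> T -> R) (l : I -> R) : Filter F ->
  (forall i, f i @ F --> l i) ->
  (\sum_(i <- r) f i x) @[x --> F] --> \sum_(i <- r) l i.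
Proof. by move=> FF fl; apply: cvg_big => //; exact: add_continuous. Qed.

(** * Hankel square sums compared with sums along antidiagonals *)

Section DoubleSums.
Variable R : realType.
Implicit Types a : nat -> R.

Lemma triangle_sum a K :
  \sum_(i < K.+1) \sum_(j < K.+1 - i) a (i + j)%N = \sum_(n < K.+1) n.+1%:R * a n.
Proof.
elim: K => [|K IH]; first by rewrite !big_ord_recl !big_ord0 !addr0 mul1r.
rewrite big_ord_recr [RHS]big_ord_recr -IH /= subSnn big_ord1 addn0.
have -> : \sum_(i < K.+1) \sum_(j < K.+2 - i) a (i + j)%N =
    \sum_(i < K.+1) (\sum_(j < K.+1 - i) a (i + j)%N + a K.+1).
  apply: eq_bigr => i _; have iK : (i <= K.+1)%N by apply/ltnW.
  by rewrite subSn // big_ord_recr /= subnKC.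
rewrite big_split /= sumr_const card_ord -addrA; congr (_ + _).
by rewrite -mulrSr mulr_natl.
Qed.

(** The square of side K lies between the triangles i + j <= K and i + j <= 2K, whose sums are
    partial sums of the series. The sign of [a 0] is free because the corner lies in all three sets;
    [mlcoef] relies on this when alpha < 1. *)
Lemma cvg_square_sum a (V : R) : (forall n, 0 <= a n.+1) ->
  series (fun n => n.+1%:R * a n) @ \oo --> V ->
  (\sum_(i < K.+1) \sum_(j < K.+1) a (i + j)%N) @[K --> \oo] --> V.
Proof.
move=> a0 aV.
have TV : (\sum_(n < K.+1) n.+1%:R * a n) @[K --> \oo] --> V.
  move: aV; rewrite -cvg_shiftS.
  by apply: cvg_trans; apply: near_eq_cvg; near=> K; rewrite /series /= big_mkord.
have T2V : (\sum_(n < (2 * K).+1) n.+1%:R * a n) @[K --> \oo] --> V.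
  apply: (cvg_comp (fun K => 2 * K)%N _ _ TV).
  apply/cvgnyPge => A; near=> K.
  by rewrite (@leq_trans K) // ?leq_pmull //; near: K; exact: nbhs_infty_ge.
apply: (squeeze_cvgr _ TV T2V); near=> K.
rewrite -!triangle_sum; apply/andP; split.
  apply: ler_sum => i _; apply: (@ler_sum_widen _ (fun j => a (i + j)%N)); first exact: leq_subr.
  move=> j; rewrite leq_subLR; case: (i + j)%N => [|n _] //; exact: a0.
apply: le_trans (_ : \sum_(i < K.+1) \sum_(j < (2 * K).+1 - i) a (i + j)%N <= _).
  apply: ler_sum => i _; apply: (@ler_sum_widen _ (fun j => a (i + j)%N)).
    have iK : (i <= K)%N by rewrite -ltnS.
    rewrite leq_subRL; first by rewrite mul2n -addnn addnS ltnS leq_add2r.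
    by rewrite (leq_trans iK) // ltnW // ltnS leq_pmull.
  move=> j Kj; have : (0 < i + j)%N by rewrite (leq_trans _ (leq_addl _ _)) // (leq_trans _ Kj).
  by case: (i + j)%N.
apply: (@ler_sum_widen _ (fun i => \sum_(j < (2 * K).+1 - i) a (i + j)%N)).
  by rewrite ltnS leq_pmull.
move=> i Ki; apply: sumr_ge0 => j _.
have : (0 < i + j)%N by rewrite (leq_trans _ (leq_addr _ _)) // (leq_trans _ Ki).
by case: (i + j)%N.
Unshelve. all: by end_near. Qed.

Lemma cvg_square_sum_sign a (V : R) :
  (forall n, 0 <= a n.+1) \/ (forall n, a n.+1 <= 0) ->
  series (fun n => n.+1%:R * a n) @ \oo --> V ->
  (\sum_(i < K.+1) \sum_(j < K.+1) a (i + j)%N) @[K --> \oo] --> V.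
Proof.
case=> [a0|a0 aV]; first exact: cvg_square_sum.
rewrite -[V]opprK (_ : (fun _ => _) =
    - (fun K => \sum_(i < K.+1) \sum_(j < K.+1) - a (i + j)%N)); last first.
  apply/funext => K; rewrite [in RHS]/GRing.opp /= -sumrN.
  by apply: eq_bigr => i _; rewrite -sumrN; apply: eq_bigr => j _; rewrite opprK.
apply: cvgN; apply: (@cvg_square_sum (fun n => - a n)) => [n|].
  by rewrite oppr_ge0.
rewrite (_ : (fun n => _) = - (fun n => n.+1%:R * a n)).
  by rewrite seriesN; exact: cvgN.
by apply/funext => n; rewrite mulrN.
Qed.

End DoubleSums.

(** * The geometric eigenvector and the two Cauchy-Schwarz inequalities *)

Section GeometricVector.
Variable R : realType.
Variables (L : R) (b u : nat -> R) (z : R).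
Hypothesis u0 : L * u 0 = 1.
Hypothesis uS : forall n, L * u n.+1 = \sum_(j < n.+1) b j * u (n - j)%N.
Hypothesis z_gt0 : 0 < z.
Hypothesis bz_cvg : series (fun n => b n * z ^+ n) @ \oo --> L / z.

Let geom i : R := z ^+ i.

(** The tail sums of b_(i+j) z^j over j, in the recursive form that [past_geom] takes. *)
Fixpoint rowlim i : R := if i is i'.+1 then (rowlim i' - b i') / z else L / z.

Lemma cvg_row i : geom_row b z K i @[K --> \oo] --> rowlim i.
Proof.
elim: i => [|i IH].
  move: bz_cvg; rewrite -cvg_shiftS; apply: cvg_trans; apply: near_eq_cvg.
  by near=> K; rewrite /geom_row /series /= big_mkord.
rewrite (_ : geom_row b z ^~ i.+1 = (fun K => (geom_row b z K.+1 i - b i) / z)); last first.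
  apply/funext => K; rewrite /geom_row [in RHS]big_ord_recl expr0 mulr1 addn0 addrC addKr mulr_suml.
  by apply: eq_bigr => j _; rewrite /= addnS exprS; field; rewrite gt_eqF.
apply: cvgM; last exact: cvg_cst.
by apply: cvgB; [rewrite (cvg_shiftS (geom_row b z ^~ i))|exact: cvg_cst].
Unshelve. all: by end_near. Qed.

Lemma cvg_form1_past m : form1 b K (past u m) geom @[K --> \oo] --> z ^- m.+1.
Proof.
rewrite -(past_geom u0 uS m (lt0r_neq0 z_gt0) (erefl (rowlim 0))); last first.
  by move=> i /=; field; rewrite gt_eqF.
have : \sum_(i < m.+1) geom_row b z K i * u (m - i)%N @[K --> \oo]
    --> \sum_(i < m.+1) rowlim i * u (m - i)%N.
  by apply: cvg_sumr => i; apply: cvgM; [exact: cvg_row|exact: cvg_cst].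
apply: cvg_trans; apply: near_eq_cvg; near=> K.
rewrite form1_past_geom //; near: K; exact: nbhs_infty_ge.
Unshelve. all: by end_near. Qed.

Lemma cvg_form0_past m : form0 L b K (past u m.+1) geom @[K --> \oo] --> z ^- m.+1.
Proof.
have := @cvg_form1_past m; apply: cvg_trans; apply: near_eq_cvg; near=> K.
rewrite (form0_pastS uS) //; near: K; exact: nbhs_infty_gt.
Unshelve. all: by end_near. Qed.

Hypothesis b_sign : (forall n, 0 <= b n.+1) \/ (forall n, b n.+1 <= 0).
Variable V : R.
Hypothesis bV : series (fun n => n.+1%:R * (b n * z ^+ n)) @ \oo --> V.

Lemma cvg_form1_geom : form1 b K geom geom @[K --> \oo] --> V.
Proof.
rewrite (_ : (fun K => form1 b K geom geom) =
    fun K => \sum_(i < K.+1) \sum_(j < K.+1) (b (i + j)%N * z ^+ (i + j))); last first.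
  apply/funext => K; rewrite /form1; apply: eq_bigr => i _; apply: eq_bigr => j _.
  by rewrite exprD mulrA.
apply: (@cvg_square_sum_sign _ (fun n => b n * z ^+ n)) => //.
by case: b_sign => b0; [left|right] => n;
  rewrite (mulr_ge0, mulr_le0_ge0) ?exprn_ge0 ?(ltW z_gt0).
Qed.

(** In accordance with the eigenvalue z: the Hankel block sums n b_n z^(n+1) over n, which is z V -
    L because the b_n z^n add up to L / z, and the zeroth entry restores L. *)
Lemma cvg_form0_geom : form0 L b K geom geom @[K --> \oo] --> z * V.
Proof.
rewrite -cvg_shiftS /= (_ : (fun K => _) = fun K => L +
    \sum_(i < K.+1) \sum_(j < K.+1) (b (i + j).+1 * z ^+ (i + j).+2)); last first.
  apply/funext => K; rewrite /form0 /geom expr0 !mulr1; congr (_ + _).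
  apply: eq_bigr => i _; apply: eq_bigr => j _.
  by rewrite -!mulrA -exprD addnS addSn.
rewrite -[z * V](subrKC L); apply: cvgD; first exact: cvg_cst.
apply: (@cvg_square_sum_sign _ (fun n => b n.+1 * z ^+ n.+2)).
  by case: b_sign => b0; [left|right] => n;
    rewrite (mulr_ge0, mulr_le0_ge0) ?exprn_ge0 ?(ltW z_gt0).
rewrite (_ : z * V - L = z * (V - L / z)); last by field; rewrite gt_eqF.
rewrite (_ : series _ = fun N => z * (series (fun n => n.+1%:R * (b n * z ^+ n)) N.+1
    - series (fun n => b n * z ^+ n) N.+1)).
  apply: cvgM; first exact: cvg_cst.
  by apply: cvgB; rewrite (cvg_shiftS (series _)).
apply/funext => N; rewrite /series /= -sumrB big_nat_recl // mul1r subrr add0r mulr_sumr.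
apply: eq_bigr => n _; rewrite -natr1 [z ^+ n.+2]exprS; ring.
Qed.

Variables p q : R.

(** Its Gram matrix on pasts is p u_(m+n+1) + q u_(m+n). The pairs (p, q) used below are (0, 1) for
    a sequence, (1, 0) and (1, -1) for differences. *)
Definition pencil K (x y : nat -> R) : R := p * form1 b K x y + q * form0 L b K x y.

Lemma pencilC K x y : pencil K x y = pencil K y x.
Proof. by rewrite /pencil form1C form0C. Qed.

Lemma form1_suml (I : finType) K (c : I -> R) (X : I -> nat -> R) y :
  form1 b K (fun k => \sum_i c i * X i k) y = \sum_i c i * form1 b K (X i) y.
Proof.
under [RHS]eq_bigr do rewrite mulr_sumr.
rewrite exchange_big /=; apply: eq_bigr => k _.
under [RHS]eq_bigr do rewrite mulr_sumr.
rewrite exchange_big /=; apply: eq_bigr => l _.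
rewrite mulr_sumr mulr_suml; apply: eq_bigr => i _; ring.
Qed.

Lemma form0_suml (I : finType) K (c : I -> R) (X : I -> nat -> R) y :
  form0 L b K (fun k => \sum_i c i * X i k) y = \sum_i c i * form0 L b K (X i) y.
Proof.
under [RHS]eq_bigr do rewrite mulrDr.
rewrite big_split /=; congr (_ + _).
  by rewrite mulr_sumr mulr_suml; apply: eq_bigr => i _; ring.
under [RHS]eq_bigr do rewrite mulr_sumr.
rewrite [RHS]exchange_big /=; apply: eq_bigr => k _.
under [RHS]eq_bigr do rewrite mulr_sumr.
rewrite [RHS]exchange_big /=; apply: eq_bigr => l _.
rewrite mulr_sumr mulr_suml; apply: eq_bigr => i _; ring.
Qed.

Lemma pencil_suml (I : finType) K (c : I -> R) (X : I -> nat -> R) y :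
  pencil K (fun k => \sum_i c i * X i k) y = \sum_i c i * pencil K (X i) y.
Proof.
rewrite /pencil form1_suml form0_suml !mulr_sumr -big_split /=.
by apply: eq_bigr => i _; ring.
Qed.

Lemma pencilBl K x (t : R) w y :
  pencil K (fun k => x k - t * w k) y = pencil K x y - t * pencil K w y.
Proof.
have := @pencil_suml bool K (fun i => if i then 1 else - t) (fun i => if i then x else w) y.
rewrite big_bool /= mul1r mulNr => <-; congr (pencil K _ y).
by apply/funext => k; rewrite big_bool /= mul1r mulNr.
Qed.

Variables (I : finType) (c : I -> R) (m : I -> nat).

(** Pasts begin at index 1 because [cvg_form0_past] is transferred from [form1] one step earlier. *)
Let x k := \sum_i c i * past u (m i).+1 k.
Let S := \sum_i \sum_j c i * c j *
  (p * u (m i + m j).+3 + q * u (m i + m j).+2).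
Let P := \sum_i c i * (p * z ^- (m i).+2 + q * z ^- (m i).+1).

Lemma cvg_pencil (t : R) :
  pencil K (fun k => x k - t * geom k) (fun k => x k - t * geom k) @[K --> \oo] -->
  S - 2 * t * P + t ^+ 2 * ((p + q * z) * V).
Proof.
have xx : pencil K x x @[K --> \oo] --> S.
  (* Constant in K as soon as K exceeds every m i + m j + 2. *)
  apply: cvg_near_cst; near=> K.
  rewrite /S pencil_suml; apply: eq_bigr => i _; rewrite pencilC pencil_suml mulr_sumr.
  apply: eq_bigr => j _; rewrite mulrA; congr (_ * _).
  have mK : ((m j).+1 + (m i).+1 < K)%N.
    rewrite addSn addnS (@leq_ltn_trans (\sum_i m i + \sum_i m i).+2) //; last first.
      by near: K; apply: nbhs_infty_gt.
    have le k : (m k <= \sum_i m i)%N by rewrite (bigD1 k) //= leq_addr.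
    by rewrite !ltnS leq_add.
  rewrite /pencil (form1_past u0 uS mK) (form0_past u0 uS (ltnW mK)).
  by rewrite addSn addnS (addnC (m j)).
have xg : pencil K x geom @[K --> \oo] --> P.
  under eq_fun do rewrite pencil_suml.
  apply: cvg_sumr => i; apply: cvgM; first exact: cvg_cst.
  apply: cvgD; apply: cvgM; try exact: cvg_cst.
    exact: cvg_form1_past.
  exact: cvg_form0_past.
have gg : pencil K geom geom @[K --> \oo] --> (p + q * z) * V.
  rewrite mulrDl -mulrA; apply: cvgD; apply: cvgM; try exact: cvg_cst.
    exact: cvg_form1_geom.
  exact: cvg_form0_geom.
rewrite (_ : (fun K => _) = fun K => pencil K x x - 2 * t * pencil K x geom
   + t ^+ 2 * pencil K geom geom); last first.
  apply/funext => K; rewrite pencilBl (pencilC K x) (pencilC K geom) !pencilBl.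
  by rewrite (pencilC K geom x); ring.
apply: cvgD; last by apply: cvgM; [exact: cvg_cst|].
by apply: cvgB => //; apply: cvgM; [exact: cvg_cst|].
Unshelve. all: by end_near. Qed.

Hypothesis W_gt0 : 0 < (p + q * z) * V.

Lemma psd_pencil_ineq : (forall K y, 0 <= pencil K y y) ->
  P ^+ 2 <= (p + q * z) * V * S.
Proof.
move=> psd; have := W_gt0; set W := _ * V => W0.
(* t = P / W minimises the quadratic S - 2 t P + t^2 W. *)
have h : 0 <= S - 2 * (P / W) * P + (P / W) ^+ 2 * W.
  have h0 := @cvg_pencil (P / W); rewrite -/W in h0.
  by apply: (cvgr_to_ge h0); near=> K; exact: psd.
rewrite -subr_ge0; have := mulr_ge0 (ltW W0) h.
by congr (_ <= _); field; rewrite gt_eqF.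
Unshelve. all: by end_near. Qed.

(* Reversed Cauchy-Schwarz: [x - x 0 *: geom] has zeroth entry 0, where the pencil
   is negative. *)
Lemma lorentz_pencil_ineq : (forall K y, y 0%N = 0 -> pencil K y y <= 0) ->
  (p + q * z) * V * S <= P ^+ 2.
Proof.
move=> lor; have := W_gt0; set W := _ * V => W0.
have h : S - 2 * x 0%N * P + (x 0%N) ^+ 2 * W <= 0.
  have h0 := @cvg_pencil (x 0%N); rewrite -/W in h0.
  apply: (cvgr_to_le h0); near=> K; apply: lor.
  by rewrite /geom expr0 mulr1 subrr.
(* With t = [x 0]: W S <= 2 t P W - t^2 W^2 = P^2 - (P - t W)^2. *)
have := sqr_ge0 (P - x 0%N * W); have := mulr_ge0_le0 (ltW W0) h; nra.
Unshelve. all: by end_near. Qed.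

End GeometricVector.

(** * Power series *)

Section GeoBounded.
Variable R : realType.
Implicit Types (a : nat -> R) (rho z r C : R).

Definition geo_bounded a rho := exists C, forall n, `|a n| * rho ^+ n <= C.

Lemma geometric_dom_cvg a C r : 0 <= r < 1 -> (forall n, `|a n| <= C * r ^+ n) ->
  cvgn (series a).
Proof.
move=> /andP[r0 r1] ar; apply: normed_cvg.
apply: (@series_le_cvg _ _ (geometric C r)) => //=.
- by move=> n; exact: le_trans (ar n).
- by apply: is_cvg_geometric_series; rewrite ger0_norm.
Qed.

Lemma geo_bounded_dom a rho z : 0 < rho -> geo_bounded a rho ->
  exists C, forall n, `|a n * z ^+ n| <= C * (`|z| / rho) ^+ n.
Proof.
move=> rho0 [C aC]; exists C => n.
have := ler_wpM2r (exprn_ge0 n (normr_ge0 z)) (aC n).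
by rewrite normrM normrX expr_div_n mulrA ler_pdivlMr ?exprn_gt0 // mulrAC.
Qed.

Lemma geo_bounded_cvg a rho z : geo_bounded a rho -> `|z| < rho -> cvgn (pseries a z).
Proof.
move=> ab zrho; have rho0 : 0 < rho by exact: le_lt_trans zrho.
have [C aC] := geo_bounded_dom z rho0 ab.
apply: geometric_dom_cvg aC; rewrite divr_ge0 ?(ltW rho0) //=.
by rewrite ltr_pdivrMr // mul1r.
Qed.

Lemma bernoulli_exp (d : R) n : 0 <= d -> 1 + n%:R * d <= (1 + d) ^+ n.
Proof.
move=> d0; elim: n => [|n IH]; first by rewrite mul0r addr0 expr0.
rewrite exprS (le_trans _ (ler_wpM2l _ IH)) ?addr_ge0 //.
have : 0 <= n%:R :> R by [].
by rewrite -natr1; nra.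
Qed.

(** With 1 + d = rho / rho', Bernoulli's inequality 1 + n d <= (1 + d)^n lets the loss of radius pay
    for a linear factor. *)
Lemma geo_bounded_affine a rho rho' (A B : R) : 0 < rho' < rho -> geo_bounded a rho ->
  geo_bounded (fun n => (A + B * n%:R) * a n) rho'.
Proof.
move=> /andP[r0 rr] [C aC].
have rho0 := lt_trans r0 rr.
have C0 : 0 <= C by apply: le_trans (aC 0%N); rewrite expr0 mulr1.
pose d := rho / rho' - 1.
have d0 : 0 < d by rewrite subr_gt0 ltr_pdivlMr // mul1r.
exists ((`|A| + `|B| / d) * C) => n.
have rE : rho ^+ n = (1 + d) ^+ n * rho' ^+ n.
  by rewrite -exprMn; congr (_ ^+ n); rewrite /d; field; rewrite gt_eqF.
have := aC n; rewrite rE mulrCA normrM -mulrA => aCn.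
have p1 := bernoulli_exp n (ltW d0).
have n0 : 0 <= n%:R :> R by [].
have AB : `|A + B * n%:R| <= (`|A| + `|B| / d) * (1 + d) ^+ n.
  apply: le_trans (_ : (`|A| + `|B| / d) * (1 + n%:R * d) <= _); last first.
    by rewrite ler_wpM2l // addr_ge0 // divr_ge0 // ltW.
  apply: le_trans (ler_normD _ _) _; rewrite normrM (ger0_norm n0).
  rewrite (_ : (_ + _) * _ = `|A| + `|B| * n%:R + (`|B| / d + `|A| * (n%:R * d))).
    by rewrite lerDl addr_ge0 ?divr_ge0 ?mulr_ge0 // ltW.
  by field; rewrite gt_eqF.
apply: le_trans (_ : (`|A| + `|B| / d) * (1 + d) ^+ n * (`|a n| * rho' ^+ n) <= _).
  by rewrite ler_wpM2r // mulr_ge0 // exprn_ge0 // ltW.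
by rewrite -mulrA ler_wpM2l // addr_ge0 // divr_ge0 // ltW.
Qed.

Lemma geo_bounded_diffs a rho rho' : 0 < rho' < rho -> geo_bounded a rho ->
  geo_bounded (pseries_diffs a) rho'.
Proof.
move=> rr; have /andP[r0 _] := rr.
move=> /(geo_bounded_affine 0 1 rr)[C aC]; exists (C / rho') => n.
have := aC n.+1; rewrite add0r mul1r /pseries_diffs ler_pdivlMr // exprS.
by rewrite mulrCA mulrC.
Qed.

Lemma is_derive_pseries a rho z : geo_bounded a rho -> `|z| < rho ->
  is_derive z 1 (fun x => limn (pseries a x)) (limn (pseries (pseries_diffs a) z)).
Proof.
move=> ab zrho.
(* Radii between |z| and rho: each of the two differentiations costs some radius before the three
   series are summed at K. *)
pose K := `|z| + (rho - `|z|) / 4; pose K1 := `|z| + (rho - `|z|) / 2.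
pose K2 := `|z| + (rho - `|z|) / 4 * 3.
have z0 := normr_ge0 z.
have ab1 : geo_bounded (pseries_diffs a) K2.
  by apply: geo_bounded_diffs ab; rewrite /K2; lra.
have ab2 : geo_bounded (pseries_diffs (pseries_diffs a)) K1.
  by apply: geo_bounded_diffs ab1; rewrite /K1 /K2; lra.
have KE : `|K| = K by rewrite ger0_norm // /K; lra.
apply: (@pseries_snd_diffs _ _ K).
- by apply: (geo_bounded_cvg ab); rewrite KE /K; lra.
- by apply: (geo_bounded_cvg ab1); rewrite KE /K /K2; lra.
- by apply: (geo_bounded_cvg ab2); rewrite KE /K /K1; lra.
- by rewrite KE /K; lra.
Qed.

Lemma geometric_tail a C r K : 0 <= r < 1 -> 0 <= C -> (forall n, `|a n| <= C * r ^+ n) ->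
  `|limn (series a) - series a K| <= C * r ^+ K / (1 - r).
Proof.
move=> r01 C0 ar; have cv := geometric_dom_cvg r01 ar.
have /andP[r0 r1] := r01.
have : `|series a n - series a K| @[n --> \oo] --> `|limn (series a) - series a K|.
  by apply: cvg_norm; apply: cvgB; [exact: cv|exact: cvg_cst].
move/cvgr_to_le; apply; near=> n.
have Kn : (K <= n)%N by near: n; exact: nbhs_infty_ge.
rewrite sub_series_geq // (le_trans (ler_norm_sum _ _ _)) //.
apply: le_trans (_ : \sum_(K <= k < n) C * r ^+ k <= _).
  by apply: ler_sum => k _; exact: ar.
rewrite -(subnKC Kn) -mulr_sumr geometric_partial_tail -mulrA ler_wpM2l //.
have [->|r0'] := eqVneq r 0.
  rewrite /series /geometric /=; case: (n - K)%N => [|k].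
    by rewrite big_nil divr_ge0 ?exprn_ge0 ?subr0.
  rewrite big_nat_recl // expr0 mulr1 big1 ?addr0 ?subr0 ?divr1 // => i _.
  by rewrite exprS mul0r mulr0.
by apply: geometric_le_lim; [exact: exprn_ge0|rewrite lt_neqAle eq_sym r0'|rewrite ger0_norm].
Unshelve. all: by end_near. Qed.

(** Dominated convergence for series: heads converge as finite sums, and both tails lie below the
    same geometric tail. *)
Lemma tannery (a : nat -> nat -> R) (l : nat -> R) C r : 0 <= r < 1 ->
  (forall k, a N k @[N --> \oo] --> l k) ->
  (\forall N \near \oo, forall k, `|a N k| <= C * r ^+ k) ->
  limn (series (a N)) @[N --> \oo] --> limn (series l).
Proof.
move=> r01 al aC; have /andP[r0 r1] := r01.
have C0 : 0 <= C.
  have [N _ /(_ N (leqnn N) 0%N)] := aC.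
  by rewrite expr0 mulr1; exact: le_trans.
have lC k : `|l k| <= C * r ^+ k.
  apply: (cvgr_to_le (cvg_norm (al k))); near=> N.
  have : forall k, `|a N k| <= C * r ^+ k by near: N.
  exact.
apply/cvgrPdist_le => e e0.
have tail0 : C * r ^+ K / (1 - r) @[K --> \oo] --> 0.
  rewrite (_ : 0 = C * 0 / (1 - r)); last by rewrite mulr0 mul0r.
  apply: cvgM; last exact: cvg_cst.
  by apply: cvgM; [exact: cvg_cst|apply: cvg_expr; rewrite ger0_norm].
have e3 : 0 < e / 3 by lra.
have /cvgrPdist_le/(_ _ e3)[K _ /(_ K (leqnn K))] := tail0.
rewrite sub0r normrN => /(le_trans (ler_norm _)) tK.
have : series (a N) K @[N --> \oo] --> series l K.
  by apply: cvg_sumr => k; exact: al.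
move/cvgrPdist_le/(_ _ e3) => sK; near=> N.
have tN : `|limn (series (a N)) - series (a N) K| <= e / 3.
  apply: le_trans tK; apply: geometric_tail => //; near: N; exact: aC.
have tl : `|limn (series l) - series l K| <= e / 3.
  by apply: le_trans tK; exact: geometric_tail.
have sN : `|series l K - series (a N) K| <= e / 3 by near: N; exact: sK.
rewrite (_ : _ - _ = (limn (series l) - series l K) + (series l K - series (a N) K)
  - (limn (series (a N)) - series (a N) K)); last by ring.
apply: le_trans (ler_normB _ _) _; apply: le_trans (lerD (ler_normD _ _) (lexx _)) _.
by lra.
Unshelve. all: by end_near. Qed.

End GeoBounded.

(** * The binomial series *)

Section BinomialSeries.
Variable R : realType.

Lemma geo_bounded_negbin (s rho : R) : 0 <= s <= 2 -> 0 < rho < 1 ->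
  geo_bounded (negbin s) rho.
Proof.
move=> s02 rho01; have : geo_bounded (fun _ : nat => 1 : R) 1.
  by exists 1 => n; rewrite normr1 mul1r expr1n.
move=> /(geo_bounded_affine 1 1 rho01)[C hC]; exists C => n.
apply: le_trans (hC n); rewrite mulr1 mul1r.
have /andP[s0 s2] := s02; have /andP[r0 _] := rho01.
rewrite ger0_norm ?negbin_ge0 // ler_wpM2r ?exprn_ge0 ?(ltW r0) // nat1r -negbin2.
by rewrite (le_trans (ler_negbin n s02)) // ler_norm.
Qed.

(** The sum y solves (1 - x) y' = s y, so y (1 - x)^s is constant on [0, z]. The bound s <= 2 keeps
    the coefficients below those of (1 - x)^(-2), namely n + 1. *)
Lemma binomial_series (s z : R) : 0 < s <= 2 -> 0 <= z < 1 ->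
  pseries (negbin s) z @ \oo --> (1 - z) `^ (- s).
Proof.
move=> /andP[s0 s2] /andP[z0 z1].
have s02 : 0 <= s <= 2 by rewrite (ltW s0).
have gb (x : R) : `|x| < 1 -> exists2 rho, geo_bounded (negbin s) rho & `|x| < rho.
  move=> x1; exists ((`|x| + 1) / 2); last lra.
  by apply: geo_bounded_negbin => //; have := normr_ge0 x; lra.
pose y (x : R) : R := limn (pseries (negbin s) x).
have cvy x : `|x| < 1 -> pseries (negbin s) x @ \oo --> y x.
  by move=> /gb[rho h xr]; exact: (geo_bounded_cvg h xr).
have dy (x : R) : `|x| < 1 -> is_derive x 1 y (s / (1 - x) * y x).
  move=> x1; have [rho h xr] := gb _ x1.
  have dx := is_derive_pseries h xr; rewrite -/y in dx.
  have x1' : 1 - x != 0 by rewrite gt_eqF // subr_gt0; move/ltr_normlP: x1 => [].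
  suff -> : s / (1 - x) * y x = limn (pseries (pseries_diffs (negbin s)) x) by [].
  have r0 : 0 < rho by exact: le_lt_trans xr.
  pose rho' := (`|x| + rho) / 2.
  have h' : geo_bounded (pseries_diffs (negbin s)) rho'.
    by apply: geo_bounded_diffs h; rewrite /rho'; have := normr_ge0 x; lra.
  have cv : cvgn (pseries (pseries_diffs (negbin s)) x).
    by apply: (geo_bounded_cvg h'); rewrite /rho'; lra.
  apply: (mulfI x1'); rewrite mulrA mulrCA divff // mulr1.
  set D := limn _.
  (* Partial sums satisfy the equation up to the boundary term x^n (n+1) c_(n+1), which tends to 0
     as the general term of a convergent series. *)
  have t0 : x ^+ n * (n.+1%:R * negbin s n.+1) @[n --> \oo] --> 0.
    have := cvg_series_cvg_0 cv; apply: cvg_trans; apply: near_eq_cvg.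
    by near=> n; rewrite /pseries_diffs mulrC.
  have : (1 - x) * pseries (pseries_diffs (negbin s)) x n +
      x ^+ n * (n.+1%:R * negbin s n.+1) @[n --> \oo] --> (1 - x) * D + 0.
    by apply: cvgD => //; apply: cvgM => //; exact: cvg_cst.
  rewrite addr0 => h1; apply/esym; apply: (cvg_unique _ h1) => //.
  have : s * pseries (negbin s) x n.+1 @[n --> \oo] --> s * y x.
    apply: cvgM; first exact: cvg_cst.
    by rewrite (cvg_shiftS (pseries (negbin s) x)); exact: cvy.
  apply: cvg_trans; apply: near_eq_cvg; near=> n.
  elim: (n) => [|k IH].
    rewrite /pseries /series /= big_nil big_nat1 mulr0 add0r expr0 !mulr1 mul1r.
    by rewrite (negbin_shift s 0) !negbin0.
  move: IH; rewrite /pseries /series /= [\sum_(0 <= i < k.+2) _]big_nat_recr //=.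
  rewrite [\sum_(0 <= i < k.+1) (pseries_diffs _ _ * _)]big_nat_recr //= => IH.
  rewrite [s * (_ + _)]mulrDr IH [in RHS](mulrDr (1 - x)).
  by rewrite /pseries_diffs (negbinS s k.+1) exprS -natr1; ring.
pose w (x : R) : R := y x * (1 - x) `^ s.
have dw (x : R) : `|x| < 1 -> is_derive x 1 w 0.
  move=> x1; have x1' : 0 < 1 - x by rewrite subr_gt0; move/ltr_normlP: x1 => [].
  have d1 := dy _ x1.
  have d2 : is_derive x 1 (fun x => (1 - x) `^ s) (s * (1 - x) `^ (s - 1) * -1).
    apply: (@is_derive1_comp _ (fun a : R => a `^ s) (fun x : R => 1 - x) _ _ _ (is_derive1_powR s x1')).
    by rewrite -[X in is_derive _ _ _ X]sub0r; apply: is_deriveB.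
  have := is_deriveM d1 d2; congr (is_derive _ _ _ _).
  rewrite /GRing.scale /= powRB ?(gt_eqF x1') ?implybT //.
  by rewrite powRr1 ?(ltW x1') //; field; rewrite gt_eqF.
have y0 : y 0 = 1.
  apply: cvg_lim => //; rewrite -cvg_shiftS; apply: cvg_near_cst; near=> n.
  rewrite /pseries /series /= big_nat_recl //= negbin0 expr0 mulr1.
  by rewrite big1 ?addr0 // => i _; rewrite exprS mul0r mulr0.
have wz : w z = 1.
  have <- : w 0 = 1 by rewrite /w y0 subr0 powR1 mulr1.
  have [->//|z_neq0] := eqVneq z 0.
  have z_gt0 : 0 < z by rewrite lt_neqAle eq_sym z_neq0.
  have [||c _ /eqP] := @MVT _ w (fun=> 0) 0 z z_gt0.
  - by move=> x; rewrite in_itv /= => /andP[x0 xz]; apply: dw; rewrite ger0_norm ?(lt_trans xz) // ltW.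
  - apply: derivable_within_continuous => x; rewrite in_itv /= => /andP[x0 xz].
    by apply: (@ex_derive _ _ _ _ _ _ 0); apply: dw; rewrite ger0_norm ?(le_lt_trans xz).
  - by rewrite mul0r subr_eq0 => /eqP.
have z1' : 0 < 1 - z by rewrite subr_gt0.
suff <- : y z = (1 - z) `^ (- s) by apply: cvy; rewrite ger0_norm.
have ps : (1 - z) `^ s != 0 by rewrite gt_eqF // powR_gt0.
by apply: (mulIf ps); rewrite -/(w z) wz powRN mulVf.
Unshelve. all: by end_near. Qed.

End BinomialSeries.

(** * Gamma and Beta integrals *)

Section Exhaustion.
Variable R : realType.
Local Notation mu := (@lebesgue_measure R).

Definition exhausts (D : set R) (a b : nat -> R) :=
  [/\ (forall n, a n.+1 <= a n), (forall n, b n <= b n.+1), (forall n, a n < b n) &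
    D = \bigcup_n `[a n, b n]%classic].

Lemma exhausts_cvg D a b (f : R -> R) : exhausts D a b -> measurable_fun setT f ->
  (forall x, D x -> 0 <= f x) ->
  (\int[mu]_(x in `[a n, b n]) (f x)%:E)%E @[n --> \oo] --> (\int[mu]_(x in D) (f x)%:E)%E.
Proof.
move=> [da ib ab DE] mf f0; rewrite DE; apply: ge0_nondecreasing_set_cvg_integral => //=.
- apply/nondecreasing_seqP => n; apply/subsetPset => x /=; rewrite !in_itv /= => /andP[h1 h2].
  by rewrite (le_trans (da n)) //= (le_trans h2).
- move=> n; apply/measurable_EFinP; exact: measurable_funTS.
- by move=> n x abx; rewrite lee_fin f0 // DE; exists n.
Qed.

Lemma exhausts_FTC D a b (F f : R -> R) n : exhausts D a b ->
  (forall x, D x -> is_derive x 1 F (f x)) ->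
  (forall x, D x -> derivable f x 1) ->
  (\int[mu]_(x in `[a n, b n]) (f x)%:E)%E = (F (b n) - F (a n))%:E.
Proof.
move=> [da ib ab DE] dF df; have sub x : x \in `[a n, b n] -> D x.
  by move=> xab; rewrite DE; exists n.
rewrite (@continuous_FTC2 _ f F) //.
- by apply: derivable_within_continuous => x /sub; exact: df.
- have cF : {within `[a n, b n], continuous F}.
    by apply: derivable_within_continuous => x /sub /dF h; exact: (@ex_derive _ _ _ _ _ _ _ h).
  have [_ ? ?] := (continuous_within_itvP _ (ab n)).1 cF; split => // x xab.
  by apply: (@ex_derive _ _ _ _ _ _ (f x)); apply: dF; apply: sub; exact: subset_itv_oo_cc xab.
- move=> x xab; rewrite derive1E; apply: derive_val; apply: dF; apply: sub.
  exact: subset_itv_oo_cc xab.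
Qed.

Lemma ge0_FTC_exhausts D a b (F f : R -> R) (l : R) : exhausts D a b ->
  measurable_fun setT f -> (forall x, D x -> 0 <= f x) ->
  (forall x, D x -> is_derive x 1 F (f x)) ->
  (forall x, D x -> derivable f x 1) ->
  F (b n) - F (a n) @[n --> \oo] --> l ->
  (\int[mu]_(x in D) (f x)%:E)%E = l%:E.
Proof.
move=> Dab mf f0 dF df Fl; have := exhausts_cvg Dab mf f0.
rewrite (_ : (fun n => _) = (fun n => (F (b n) - F (a n))%:E)); last first.
  by apply/funext => n; exact: exhausts_FTC Dab dF df.
move=> h; apply: cvg_unique h _; first exact: ereal_hausdorff.
by apply: cvg_EFin => //; near=> n.
Unshelve. all: by end_near. Qed.

(** In an integration by parts F' has no constant sign. Written as a difference of nonnegative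
    functions with known finite integrals, it is handled by monotone convergence on each of them. *)
Lemma FTC_exhausts D a b (F f1 f2 : R -> R) (l I1 I2 : R) : exhausts D a b ->
  measurable_fun setT f1 -> measurable_fun setT f2 ->
  (forall x, D x -> 0 <= f1 x) -> (forall x, D x -> 0 <= f2 x) ->
  (\int[mu]_(x in D) (f1 x)%:E)%E = I1%:E -> (\int[mu]_(x in D) (f2 x)%:E)%E = I2%:E ->
  (forall x, D x -> is_derive x 1 F (f1 x - f2 x)) ->
  (forall x, D x -> derivable f1 x 1) -> (forall x, D x -> derivable f2 x 1) ->
  F (b n) - F (a n) @[n --> \oo] --> l ->
  I1 - I2 = l.
Proof.
move=> Dab mf1 mf2 f10 f20 If1 If2 dF df1 df2 Fl.
have := cvgeB _ (exhausts_cvg Dab mf1 f10) (exhausts_cvg Dab mf2 f20).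
rewrite If1 If2 => /(_ _ isT).
rewrite (_ : (fun n => _) = (fun n => (F (b n) - F (a n))%:E)).
  move=> h; apply: EFin_inj; rewrite EFinB; apply: cvg_unique h _; first exact: ereal_hausdorff.
  by apply: cvg_EFin => //; near=> n.
apply/funext => n.
rewrite -(exhausts_FTC n Dab dF); last by move=> x Dx; apply: derivableB; [exact: df1|exact: df2].
have [_ _ ab DE] := Dab; have sub x : `[a n, b n]%classic x -> D x by move=> xab; rewrite DE; exists n.
have int g : (forall x, D x -> derivable g x 1) -> mu.-integrable `[a n, b n] (EFin \o g).
  move=> dg; apply: continuous_compact_integrable; first exact: segment_compact.
  by apply: derivable_within_continuous => x xab; apply: dg; exact: sub.
by rewrite -integralB_EFin //; exact: int.
Unshelve. all: by end_near. Qed.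

Lemma exhausts_0y : exhausts `]0, +oo[%classic (fun n => n.+2%:R^-1) (fun n => n.+2%:R).
Proof.
split => [n|n|n|].
- by rewrite lef_pV2 ?posrE // ler_nat.
- by rewrite ler_nat.
- by rewrite (@lt_trans _ _ 1) ?invf_lt1 ?ltr1n // ltr1n.
- apply/seteqP; split => [x|x [n _]] /=; rewrite !in_itv /=; last first.
    by rewrite andbT => /andP[+ _]; apply: lt_le_trans; rewrite invr_gt0.
  rewrite andbT => x0; exists (Num.bound (x + x^-1)) => //=; rewrite in_itv /=.
  have /ltW := archi_boundP (addr_ge0 (ltW x0) (ltW (divr_gt0 ltr01 x0))).
  rewrite div1r; set N := Num.bound _ => h.
  have NN : N%:R <= N.+2%:R :> R by rewrite ler_nat -addn2 leq_addr.
  have x0' : 0 < x^-1 by rewrite invr_gt0.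
  apply/andP; split; last by lra.
  by rewrite -[x]invrK lef_pV2 ?posrE //; lra.
Qed.

(** The 3 makes the segments nondegenerate from n = 0 on, as 2 x / 3 < x. *)
Lemma exhausts_0x (x : R) : 0 < x ->
  exhausts `]0, x[%classic (fun n => x / n.+3%:R) (fun n => x - x / n.+3%:R).
Proof.
move=> x0; have le n : x / n.+4%:R <= x / n.+3%:R.
  by rewrite ler_pM2l // lef_pV2 ?posrE // ler_nat.
split => [//|n|n|]; first by rewrite lerD2l lerN2.
  rewrite ltrBrDr -mulrDl ltr_pdivrMr //.
  by have : 3 <= n.+3%:R :> R by [rewrite ler_nat]; nra.
apply/seteqP; split => [y|y [n _]] /=; rewrite !in_itv /=; last first.
  move=> /andP[h1 h2]; apply/andP; split.
    by apply: lt_le_trans h1; rewrite divr_gt0.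
  by apply: le_lt_trans h2 _; rewrite ltrBlDr ltrDl divr_gt0.
move=> /andP[y0 yx]; pose d := Num.min y (x - y).
have d0 : 0 < d by rewrite lt_min y0 subr_gt0.
exists (Num.bound (x / d)) => //=; rewrite in_itv /=.
have /ltW := archi_boundP (divr_ge0 (ltW x0) (ltW d0)).
set N := Num.bound _ => h.
have : x / N.+3%:R <= d.
  rewrite ler_pdivrMr // mulrC -ler_pdivrMr //; apply: le_trans h _.
  by rewrite ler_nat -addn3 leq_addr.
by rewrite /d le_min lerBrDr => /andP[-> ]; rewrite /= lerBrDr addrC.
Qed.

End Exhaustion.

Lemma is_derive_derivable (R : realType) (f : R -> R) (x d : R) :
  is_derive x 1 f d -> derivable f x 1.
Proof. by case. Qed.

Lemma derivable_cvg_seq (R : realType) (f : R -> R) (u : nat -> R) (l : R) :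
  derivable f l 1 -> u @ \oo --> l -> f (u n) @[n --> \oo] --> f l.
Proof.
move=> /derivable1_diffP/differentiable_continuous cf ul.
exact: (cvg_comp _ _ ul cf).
Qed.

Lemma cvg_invS2 (R : realType) : (n.+2%:R^-1 : R) @[n --> \oo] --> (0 : R).
Proof. by rewrite (cvg_shiftS (@harmonic R)); exact: cvg_harmonic. Qed.

Lemma cvg_invS3 (R : realType) : (n.+3%:R^-1 : R) @[n --> \oo] --> (0 : R).
Proof. by rewrite (cvg_shiftS (fun n => n.+2%:R^-1 : R)); exact: cvg_invS2. Qed.

Lemma cvg_powR_seq0 (R : realType) (u : nat -> R) (s : R) : 0 < s ->
  (forall n, 0 < u n) -> u @ \oo --> (0 : R) -> u n `^ s @[n --> \oo] --> (0 : R).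
Proof. by move=> s0 u0 ul; move/cvg_at_rightP: (powR_cvg0 s0); apply. Qed.

Lemma cvg_powR_seq (R : realType) (u : nat -> R) (s l : R) : 0 < l ->
  u @ \oo --> l -> u n `^ s @[n --> \oo] --> l `^ s.
Proof.
move=> l0 ul; apply: (@derivable_cvg_seq _ (fun x => x `^ s) u l _ ul).
exact: is_derive_derivable (is_derive1_powR s l0).
Qed.

(** * Finiteness, lower bound and functional equation of Gamma *)

Section GammaFunction.
Variable R : realType.
Local Notation mu := (@lebesgue_measure R).
Implicit Types s t u x : R.

Definition gamma_fun s t : R := t `^ (s - 1) * expR (- t).

Lemma measurable_gamma_fun s : measurable_fun setT (gamma_fun s).
Proof.
apply: measurable_funM; first exact: measurable_powR.
by apply: measurableT_comp => //; exact: measurable_expR.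
Qed.

Lemma gamma_fun_ge0 s t : 0 <= gamma_fun s t.
Proof. by rewrite mulr_ge0 ?powR_ge0 ?expR_ge0. Qed.

Lemma is_derive_expRN t : is_derive t 1 (fun x => expR (- x)) (- expR (- t)).
Proof.
have := @is_derive1_comp _ expR (fun x : R => - x) t _ (-1) (is_derive_expR _) _.
by rewrite mulrN1; apply; exact: is_deriveN.
Qed.

Lemma is_derive_gamma_fun s t : 0 < t ->
  is_derive t 1 (gamma_fun (s + 1)) (s * gamma_fun s t - gamma_fun (s + 1) t).
Proof.
move=> t0; have := is_deriveM (is_derive1_powR (s + 1 - 1) t0) (is_derive_expRN t).
congr (is_derive _ _ _ _); rewrite /GRing.scale /= /gamma_fun addrK; ring.
Qed.

Lemma derivable_gamma_fun s t : 0 < t -> derivable (gamma_fun s) t 1.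
Proof. by move=> t0; rewrite -(subrK 1 s); apply: is_derive_derivable (is_derive_gamma_fun _ t0). Qed.

(** From e^(t/(s+1)) >= 1 + t/(s+1). The majorant is integrable at both ends and has the elementary
    primitive s^-1 (t / (1 + t))^s, up to the constant. *)
Lemma gamma_fun_le s t : 0 < s -> 0 < t ->
  gamma_fun s t <= (s + 1) `^ (s + 1) * (t `^ (s - 1) * (1 + t) `^ (- (s + 1))).
Proof.
move=> s0 t0; rewrite mulrCA ler_wpM2l ?powR_ge0 //.
have s1 : 0 < s + 1 by lra.
have t1 : 0 < 1 + t by lra.
have sn : s + 1 != 0 by rewrite gt_eqF.
rewrite powRN ler_pdivlMr ?powR_gt0 // expRN mulrC ler_pdivrMr ?expR_gt0 //.
have -> : expR t = expR (t / (s + 1)) `^ (s + 1).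
  by rewrite -expRM divfK.
rewrite -powRM ?(ltW s1) ?expR_ge0 // ge0_ler_powR ?nnegrE ?(ltW s1) ?(ltW t1) //.
  by rewrite mulr_ge0 ?expR_ge0 ?(ltW s1).
apply: le_trans (_ : (s + 1) * (1 + t / (s + 1)) <= _).
  by rewrite mulrDr mulr1 mulrC divfK //; lra.
by rewrite ler_wpM2l ?(ltW s1) ?expR_ge1Dx.
Qed.

Lemma Gamma_fin s : 0 < s -> (\int[mu]_(t in `]0%R, +oo[) (gamma_fun s t)%:E)%E = (Gamma s)%:E.
Proof.
move=> s0; rewrite /Gamma /Rintegral fineK // ge0_fin_numE; last first.
  by apply: integral_ge0 => t _; rewrite lee_fin gamma_fun_ge0.
pose g t : R := t `^ (s - 1) * (1 + t) `^ (- (s + 1)).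
pose G t : R := s^-1 * (t / (1 + t)) `^ s.
have mg : measurable_fun setT g.
  apply: measurable_funM; first exact: measurable_powR.
  apply: (measurableT_comp (measurable_powR _)).
  exact: measurable_funD.
have d1 t : is_derive t 1 (fun x : R => 1 + x) 1.
  by rewrite -[X in is_derive _ _ _ X]add0r; exact: is_deriveD.
have dG t : 0 < t -> is_derive t 1 G (g t).
  move=> t0; have t1 : 0 < 1 + t by rewrite ltr_wpDl.
  have t1' : 1 + t != 0 by rewrite gt_eqF.
  have dq := is_deriveM (is_derive_id t (1 : R)) (is_deriveV t1' (d1 t)).
  have := is_deriveZ s^-1 (@is_derive1_comp _ (fun a : R => a `^ s) (fun t : R => t / (1 + t)) t _ _
    (is_derive1_powR s (divr_gt0 t0 t1)) dq).
  congr (is_derive _ _ _ _); rewrite /GRing.scale /= /g.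
  have -> : (1 + t) `^ (- (s + 1)) = (1 + t) `^ (- (s - 1)) / (1 + t) ^+ 2.
    rewrite -(powR_invn 2 (ltW t1)) -powRD ?t1' ?implybT //.
    by congr (_ `^ _); ring.
  rewrite powRM ?invr_ge0 ?(ltW t0) ?(ltW t1) // -(powR_inv1 (ltW t1)) -powRrM mulN1r.
  rewrite powR_inv1 ?(ltW t1) //.
  by field; rewrite t1' gt_eqF.
have dg t : 0 < t -> derivable g t 1.
  move=> t0; have t1 : 0 < 1 + t by rewrite ltr_wpDl.
  apply: derivableM; first exact: is_derive_derivable (is_derive1_powR _ t0).
  by apply: is_derive_derivable (@is_derive1_comp _ (fun a : R => a `^ _) (fun x : R => 1 + x) t _ _
    (is_derive1_powR _ t1) (d1 t)).
have ig : (\int[mu]_(t in `]0%R, +oo[) (g t)%:E)%E = (s^-1)%:E.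
  apply: (ge0_FTC_exhausts (F := G) (exhausts_0y R) mg) => [t _|t|t|].
  - by rewrite mulr_ge0 ?powR_ge0.
  - by rewrite /= in_itv /= andbT; exact: dG.
  - by rewrite /= in_itv /= andbT; exact: dg.
  have s0' : s != 0 by rewrite gt_eqF.
  rewrite (_ : s^-1 = s^-1 * 1 `^ s - s^-1 * 0); last by rewrite powR1; ring.
  apply: cvgB; apply: cvgM; try exact: cvg_cst.
    apply: cvg_powR_seq => //.
    rewrite (_ : (fun n => _) = (fun n => 1 - (n.+3%:R^-1 : R))); last first.
      apply/funext => n; rewrite -[n.+3%:R]nat1r; have : 0 < n.+2%:R :> R by [].
      by move: n.+2%:R => m m0; field; rewrite gt_eqF // addr_gt0.
    rewrite -[X in _ --> X]subr0; apply: cvgB; first exact: cvg_cst.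
    exact: cvg_invS3.
  apply: cvg_powR_seq0 => //.
  rewrite (_ : (fun n => _) = (fun n => (n.+3%:R^-1 : R))); first exact: cvg_invS3.
  apply/funext => n; rewrite -[n.+3%:R]nat1r; have : 0 < n.+2%:R :> R by [].
  move: n.+2%:R => m m0; field.
  by rewrite (gt_eqF m0) (gt_eqF (addr_gt0 ltr01 m0)).
apply: le_lt_trans (_ : (\int[mu]_(t in `]0%R, +oo[) (((s + 1) `^ (s + 1))%:E * (g t)%:E) < +oo)%E).
  apply: ge0_le_integral => //=.
  - by move=> t _; rewrite lee_fin gamma_fun_ge0.
  - apply/measurable_EFinP; apply: measurable_funTS; exact: measurable_gamma_fun.
  - apply/measurable_EFinP; apply: measurable_funTS; exact: measurable_funM.
  - move=> t; rewrite in_itv /= andbT => t0; rewrite -EFinM lee_fin.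
    exact: gamma_fun_le.
rewrite ge0_integralZl_EFin //=.
- by rewrite ig -EFinM ltry.
- by move=> t _; rewrite lee_fin mulr_ge0 ?powR_ge0.
- by apply/measurable_EFinP; apply: measurable_funTS.
- by rewrite powR_ge0.
Qed.

(** Keep only the interval [x, x+1], where t^(s-1) = t^s / t >= x^s / (x+1). As x is free, Gamma
    outgrows every exponential in s, which makes the Mittag-Leffler series entire. *)
Lemma Gamma_lower s x : 0 < s -> 0 < x -> x `^ s * expR (- (x + 1)) / (x + 1) <= Gamma s.
Proof.
move=> s0 x0; rewrite -lee_fin -Gamma_fin //.
have x1 : 0 < x + 1 by lra.
apply: (@le_trans _ _ (\int[mu]_(t in `[x, (x + 1)%R]) (gamma_fun s t)%:E)%E); last first.
  apply: ge0_subset_integral => //=.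
  - by apply/measurable_EFinP; apply: measurable_funTS; exact: measurable_gamma_fun.
  - by move=> t _; rewrite lee_fin gamma_fun_ge0.
  - by move=> t /=; rewrite !in_itv /= andbT => /andP[+ _]; exact: lt_le_trans.
apply: (@le_trans _ _ (\int[mu]_(t in `[x, (x + 1)%R]) (x `^ s * expR (- (x + 1)) / (x + 1))%:E)%E).
  rewrite integral_cst //= lebesgue_measure_itv /= lte_fin ltrDl ltr01.
  by rewrite -EFinB addrAC subrr add0r mule1.
apply: ge0_le_integral => //=.
- by move=> t _; rewrite lee_fin !mulr_ge0 ?powR_ge0 ?expR_ge0 // invr_ge0 ltW.
- by apply/measurable_EFinP; apply: measurable_funTS; exact: measurable_gamma_fun.
move=> t; rewrite in_itv /= => /andP[xt tx].
have t0 : 0 < t by exact: lt_le_trans xt.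
rewrite lee_fin /gamma_fun mulrAC ler_pM ?expR_ge0 //.
- by rewrite divr_ge0 ?powR_ge0 // ltW.
- rewrite ler_pdivrMr //; apply: le_trans (_ : t `^ s <= _).
    by rewrite ge0_ler_powR ?nnegrE ?(ltW s0) ?(ltW x0) ?(ltW t0).
  by rewrite -(mulr_powRB1 (ltW t0) s0) mulrC ler_wpM2l ?powR_ge0.
- by rewrite ler_expR lerN2.
Qed.

Lemma Gamma_gt0 s : 0 < s -> 0 < Gamma s.
Proof.
move=> s0; apply: lt_le_trans (Gamma_lower s0 ltr01).
by rewrite divr_gt0 ?mulr_gt0 ?powR_gt0 ?expR_gt0 ?addr_gt0.
Qed.

Lemma cvg_gamma_fun_infty s : 0 < s -> gamma_fun (s + 1) n.+2%:R @[n --> \oo] --> (0 : R).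
Proof.
move=> s0.
have h : (s + 2) `^ (s + 2) * n.+2%:R^-1 @[n --> \oo] --> (s + 2) `^ (s + 2) * 0.
  by apply: cvgM; [exact: cvg_cst|exact: cvg_invS2].
rewrite mulr0 in h; apply: (squeeze_cvgr _ (cvg_cst 0) h); near=> n.
rewrite gamma_fun_ge0 /=; have n0 : 0 < n.+2%:R :> R by [].
have s1 : 0 < s + 1 by lra.
apply: le_trans (gamma_fun_le s1 n0) _; rewrite -addrA.
rewrite ler_wpM2l ?powR_ge0 // addrK.
have n1 : 0 < 1 + n.+2%:R :> R by rewrite ltr_wpDl.
apply: le_trans (_ : (1 + n.+2%:R) `^ s * (1 + n.+2%:R) `^ (- (s + 2)) <= _).
  by rewrite ler_wpM2r ?powR_ge0 // ge0_ler_powR ?nnegrE ?(ltW s0) ?(ltW n1) // lerDr.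
rewrite -powRD ?(gt_eqF n1) ?implybT // (_ : s + - (s + 2) = - 2%:R); last by ring.
rewrite powR_invn ?(ltW n1) // lef_pV2 ?posrE ?exprn_gt0 //.
by rewrite (@le_trans _ _ (1 + n.+2%:R)) ?lerDr // ler_eXnr // lerDl.
Unshelve. all: by end_near. Qed.

Lemma GammaS s : 0 < s -> Gamma (s + 1) = s * Gamma s.
Proof.
move=> s0; apply/eqP; rewrite -subr_eq0; apply/eqP.
have s1 : 0 < s + 1 by lra.
rewrite -[X in _ = X]oppr0 -[LHS]opprB; congr (- _).
apply: (FTC_exhausts (F := gamma_fun (s + 1)) (f1 := fun t => s * gamma_fun s t)
  (f2 := gamma_fun (s + 1)) (exhausts_0y R)).
- by apply: measurable_funM => //; exact: measurable_gamma_fun.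
- exact: measurable_gamma_fun.
- by move=> t _; rewrite mulr_ge0 ?gamma_fun_ge0 // ltW.
- by move=> t _; exact: gamma_fun_ge0.
- under eq_integral do rewrite EFinM.
  rewrite ge0_integralZl_EFin ?ltW //= ?Gamma_fin //.
  + by move=> t _; rewrite lee_fin gamma_fun_ge0.
  + by apply/measurable_EFinP; apply: measurable_funTS; exact: measurable_gamma_fun.
- exact: Gamma_fin.
- by move=> t; rewrite /= in_itv /= andbT => t0; exact: is_derive_gamma_fun.
- move=> t; rewrite /= in_itv /= andbT => t0; apply: derivableM => //.
  exact: derivable_gamma_fun.
- by move=> t; rewrite /= in_itv /= andbT => t0; exact: derivable_gamma_fun.
rewrite -[X in _ --> X]subr0; apply: cvgB; first exact: cvg_gamma_fun_infty.
rewrite /gamma_fun addrK -[X in _ --> X](mul0r (expR (- 0))); apply: cvgM.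
  by apply: cvg_powR_seq0 => //; exact: cvg_invS2.
apply: (@derivable_cvg_seq _ (fun x => expR (- x))); last exact: cvg_invS2.
exact: is_derive_derivable (is_derive_expRN 0).
Qed.

Lemma Gamma1 : Gamma (1 : R) = 1.
Proof.
apply: EFin_inj; rewrite -Gamma_fin //.
apply: (ge0_FTC_exhausts (F := fun t => - expR (- t)) (exhausts_0y R)).
- exact: measurable_gamma_fun.
- by move=> t _; exact: gamma_fun_ge0.
- move=> t _; have := is_deriveN (is_derive_expRN t).
  by rewrite opprK /gamma_fun subrr powRr0 mul1r.
- by move=> t; rewrite /= in_itv /= andbT => t0; exact: derivable_gamma_fun.
have h : expR (- n.+2%:R) @[n --> \oo] --> (0 : R).
  have := @cvg_gamma_fun_infty 1 ltr01; apply: (squeeze_cvgr _ (cvg_cst 0)).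
  near=> n; rewrite expR_ge0 /= /gamma_fun addrK powRr1 // ler_peMl ?expR_ge0 //.
  by rewrite ler1n.
have e : - 0 - - expR (- 0) = 1 :> R by rewrite oppr0 expR0; ring.
rewrite -[X in _ --> X]e.
apply: cvgB; apply: cvgN => //.
apply: (@derivable_cvg_seq _ (fun x => expR (- x))); last exact: cvg_invS2.
exact: is_derive_derivable (is_derive_expRN 0).
Unshelve. all: by end_near. Qed.

Lemma Gamma_natS n : Gamma (n.+1%:R : R) = n`!%:R.
Proof.
elim: n => [|n IH]; first exact: Gamma1.
by rewrite -natr1 GammaS // IH factS natrM.
Qed.

End GammaFunction.

(** * Bohr-Mollerup: asymptotics and uniqueness from log-convexity *)

Section BohrMollerup.
Variable R : realType.
Local Notation mu := (@lebesgue_measure R).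

Lemma powR_le_affine (y s : R) : 0 < y -> 0 <= s <= 1 -> y `^ s <= 1 - s + s * y.
Proof.
move=> y0 /andP[s0 s1]; pose m := 1 - s + s * y.
have m0 : 0 < m.
  rewrite /m; have [->|] := eqVneq s 0; first by lra.
  by move=> sn; have := mulr_gt0 (_ : 0 < s) y0; rewrite lt_neqAle eq_sym sn s0 => /(_ isT); lra.
have l (x : R) : 0 < x -> ln x <= x - 1.
  move=> x0; have := @le_ln1Dx R (x - 1); rewrite (_ : 1 + (x - 1) = x); [apply; lra|ring].
(* ln v <= v - 1 at v = 1 / m and v = y / m: with weights 1 - s and s the right-hand sides cancel, m
   being the weighted mean of 1 and y. *)
have h1 := l _ (divr_gt0 ltr01 m0); have h2 := l _ (divr_gt0 y0 m0).
rewrite ln_div ?posrE // ln1 sub0r in h1; rewrite ln_div ?posrE // in h2.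
have : (1 - s) * - ln m + s * (ln y - ln m) <= (1 - s) * (1 / m - 1) + s * (y / m - 1).
  by apply: lerD; apply: ler_wpM2l => //; lra.
have -> : (1 - s) * (1 / m - 1) + s * (y / m - 1) = 0 by rewrite /m; field; rewrite gt_eqF.
move=> h; have {}h : s * ln y <= ln m by lra.
by rewrite /powR gt_eqF // -ler_expR lnK in h *.
Qed.

Variables (G : R -> R).
Hypothesis G1 : G 1 = 1.
Hypothesis GS : forall u, 0 < u -> G (u + 1) = u * G u.
Hypothesis Gconv : forall u s, 0 < u -> 0 <= s <= 1 -> G (u + s) <= u `^ s * G u.

Let G_nat n : G n.+1%:R = n`!%:R.
Proof. by elim: n => [|n IH]; rewrite ?G1 // -natr1 GS // IH factS natrM. Qed.

Let G_negbin p n : 0 < p -> G (p + n%:R) = n`!%:R * negbin p n * G p.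
Proof.
move=> p0; elim: n => [|n IH]; first by rewrite addr0 negbin0 !mul1r.
rewrite -natr1 addrA GS; last by rewrite ltr_wpDr.
rewrite IH factS natrM [RHS](_ : _ = n`!%:R * (n.+1%:R * negbin p n.+1) * G p); last by ring.
by rewrite negbinS; ring.
Qed.

(** Abstract in G because the limit serves twice: it determines G, which identifies the Beta
    integral, and for Gamma it is the asymptotics c_n(p) ~ n^(p-1) / Gamma(p) behind the scaling
    limit. For p <= 1 log-convexity squeezes G(p+n+1) by means of factorials; larger p reduce to p -
    1. *)
Lemma cvg_Bohr_Mollerup p : 0 < p ->
  negbin p n.+1 * n.+1%:R `^ (1 - p) * G p @[n --> \oo] --> (1 : R).
Proof.
move=> p0; have [k pk] : exists k, p <= k.+1%:R.
  exists (Num.bound p); apply: le_trans (ltW (archi_boundP (ltW p0))) _.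
  by rewrite ler_nat.
elim: k p p0 pk => [p p0 p1|k IH p p0 pk].
  have n0 n : 0 < n.+1%:R :> R by [].
  have l : (n.+1%:R / (p + n.+1%:R)) `^ (1 - p) @[n --> \oo] --> (1 : R).
    have e : 1 `^ (1 - p) = 1 :> R by rewrite powR1.
    rewrite -[X in _ --> X]e; apply: cvg_powR_seq => //.
    have : (1 + p * n.+1%:R^-1)^-1 @[n --> \oo] --> (1 + p * 0 : R)^-1.
      apply: cvgV; first by rewrite mulr0 addr0 oner_eq0.
      apply: cvgD; first exact: cvg_cst.
      by apply: cvgM; [exact: cvg_cst|exact: cvg_harmonic].
    rewrite mulr0 addr0 invr1; apply: cvg_trans; apply: near_eq_cvg.
    near=> n; have := n0 n; move: n.+1%:R => m m0.
    by field; rewrite (gt_eqF m0) gt_eqF ?addr_gt0.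
  have c1 : (fun _ : nat => 1 : R) @ \oo --> (1 : R) by exact: cvg_cst.
  apply: (squeeze_cvgr _ l c1); near=> n; have m0 := n0 n.
  have nE : negbin p n.+1 * n.+1%:R `^ (1 - p) * G p =
      G (p + n.+1%:R) / (n.+1%:R `^ p * n`!%:R).
    rewrite G_negbin // factS natrM powRB ?(gt_eqF m0) ?implybT // powRr1 ?(ltW m0) //.
    by field; rewrite pnatr_eq0 -lt0n fact_gt0 gt_eqF ?powR_gt0.
  have f0 : 0 < n`!%:R :> R by rewrite ltr0n fact_gt0.
  have pn0 : 0 < p + n.+1%:R by rewrite addr_gt0.
  rewrite nE; apply/andP; split; last first.
    rewrite ler_pdivrMr ?mulr_gt0 ?powR_gt0 // mul1r addrC -G_nat.
    by apply: Gconv => //; rewrite (ltW p0).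
  rewrite ler_pdivlMr ?mulr_gt0 ?powR_gt0 //.
  (* Lower bound: a step of 1 - p from p + n + 1 lands on the integer n + 2. *)
  have := @Gconv (p + n.+1%:R) (1 - p) pn0.
  rewrite (_ : p + n.+1%:R + (1 - p) = n.+2%:R); last by rewrite -natr1; ring.
  rewrite G_nat factS natrM subr_ge0 p1 lerBlDr lerDl (ltW p0) => /(_ isT) h.
  rewrite powRM ?invr_ge0 ?(ltW m0) ?(ltW pn0) // -(powR_inv1 (ltW pn0)) -powRrM mulN1r powRN.
  rewrite [X in X <= _](_ : _ = n.+1%:R `^ (1 - p) * n.+1%:R `^ p * n`!%:R
    / (p + n.+1%:R) `^ (1 - p)); last by ring.
  rewrite ler_pdivrMr ?powR_gt0 // -powRD ?(gt_eqF m0) ?implybT // subrK powRr1 ?(ltW m0) //.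
  by rewrite [X in _ <= X]mulrC.
have [p1|p1] := lerP p 1; first by apply: IH => //; apply: (le_trans p1); rewrite ler1n.
have q0 : 0 < p - 1 by lra.
have qk : p - 1 <= k.+1%:R by move: pk; rewrite -[k.+2%:R]natr1; lra.
have := IH _ q0 qk => h.
have l : (p - 1 + n.+1%:R) / n.+1%:R @[n --> \oo] --> (1 : R).
  have : 1 + (p - 1) * n.+1%:R^-1 @[n --> \oo] --> (1 + (p - 1) * 0 : R).
    apply: cvgD; first exact: cvg_cst.
    by apply: cvgM; [exact: cvg_cst|exact: cvg_harmonic].
  rewrite mulr0 addr0; apply: cvg_trans; apply: near_eq_cvg; near=> n.
  by field; rewrite nat1r pnatr_eq0.
have : negbin (p - 1) n.+1 * n.+1%:R `^ (1 - (p - 1)) * G (p - 1) *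
    ((p - 1 + n.+1%:R) / n.+1%:R) @[n --> \oo] --> (1 * 1 : R) by exact: cvgM.
rewrite mulr1; apply: cvg_trans; apply: near_eq_cvg; near=> n.
have m0 : 0 < n.+1%:R :> R by [].
have e1 : (p - 1 + n.+1%:R) * negbin (p - 1) n.+1 = (p - 1) * negbin p n.+1.
  by rewrite -negbinS negbin_shift subrK.
have e2 : G p = (p - 1) * G (p - 1) by rewrite -GS // subrK.
have e3 : n.+1%:R `^ (1 - (p - 1)) = n.+1%:R * n.+1%:R `^ (1 - p) :> R.
  rewrite -[X in X * _](powRr1 (ltW m0)) -powRD ?(gt_eqF m0) ?implybT //.
  by congr (_ `^ _); ring.
rewrite e2 e3 [RHS](_ : _ = (p - 1) * negbin p n.+1 * n.+1%:R `^ (1 - p) * G (p - 1)); last by ring.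
rewrite -e1; move: m0; move: n.+1%:R => m m0; field; rewrite gt_eqF //.
Unshelve. all: by end_near. Qed.

End BohrMollerup.

(** * The Beta integral *)

Section BetaIntegral.
Variable R : realType.
Local Notation mu := (@lebesgue_measure R).
Implicit Types a b s u x : R.

(** Hoelder's inequality in tangent form: (t / rho)^s <= 1 - s + s t / rho, and for rho = I1 / I0
    the affine bound integrates to exactly I0. It covers both Gamma, with rho = u, and the Beta
    integral, with rho = a / (a + b). *)
Lemma ge0_integral_powR_conv (D : set R) (w : R -> R) u s (rho I0 I1 I : R) :
  measurable D -> (forall t, D t -> 0 < t) ->
  measurable_fun setT w -> (forall t, D t -> 0 <= w t) ->
  0 < rho -> 0 <= s <= 1 -> I1 = rho * I0 ->
  (\int[mu]_(t in D) (t `^ (u - 1) * w t)%:E)%E = I0%:E ->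
  (\int[mu]_(t in D) (t `^ (u + 1 - 1) * w t)%:E)%E = I1%:E ->
  (\int[mu]_(t in D) (t `^ (u + s - 1) * w t)%:E)%E = I%:E ->
  I <= rho `^ s * I0.
Proof.
move=> mD D0 mw w0 rho0 s01 I1E h0 h1 h.
have rhos : 0 <= rho `^ s by exact: powR_ge0.
have /andP[s0 s1] := s01.
pose c0 := rho `^ s * (1 - s); pose c1 := rho `^ s * (s / rho).
have c00 : 0 <= c0 by rewrite mulr_ge0 // subr_ge0.
have c10 : 0 <= c1 by rewrite mulr_ge0 // divr_ge0 // ltW.
have mt p : measurable_fun setT (fun t => t `^ p * w t).
  by apply: measurable_funM => //; exact: measurable_powR.
rewrite -lee_fin -h.
have -> : (rho `^ s * I0)%:E = (c0%:E * I0%:E + c1%:E * I1%:E)%E.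
  by rewrite -!EFinM -EFinD I1E /c0 /c1; congr _%:E; field; rewrite gt_eqF.
have pos p t : D t -> (0 <= (t `^ p * w t)%:E)%E.
  by move=> Dt; rewrite lee_fin mulr_ge0 ?powR_ge0 ?w0.
have mE p : measurable_fun D (fun t => (t `^ p * w t)%:E).
  by apply/measurable_EFinP; exact: measurable_funTS.
rewrite -h0 -h1 -!ge0_integralZl_EFin //; try (by move=> t; exact: pos); try exact: mE.
rewrite -ge0_integralD //; last 4 first.
- by move=> t Dt; rewrite mule_ge0 ?pos ?lee_fin.
- by apply: measurable_funeM; exact: mE.
- by move=> t Dt; rewrite mule_ge0 ?pos ?lee_fin.
- by apply: measurable_funeM; exact: mE.
apply: ge0_le_integral => //.
- by move=> t; exact: pos.
- exact: mE.
- by apply: emeasurable_funD; apply: measurable_funeM; exact: mE.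
move=> t Dt; have t0 := D0 _ Dt; rewrite -!EFinM -EFinD lee_fin.
have e1 : t `^ (u + s - 1) = t `^ (u - 1) * (rho `^ s * (t / rho) `^ s).
  rewrite -powRM ?divr_ge0 ?ltW // [rho * _]mulrC divfK ?gt_eqF // -powRD ?(gt_eqF t0) ?implybT //.
  by congr (_ `^ _); ring.
have e2 : t `^ (u + 1 - 1) = t `^ (u - 1) * t.
  rewrite -[X in _ * X]powRr1 ?ltW // -powRD ?(gt_eqF t0) ?implybT //.
  by congr (_ `^ _); ring.
have := powR_le_affine (divr_gt0 t0 rho0) s01.
move=> /(ler_wpM2l rhos)/(ler_wpM2l (powR_ge0 t (u - 1)))/(ler_wpM2r (w0 _ Dt)).
rewrite -e1 => /le_trans; apply; rewrite e2 le_eqVlt; apply/orP; left; apply/eqP.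
by rewrite /c0 /c1; field; rewrite gt_eqF.
Qed.

Lemma Gamma_conv u s : 0 < u -> 0 <= s <= 1 -> Gamma (u + s) <= u `^ s * Gamma u.
Proof.
move=> u0 /andP[s0 s1].
apply: (@ge0_integral_powR_conv `]0, +oo[%classic (fun t => expR (- t)) u s u _ (Gamma (u + 1))) => //.
- by move=> t /=; rewrite in_itv /= andbT.
- by apply: measurableT_comp => //; exact: measurable_expR.
- by rewrite s0 s1.
- exact: GammaS.
- exact: Gamma_fin.
- by apply: Gamma_fin; lra.
- by apply: Gamma_fin; lra.
Qed.

Definition beta_integrand a b r : R := r `^ (a - 1) * (1 - r) `^ (b - 1).

Definition beta_integral a b : R := \int[mu]_(r in `]0, 1[) beta_integrand a b r.

Lemma measurable_powR_onem p : measurable_fun setT (fun r : R => (1 - r) `^ p).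
Proof. by apply: (measurableT_comp (measurable_powR _)); exact: measurable_funB. Qed.

Lemma measurable_beta_integrand a b : measurable_fun setT (beta_integrand a b).
Proof.
by apply: measurable_funM; [exact: measurable_powR|exact: measurable_powR_onem].
Qed.

Lemma beta_integrand_ge0 a b (r : R) : 0 <= beta_integrand a b r.
Proof. by rewrite mulr_ge0 ?powR_ge0. Qed.

Lemma is_derive_powR_onem (p r : R) : r < 1 ->
  is_derive r 1 (fun r : R => (1 - r) `^ p) (- (p * (1 - r) `^ (p - 1))).
Proof.
move=> r1; have r1' : 0 < 1 - r by rewrite subr_gt0.
have := @is_derive1_comp _ (fun a : R => a `^ p) (fun x : R => 1 - x) r _ (-1)
  (is_derive1_powR p r1') _.
rewrite mulrN1; apply; rewrite -[X in is_derive _ _ _ X]sub0r; exact: is_deriveB.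
Qed.

Lemma derivable_beta_integrand a b (r : R) : 0 < r < 1 -> derivable (beta_integrand a b) r 1.
Proof.
move=> /andP[r0 r1]; apply: derivableM.
  exact: is_derive_derivable (is_derive1_powR _ r0).
exact: is_derive_derivable (is_derive_powR_onem _ r1).
Qed.

Lemma cvg_powR_onem_seq (p : R) : 0 < p ->
  (1 - (1 - 1 / n.+3%:R)) `^ p @[n --> \oo] --> (0 : R).
Proof.
move=> p0; rewrite (_ : (fun n => _) = (fun n => (n.+3%:R^-1 : R) `^ p)).
  by apply: cvg_powR_seq0 => //; exact: cvg_invS3.
by apply/funext => n; rewrite subKr div1r.
Qed.

Lemma beta_integral_fin a b : 0 < a -> 0 < b ->
  (\int[mu]_(r in `]0%R, 1%R[) (beta_integrand a b r)%:E)%E = (beta_integral a b)%:E.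
Proof.
move=> a0 b0; rewrite /beta_integral /Rintegral fineK // ge0_fin_numE; last first.
  by apply: integral_ge0 => t _; rewrite lee_fin beta_integrand_ge0.
(* On each half of the interval one of the two powers is at most 2, because x^(p-1) <= 1 / x for x
   <= 1; the other power is kept. *)
pose g r : R := 2 * (r `^ (a - 1) + (1 - r) `^ (b - 1)).
pose F r : R := 2 * (a^-1 * r `^ a - b^-1 * (1 - r) `^ b).
have mg : measurable_fun setT g.
  by apply: measurable_funM => //; apply: measurable_funD; [exact: measurable_powR|exact: measurable_powR_onem].
have an : a != 0 by rewrite gt_eqF.
have bn : b != 0 by rewrite gt_eqF.
have ig : (\int[mu]_(t in `]0%R, 1%R[) (g t)%:E)%E = (2 * (a^-1 + b^-1))%:E.
  apply: (ge0_FTC_exhausts (F := F) (exhausts_0x ltr01) mg) => [r _|r|r|].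
  - by rewrite mulr_ge0 // addr_ge0 // powR_ge0.
  - rewrite /= in_itv /= => /andP[r0 r1].
    have := is_deriveZ 2 (is_deriveB (is_deriveZ a^-1 (is_derive1_powR a r0))
      (is_deriveZ b^-1 (is_derive_powR_onem b r1))).
    by congr (is_derive _ _ _ _); rewrite /GRing.scale /= /g; field; rewrite an bn.
  - rewrite /= in_itv /= => /andP[r0 r1]; apply: derivableM => //; apply: derivableD.
      exact: is_derive_derivable (is_derive1_powR _ r0).
    exact: is_derive_derivable (is_derive_powR_onem _ r1).
  have c1 : 1 - (n.+3%:R^-1 : R) @[n --> \oo] --> (1 - 0 : R).
    by apply: cvgB; [exact: cvg_cst|exact: cvg_invS3].
  rewrite subr0 in c1.
  rewrite (_ : 2 * _ = 2 * (a^-1 * 1 `^ a - b^-1 * 0) - 2 * (a^-1 * 0 - b^-1 * 1 `^ b)); last first.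
    by rewrite !powR1; ring.
  apply: cvgB; apply: cvgM; try exact: cvg_cst; apply: cvgB; apply: cvgM; try exact: cvg_cst.
  + apply: cvg_powR_seq => //; move: c1; apply: cvg_trans; apply: near_eq_cvg.
    by near=> n; rewrite div1r.
  + exact: cvg_powR_onem_seq.
  + apply: cvg_powR_seq0 => //.
    by under eq_fun do rewrite div1r; exact: cvg_invS3.
  + apply: cvg_powR_seq => //; move: c1; apply: cvg_trans; apply: near_eq_cvg.
    by near=> n; rewrite div1r.
apply: (@le_lt_trans _ _ (\int[mu]_(t in `]0%R, 1%R[) (g t)%:E)%E); last by rewrite ig ltry.
apply: ge0_le_integral => //=.
- by move=> t _; rewrite lee_fin beta_integrand_ge0.
- by apply/measurable_EFinP; apply: measurable_funTS; exact: measurable_beta_integrand.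
- by apply/measurable_EFinP; apply: measurable_funTS.
move=> r; rewrite in_itv /= => /andP[r0 r1]; rewrite lee_fin /g /beta_integrand.
have half (x p : R) : 2^-1 <= x <= 1 -> 0 < p -> x `^ (p - 1) <= 2.
  move=> /andP[x2 x1] p0; have x0 : 0 < x by apply: lt_le_trans x2.
  rewrite powRB ?(gt_eqF x0) ?implybT // powRr1 ?(ltW x0) // ler_pdivrMr //.
  rewrite (@le_trans _ _ 1) //; last by lra.
  have <- : 1 `^ p = 1 :> R by rewrite powR1.
  by apply: ge0_ler_powR; rewrite ?nnegrE ?(ltW p0) ?(ltW x0).
have [r2|r2] := lerP r (2^-1).
  rewrite mulrDr mulrC ler_wpDr ?mulr_ge0 ?powR_ge0 //.
  by rewrite ler_wpM2r ?powR_ge0 // half //; lra.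
rewrite mulrDr ler_wpDl ?mulr_ge0 ?powR_ge0 //.
by rewrite ler_wpM2r ?powR_ge0 // half //; lra.
Unshelve. all: by end_near. Qed.

(** The difference of the two integrands is the derivative of r^a (1 - r)^b, which vanishes at both
    ends. *)
Lemma beta_integralS a b : 0 < a -> 0 < b ->
  (a + b) * beta_integral (a + 1) b = a * beta_integral a b.
Proof.
move=> a0 b0; apply/esym/eqP; rewrite -subr_eq0; apply/eqP.
have a1 : 0 < a + 1 by lra.
have scale (k c d : R) : 0 <= k -> 0 < c -> 0 < d ->
    (\int[mu]_(r in `]0%R, 1%R[) (k * beta_integrand c d r)%:E)%E = (k * beta_integral c d)%:E.
  move=> k0 c0 d0; under eq_integral do rewrite EFinM.
  rewrite ge0_integralZl_EFin //= ?beta_integral_fin //.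
  - by move=> t _; rewrite lee_fin beta_integrand_ge0.
  - by apply/measurable_EFinP; apply: measurable_funTS; exact: measurable_beta_integrand.
apply: (FTC_exhausts (F := fun r : R => r `^ a * (1 - r) `^ b)
  (f1 := fun r => a * beta_integrand a b r)
  (f2 := fun r => (a + b) * beta_integrand (a + 1) b r) (exhausts_0x ltr01)).
- by apply: measurable_funM => //; exact: measurable_beta_integrand.
- by apply: measurable_funM => //; exact: measurable_beta_integrand.
- by move=> t _; rewrite mulr_ge0 ?beta_integrand_ge0 // ltW.
- by move=> t _; rewrite mulr_ge0 ?beta_integrand_ge0 // ltW // addr_gt0.
- by apply: scale => //; exact: ltW.
- by apply: scale => //; rewrite ltW // addr_gt0.
- move=> r; rewrite /= in_itv /= => /andP[r0 r1].
  have r1' : 0 < 1 - r by rewrite subr_gt0.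
  have := is_deriveM (is_derive1_powR a r0) (is_derive_powR_onem b r1).
  congr (is_derive _ _ _ _); rewrite /GRing.scale /= /beta_integrand addrK.
  have -> : (1 - r) `^ b = (1 - r) * (1 - r) `^ (b - 1) by rewrite mulr_powRB1 // ltW.
  have -> : r `^ a = r * r `^ (a - 1) by rewrite mulr_powRB1 // ltW.
  by ring.
- move=> r; rewrite /= in_itv /= => r01; apply: derivableM => //.
  exact: derivable_beta_integrand.
- move=> r; rewrite /= in_itv /= => r01; apply: derivableM => //.
  exact: derivable_beta_integrand.
have e : 1 `^ a * 0 - 0 * 1 `^ b = 0 :> R by ring.
rewrite -[X in _ --> X]e; apply: cvgB; apply: cvgM.
- apply: cvg_powR_seq => //; rewrite -[X in _ --> X]subr0; apply: cvgB; first exact: cvg_cst.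
  by under eq_fun do rewrite div1r; exact: cvg_invS3.
- exact: cvg_powR_onem_seq.
- apply: cvg_powR_seq0 => //.
  by under eq_fun do rewrite div1r; exact: cvg_invS3.
- apply: cvg_powR_seq => //; rewrite -[X in _ --> X]subr0; apply: cvgB; first exact: cvg_cst.
  by under eq_fun do rewrite div1r; exact: cvg_invS3.
Qed.

Lemma beta_integral1 b : 0 < b -> beta_integral 1 b = b^-1.
Proof.
move=> b0; have bn : b != 0 by rewrite gt_eqF.
apply: EFin_inj; rewrite -beta_integral_fin //.
apply: (ge0_FTC_exhausts (F := fun r : R => - b^-1 * (1 - r) `^ b) (exhausts_0x ltr01)).
- exact: measurable_beta_integrand.
- by move=> t _; exact: beta_integrand_ge0.
- move=> r; rewrite /= in_itv /= => /andP[r0 r1].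
  have := is_deriveZ (- b^-1) (is_derive_powR_onem b r1).
  congr (is_derive _ _ _ _); rewrite /GRing.scale /= /beta_integrand subrr powRr0.
  by field.
- move=> r; rewrite /= in_itv /= => r01; exact: derivable_beta_integrand.
have e : - b^-1 * 0 - - b^-1 * 1 `^ b = b^-1 by rewrite powR1; ring.
rewrite -[X in _ --> X]e; apply: cvgB; apply: cvgM; try exact: cvg_cst.
  exact: cvg_powR_onem_seq.
apply: cvg_powR_seq => //; rewrite -[X in _ --> X]subr0; apply: cvgB; first exact: cvg_cst.
by under eq_fun do rewrite div1r; exact: cvg_invS3.
Qed.

Lemma beta_integral_conv a b s : 0 < a -> 0 < b -> 0 <= s <= 1 ->
  beta_integral (a + s) b <= (a / (a + b)) `^ s * beta_integral a b.
Proof.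
move=> a0 b0 /andP[s0 s1].
apply: (@ge0_integral_powR_conv `]0, 1[%classic (fun r => (1 - r) `^ (b - 1)) a s
  (a / (a + b)) _ (beta_integral (a + 1) b)) => //.
- by move=> t /=; rewrite in_itv /= => /andP[].
- exact: measurable_powR_onem.
- by move=> t _; exact: powR_ge0.
- by rewrite divr_gt0 // addr_gt0.
- by rewrite s0.
- apply: (mulfI (x := a + b)); first by rewrite gt_eqF // addr_gt0.
  by rewrite beta_integralS //; field; rewrite gt_eqF // addr_gt0.
- exact: beta_integral_fin.
- by apply: beta_integral_fin => //; lra.
- by apply: beta_integral_fin => //; lra.
Qed.

Lemma cvg_negbin_Gamma p : 0 < p ->
  negbin p n.+1 * n.+1%:R `^ (1 - p) * Gamma p @[n --> \oo] --> (1 : R).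
Proof. exact: (cvg_Bohr_Mollerup (Gamma1 R) (@GammaS R) Gamma_conv). Qed.

(** B(u, b) Gamma(u + b) / Gamma(b), as a function of u, satisfies the Bohr-Mollerup hypotheses, so
    it agrees with Gamma at a. *)
Lemma beta_integralE a b : 0 < a -> 0 < b ->
  beta_integral a b = Gamma a * Gamma b / Gamma (a + b).
Proof.
move=> a0 b0; pose G u := beta_integral u b * Gamma (u + b) / Gamma b.
have Gb0 := Gamma_gt0 b0; have Gbn : Gamma b != 0 by rewrite gt_eqF.
have G1 : G 1 = 1.
  by rewrite /G beta_integral1 // addrC GammaS //; field; rewrite Gbn gt_eqF.
have GS u : 0 < u -> G (u + 1) = u * G u.
  move=> u0; rewrite /G addrAC GammaS ?addr_gt0 //.
  rewrite mulrA [beta_integral _ _ * _]mulrC beta_integralS //; ring.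
have Gc u s : 0 < u -> 0 <= s <= 1 -> G (u + s) <= u `^ s * G u.
  move=> u0 s01; have ub0 : 0 < u + b by rewrite addr_gt0.
  have h1 := beta_integral_conv u0 b0 s01.
  have h2 := Gamma_conv ub0 s01.
  rewrite /G mulrA ler_pM2r ?invr_gt0 // addrAC.
  have p1 : 0 <= beta_integral (u + s) b.
    rewrite /beta_integral; apply: Rintegral_ge0 => r _; exact: beta_integrand_ge0.
  have p2 : 0 <= Gamma (u + b + s).
    by apply: ltW; apply: Gamma_gt0; have /andP[s0 _] := s01; exact: ltr_wpDr.
  apply: le_trans (ler_pM p1 p2 h1 h2) _.
  rewrite powRM ?invr_ge0 ?(ltW u0) ?(ltW ub0) // -(powR_inv1 (ltW ub0)) -powRrM mulN1r powRN.
  rewrite le_eqVlt; apply/orP; left; apply/eqP; field.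
  by rewrite gt_eqF // powR_gt0.
have l1 := cvg_Bohr_Mollerup G1 GS Gc a0.
have l2 := cvg_negbin_Gamma a0.
have e : G a = Gamma a.
  have h1 : negbin a n.+1 * n.+1%:R `^ (1 - a) * G a * Gamma a @[n --> \oo] --> 1 * Gamma a.
    by apply: cvgM => //; exact: cvg_cst.
  have h2 : negbin a n.+1 * n.+1%:R `^ (1 - a) * Gamma a * G a @[n --> \oo] --> 1 * G a.
    by apply: cvgM => //; exact: cvg_cst.
  rewrite !mul1r in h1 h2; apply: (cvg_unique _ _ h1) => //; move: h2.
  apply: cvg_trans; apply: near_eq_cvg; near=> n.
  by rewrite mulrAC.
have Gabn : Gamma (a + b) != 0 by rewrite gt_eqF // Gamma_gt0 // addr_gt0.
rewrite -e /G; move: (beta_integral _ _) (Gamma _) (Gamma _) Gbn Gabn => x y w y0 w0.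
by field; rewrite y0 w0.
Unshelve. all: by end_near. Qed.

End BetaIntegral.

(** * Signs of Hankel forms *)

Section HankelForms.
Variable R : realType.
Local Notation mu := (@lebesgue_measure R).

Lemma integrable_beta_integrand (a b : R) : 0 < a -> 0 < b ->
  mu.-integrable `]0%R, 1%R[ (EFin \o beta_integrand a b).
Proof.
move=> a0 b0; apply/integrableP; split.
  by apply/measurable_EFinP; apply: measurable_funTS; exact: measurable_beta_integrand.
under eq_integral do rewrite /= ger0_norm ?beta_integrand_ge0 //.
by rewrite beta_integral_fin // ltry.
Qed.

Lemma Rintegral_sum (I : Type) (r : seq I) (D : set R) (f : I -> R -> R) :
  measurable D -> (forall i, mu.-integrable D (EFin \o f i)) ->
  mu.-integrable D (EFin \o (fun x => \sum_(i <- r) f i x)) /\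
  \int[mu]_(x in D) (\sum_(i <- r) f i x) = \sum_(i <- r) \int[mu]_(x in D) f i x.
Proof.
move=> mD fi; elim: r => [|i r [IH1 IH2]].
  rewrite big_nil; split.
    rewrite (_ : _ \o _ = cst 0%E); first exact: integrable0.
    by apply/funext => x; rewrite /= big_nil.
  rewrite (@eq_Rintegral _ _ _ _ _ (cst 0)) ?Rintegral_cst ?mul0r // => x _.
  by rewrite big_nil.
have E x : \sum_(j <- i :: r) f j x = f i x + \sum_(j <- r) f j x by rewrite big_cons.
split.
  rewrite (_ : _ \o _ = ((EFin \o f i) \+ (EFin \o (fun x => (\sum_(j <- r) f j x)%R)))%E).
    exact: integrableD.
  by apply/funext => x; rewrite /= E EFinD.
rewrite big_cons -IH2 -RintegralD //.
by apply: eq_Rintegral => x _; rewrite E.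
Qed.

(** The entries are moments of the positive weight r^(a-1) (1-r)^(b-1) on (0, 1), so the form is the
    integral of that weight times a square. *)
Lemma beta_Hankel_ge0 (K : nat) (y : nat -> R) (a b : R) : 0 < a -> 0 < b ->
  0 <= \sum_(i < K) \sum_(j < K) beta_integral (a + (i + j)%:R) b * y i * y j.
Proof.
move=> a0 b0; pose D : set R := `]0, 1[%classic.
have mD : measurable D by exact: measurable_itv.
have sum2 (g : 'I_K * 'I_K -> R) : \sum_(i < K) \sum_(j < K) g (i, j) = \sum_p g p.
  by rewrite pair_bigA /=; apply: eq_bigr => -[].
pose f (p : 'I_K * 'I_K) (r : R) :=
  y p.1 * y p.2 * beta_integrand (a + (p.1 + p.2)%:R) b r.
have p0 (p : 'I_K * 'I_K) : 0 < a + (p.1 + p.2)%:R by rewrite ltr_wpDr.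
have fi p : mu.-integrable D (EFin \o f p).
  rewrite (_ : _ \o _ = (fun x => (y p.1 * y p.2)%:E *
      (EFin \o beta_integrand (a + (p.1 + p.2)%:R) b) x)%E).
    by apply: integrableZl => //; exact: integrable_beta_integrand.
  by apply/funext => x; rewrite /= EFinM.
have [_ fE] := @Rintegral_sum _ (index_enum ('I_K * 'I_K)%type) D f mD fi.
have -> : \sum_(i < K) \sum_(j < K) beta_integral (a + (i + j)%:R) b * y i * y j =
    \int[mu]_(x in D) \sum_p f p x.
  rewrite fE -sum2; apply: eq_bigr => i _; apply: eq_bigr => j _.
  rewrite /f /= RintegralZl //; last exact: (integrable_beta_integrand (p0 (i, j)) b0).
  rewrite -/(beta_integral _ _); ring.
apply: Rintegral_ge0 => r; rewrite /D /= in_itv /= => /andP[r0 r1].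
rewrite (_ : \sum_p f p r = beta_integrand a b r * (\sum_(i < K) y i * r ^+ i) ^+ 2).
  by rewrite mulr_ge0 ?beta_integrand_ge0 ?sqr_ge0.
rewrite -sum2 expr2 big_distrlr /= mulr_sumr; apply: eq_bigr => i _.
rewrite mulr_sumr; apply: eq_bigr => j _; rewrite /f /beta_integrand /=.
have -> : r `^ (a + (i + j)%:R - 1) = r `^ (a - 1) * (r ^+ i * r ^+ j).
  rewrite -exprD -(powR_mulrn _ (ltW r0)) -powRD ?(gt_eqF r0) ?implybT //.
  by congr (_ `^ _); ring.
ring.
Qed.

(** Both sides satisfy the same recursion in n, by [beta_integralS]. The constant carries the sign
    of s, and starting at index n+1 keeps the first Beta parameter positive for all s > -1. *)
Lemma negbin_beta (s : R) n : -1 < s < 1 ->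
  negbin s n.+1 = s / (Gamma (1 + s) * Gamma (1 - s)) * beta_integral (1 + s + n%:R) (1 - s).
Proof.
move=> /andP[s1 s2]; have p1 : 0 < 1 + s by lra.
have p2 : 0 < 1 - s by lra.
have G1 := Gamma_gt0 p1; have G2 := Gamma_gt0 p2.
elim: n => [|n IH].
  rewrite addr0 beta_integralE // (_ : 1 + s + (1 - s) = 1 + 1); last by ring.
  rewrite GammaS // Gamma1 -[LHS]mul1r (negbin_shift s 0) negbin0.
  move: G1 G2; move: (Gamma _) (Gamma _) => x y x0 y0.
  by field; rewrite (gt_eqF x0) (gt_eqF y0).
apply: (mulfI (x := n.+2%:R)); first by rewrite pnatr_eq0.
rewrite negbinS IH.
have a0 : 0 < 1 + s + n%:R by rewrite ltr_wpDr.
have := beta_integralS a0 p2.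
rewrite (_ : 1 + s + n%:R + (1 - s) = n.+2%:R); last by rewrite -!natr1; ring.
rewrite (_ : 1 + s + n%:R + 1 = 1 + s + n.+1%:R); last by rewrite -natr1; ring.
move=> h; rewrite [RHS]mulrCA h (_ : s + n.+1%:R = 1 + s + n%:R); last by rewrite -natr1; ring.
ring.
Qed.

Lemma negbin_Hankel_ge0 (s : R) k K (y : nat -> R) : 0 <= s <= 1 ->
  0 <= \sum_(i < K) \sum_(j < K) negbin s (i + j + k).+1 * y i * y j.
Proof.
move=> /andP[s0]; rewrite le_eqVlt => /orP[/eqP ->|s1].
  (* At s = 1 the Beta measure degenerates to a point mass at 1: every coefficient is 1 and the form
     is a single square. *)
  under eq_bigr do under eq_bigr do rewrite negbin1 mul1r.
  rewrite (_ : \sum_(_ < _) _ = (\sum_(i < K) y i) ^+ 2) ?sqr_ge0 //.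
  by rewrite expr2 big_distrlr.
have s11 : -1 < s < 1 by rewrite s1 andbT; lra.
have C0 : 0 <= s / (Gamma (1 + s) * Gamma (1 - s)).
  by rewrite divr_ge0 // mulr_ge0 // ltW // Gamma_gt0 //; lra.
rewrite (_ : \sum_(_ < _) _ = s / (Gamma (1 + s) * Gamma (1 - s)) *
  \sum_(i < K) \sum_(j < K) beta_integral (1 + s + k%:R + (i + j)%:R) (1 - s) * y i * y j).
  apply: mulr_ge0; first exact: C0.
  apply: beta_Hankel_ge0; last by lra.
  by apply: ltr_wpDr; [exact: ler0n|lra].
rewrite mulr_sumr; apply: eq_bigr => i _; rewrite mulr_sumr; apply: eq_bigr => j _.
rewrite (negbin_beta _ s11) (_ : 1 + s + (i + j + k)%:R = 1 + s + k%:R + (i + j)%:R).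
  by rewrite !mulrA.
by rewrite [(i + j + k)%:R]natrD; ring.
Qed.

Lemma negbin_Hankel_le0 (s : R) k K (y : nat -> R) : -1 <= s <= 0 ->
  \sum_(i < K) \sum_(j < K) negbin s (i + j + k).+2 * y i * y j <= 0.
Proof.
move=> /andP[]; rewrite le_eqVlt => /orP[/eqP <- _|s1 s0].
  rewrite big1 // => i _; rewrite big1 // => j _.
  by rewrite negbin_N1SS !mul0r.
have s11 : -1 < s < 1 by rewrite s1 /=; lra.
have C0 : s / (Gamma (1 + s) * Gamma (1 - s)) <= 0.
  rewrite mulr_le0_ge0 // invr_ge0 mulr_ge0 // ltW // Gamma_gt0 //; lra.
rewrite (_ : \sum_(_ < _) _ = s / (Gamma (1 + s) * Gamma (1 - s)) *
  \sum_(i < K) \sum_(j < K) beta_integral (1 + s + k.+1%:R + (i + j)%:R) (1 - s) * y i * y j).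
  apply: mulr_le0_ge0; first exact: C0.
  apply: beta_Hankel_ge0; last by lra.
  by apply: ltr_wpDr; [exact: ler0n|lra].
rewrite mulr_sumr; apply: eq_bigr => i _; rewrite mulr_sumr; apply: eq_bigr => j _.
rewrite -addnS (negbin_beta _ s11) (_ : 1 + s + (i + j + k.+1)%:R = 1 + s + k.+1%:R + (i + j)%:R).
  by rewrite !mulrA.
by rewrite [(i + j + k.+1)%:R]natrD; ring.
Qed.

End HankelForms.

Lemma geo_bounded_affine_exp (R : realType) (A B rho : R) n : 0 < rho < 1 ->
  geo_bounded (fun k => (A + B * k%:R) ^+ n) rho.
Proof.
elim: n rho => [|n IH] rho rho01.
  by exists 1 => k; rewrite expr0 normr1 mul1r exprn_ile1 //; lra.
have [||C hC] := @geo_bounded_affine R (fun k => (A + B * k%:R) ^+ n) ((rho + 1) / 2) rho A B.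
- lra.
- apply: IH; lra.
by exists C => k; rewrite exprS; exact: hC.
Qed.

(** * Discrete Mittag-Leffler sequences *)

Section DiscreteMittagLeffler.
Variable R : realType.
Variables (alpha eta : R).
Hypothesis alpha_gt0 : 0 < alpha.
Hypothesis eta01 : 0 < eta < 1.

Let theta := eta `^ alpha.
Let z := 1 - eta.

Let eta_gt0 : 0 < eta. Proof. by have /andP[] := eta01. Qed.
Let z01 : 0 < z < 1. Proof. by have := eta01; rewrite /z; lra. Qed.
Let theta01 : 0 < theta < 1.
Proof.
rewrite powR_gt0 //=; have /andP[_ e1] := eta01.
have <- : 1 `^ alpha = 1 :> R by rewrite powR1.
by rewrite gt0_ltr_powR // nnegrE ltW.
Qed.

Lemma geo_bounded_negbin_affine (c rho : R) n : 0 <= c -> 0 < rho < 1 ->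
  geo_bounded (fun k => negbin (alpha * k%:R + c) n) rho.
Proof.
move=> c0 rho01.
have [C hC] := @geo_bounded_affine_exp R (c + 1) alpha rho n rho01.
exists C => k; apply: le_trans (hC k); have /andP[r0 _] := rho01.
have s0 : 0 <= alpha * k%:R + c by rewrite addr_ge0 ?mulr_ge0 // ltW.
apply: ler_wpM2r; first by rewrite exprn_ge0 // ltW.
rewrite ger0_norm ?negbin_ge0 //; apply: le_trans (ler_norm _).
apply: le_trans (_ : negbin (alpha * k%:R + c + 1) n <= _).
  by apply: ler_negbin; rewrite s0 lerDl ler01.
apply: le_trans (negbin_le n s0) _; rewrite le_eqVlt; apply/orP; left; apply/eqP.
by congr (_ ^+ _); ring.
Qed.

(** The coefficient of x^n in (1 - x)^(-c) / (1 - theta (1 - x)^(-alpha)). At c = 1 it is the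
    sequence u; c = 0 and c = alpha describe its differences. *)
Definition mlseq (c : R) n := limn (pseries (fun k => negbin (alpha * k%:R + c) n) theta).

Lemma cvg_mlseq c n : 0 <= c ->
  pseries (fun k => negbin (alpha * k%:R + c) n) theta @ \oo --> mlseq c n.
Proof.
move=> c0; apply: (@geo_bounded_cvg _ _ ((1 + theta) / 2)).
  by apply: geo_bounded_negbin_affine => //; have := theta01; lra.
by have := theta01 => /andP[t0 t1]; rewrite gtr0_norm //; lra.
Qed.

Lemma mlseq_diff n : mlseq 1 n.+1 - mlseq 1 n = mlseq 0 n.+1.
Proof.
have h0 := @cvg_mlseq 0 n.+1 (lexx _).
apply/esym; apply: (cvg_unique _ h0) => //.
have : pseries (fun k => negbin (alpha * k%:R + 1) n.+1) theta K -
    pseries (fun k => negbin (alpha * k%:R + 1) n) theta K @[K --> \oo] -->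
    mlseq 1 n.+1 - mlseq 1 n by apply: cvgB; exact: cvg_mlseq ler01.
apply: cvg_trans; apply: near_eq_cvg; near=> K.
rewrite /= /pseries /series /= -sumrB; apply: eq_bigr => k _.
by rewrite -mulrBl negbin_diff addrK addr0.
Unshelve. all: by end_near. Qed.

(** Passing from c = alpha to c = 0 shifts k by one; the missing term k = 0 is the coefficient of
    x^(n+1) in the constant 1. *)
Lemma mlseq_shift n : theta * mlseq alpha n.+1 = mlseq 0 n.+1.
Proof.
have h : theta * pseries (fun k => negbin (alpha * k%:R + alpha) n.+1) theta K
    @[K --> \oo] --> theta * mlseq alpha n.+1.
  by apply: cvgM; [exact: cvg_cst|apply: cvg_mlseq; exact: ltW].
apply: (cvg_unique _ h) => //.
have := @cvg_mlseq 0 n.+1 (lexx (0 : R)); rewrite -cvg_shiftS.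
apply: cvg_trans; apply: near_eq_cvg; near=> K.
rewrite /pseries /series /= big_nat_recl // mulr0 addr0 negbin_0S mul0r add0r mulr_sumr.
apply: eq_bigr => k _; rewrite addr0 -natr1 exprS mulrDr mulr1; ring.
Unshelve. all: by end_near. Qed.

Lemma mlseq_Vandermonde (s : R) c n : 0 <= c -> 0 <= s + c ->
  mlseq (s + c) n = \sum_(j < n.+1) negbin s j * mlseq c (n - j).
Proof.
move=> c0 sc0; apply: (cvg_unique _ (@cvg_mlseq _ n sc0)) => //.
have : \sum_(j < n.+1) negbin s j * pseries (fun k => negbin (alpha * k%:R + c) (n - j)) theta K
    @[K --> \oo] --> \sum_(j < n.+1) negbin s j * mlseq c (n - j).
  by apply: cvg_sumr => j; apply: cvgM; [exact: cvg_cst|exact: cvg_mlseq].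
apply: cvg_trans; apply: near_eq_cvg; near=> K.
rewrite /pseries /series /=.
under [LHS]eq_bigr do rewrite mulr_sumr.
rewrite [LHS]exchange_big /=; apply: eq_bigr => k _.
rewrite addrCA -negbin_Vandermonde mulr_suml.
by apply: eq_bigr => j _; rewrite mulrA.
Unshelve. all: by end_near. Qed.

Lemma mlseq0 c : 0 <= c -> (1 - theta) * mlseq c 0 = 1.
Proof.
move=> c0; have /andP[t0 t1] := theta01.
have -> : mlseq c 0 = 1 / (1 - theta).
  apply: (cvg_unique _ (@cvg_mlseq _ 0 c0)) => //.
  have := @cvg_geometric_series R 1 theta; rewrite gtr0_norm // => /(_ t1).
  apply: cvg_trans; apply: near_eq_cvg; near=> K.
  rewrite /pseries /series /=; apply: eq_bigr => k _.
  by rewrite negbin0.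
by rewrite mulrC divfK // gt_eqF // subr_gt0.
Unshelve. all: by end_near. Qed.

(** Read off from 1 - theta - x sum_n b_n x^n = (1 - x) - theta (1 - x)^(1 - alpha), the reciprocal
    of the generating function of [mlseq 1]. *)
Definition mlcoef n : R := (n == 0)%:R + theta * negbin (alpha - 1) n.+1.

Lemma mlseqS n : (1 - theta) * mlseq 1 n.+1 = \sum_(j < n.+1) mlcoef j * mlseq 1 (n - j).
Proof.
have := mlseq_diff n; rewrite -mlseq_shift.
have -> : mlseq alpha n.+1 = \sum_(j < n.+2) negbin (alpha - 1) j * mlseq 1 (n.+1 - j).
  by rewrite -mlseq_Vandermonde ?subrK ?ler01 ?(ltW alpha_gt0).
rewrite [X in theta * X]big_ord_recl negbin0 mul1r subn0 => h.
transitivity (theta * (\sum_(i < n.+1) negbin (alpha - 1) (lift ord0 i) *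
    mlseq 1 (n.+1 - lift ord0 i)) + mlseq 1 n).
  by move: h; move: (\sum_(_ < _) _) (mlseq 1 n.+1) (mlseq 1 n) => A B C; lra.
under [RHS]eq_bigr do rewrite mulrDl.
rewrite big_split /= [RHS]addrC; congr (_ + _); last first.
  by rewrite big_ord_recl eqxx mul1r subn0 big1 ?addr0 // => j _; rewrite mul0r.
by rewrite mulr_sumr; apply: eq_bigr => j _; rewrite mulrA /bump /= add1n subSS.
Qed.

(** A second renewal recursion, from the reciprocal 1 - theta (1 - x)^(-alpha) of the generating
    function at c = 0. *)
Lemma mlseq0S n : (1 - theta) * mlseq 0 n.+1 =
  \sum_(j < n.+1) theta * negbin alpha j.+1 * mlseq 0 (n - j).
Proof.
have e : mlseq alpha n.+1 = \sum_(j < n.+2) negbin alpha j * mlseq 0 (n.+1 - j).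
  by rewrite -mlseq_Vandermonde ?addr0 ?lexx ?(ltW alpha_gt0).
rewrite mulrBl mul1r -{1}mlseq_shift e.
rewrite big_ord_recl negbin0 mul1r subn0 mulrDr addrAC subrr add0r mulr_sumr.
by apply: eq_bigr => j _; rewrite mulrA /= /bump /= add1n subSS.
Qed.

Hypothesis alpha_le2 : alpha <= 2.

Let eta_negbin : pseries (negbin alpha) z @ \oo --> eta `^ (- alpha).
Proof.
have -> : eta = 1 - z by rewrite /z; ring.
by apply: binomial_series; [rewrite alpha_gt0|have := z01; lra].
Qed.

Let thetaN : theta * eta `^ (- alpha) = 1.
Proof. by rewrite /theta powRN divff // gt_eqF // powR_gt0. Qed.

(** At x = z both terms of (1 - x) - theta (1 - x)^(1 - alpha) equal eta; this is the zero that the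
    geometric vector requires. *)
Lemma cvg_mlcoef : series (fun n => mlcoef n * z ^+ n) @ \oo --> (1 - theta) / z.
Proof.
have /andP[z0 z1] := z01.
rewrite -cvg_shiftS.
(* The exponent alpha - 1 may be nonpositive, outside the range of [binomial_series]; its
   coefficients are taken as differences of those for alpha. *)
have h : 1 + theta / z * ((pseries (negbin alpha) z K.+2 - 1) - z * pseries (negbin alpha) z K.+1)
   @[K --> \oo] --> 1 + theta / z * ((eta `^ (- alpha) - 1) - z * eta `^ (- alpha)).
  apply: cvgD; first exact: cvg_cst.
  apply: cvgM; first exact: cvg_cst.
  apply: cvgB; last apply: cvgM; try exact: cvg_cst.
    apply: cvgB; last exact: cvg_cst.
    by rewrite (cvg_shiftS (fun n => pseries (negbin alpha) z n.+1)) (cvg_shiftS (pseries _ _)).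
  by rewrite (cvg_shiftS (pseries _ _)).
have zn : z != 0 by rewrite gt_eqF.
have -> : (1 - theta) / z = 1 + theta / z * ((eta `^ (- alpha) - 1) - z * eta `^ (- alpha)).
  transitivity (1 + (theta * eta `^ (- alpha) * (1 - z) - theta) / z); last by field.
  by rewrite thetaN; field.
move: h; apply: cvg_trans; apply: near_eq_cvg; near=> K.
transitivity (1 + theta / z * \sum_(0 <= k < K.+1) negbin (alpha - 1) k.+1 * z ^+ k.+1).
  congr (_ + _ * _); rewrite /pseries /series /= big_nat_recl // negbin0 expr0 mulr1.
  rewrite [1 + _]addrC addrK mulr_sumr -sumrB; apply: eq_bigr => k _.
  by rewrite -negbin_diff exprS; ring.
rewrite /series /= [RHS]big_nat_recl // expr0 mulr1 big_nat_recl // /mlcoef /= -addrA; congr (_ + _).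
rewrite mulrDr; congr (_ + _); first by rewrite expr1; field.
rewrite mulr_sumr; apply: eq_bigr => k _.
by rewrite add0r [z ^+ k.+2]exprS; field.
Unshelve. all: by end_near. Qed.

(** The sum is the derivative of x B(x) at z, which is 1 + theta (alpha - 1) eta^(-alpha); the
    choice theta = eta^alpha turns it into the constant alpha of the theorem. *)
Lemma cvg_mlcoefM : series (fun n => n.+1%:R * (mlcoef n * z ^+ n)) @ \oo --> alpha.
Proof.
rewrite -cvg_shiftS.
have h : 1 + theta * (alpha - 1) * pseries (negbin alpha) z K.+1
   @[K --> \oo] --> 1 + theta * (alpha - 1) * eta `^ (- alpha).
  apply: cvgD; first exact: cvg_cst.
  apply: cvgM; first exact: cvg_cst.
  by rewrite (cvg_shiftS (pseries _ _)).
have e : alpha = 1 + theta * (alpha - 1) * eta `^ (- alpha).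
  by rewrite mulrAC thetaN; ring.
rewrite -e in h; move: h; apply: cvg_trans; apply: near_eq_cvg; near=> K.
rewrite /pseries /series /= [RHS]big_nat_recl // mulr_sumr big_nat_recl // addrA; congr (_ + _).
  have h1 : negbin (alpha - 1) 1 = alpha - 1.
    by rewrite -[LHS]mul1r (negbin_shift _ 0) negbin0 mulr1.
  by rewrite negbin0 expr0 !mulr1 mul1r /mlcoef h1 /=; ring.
apply: eq_bigr => k _; rewrite /mlcoef /= add0r.
have := negbin_shift (alpha - 1) k.+1; rewrite subrK => h.
rewrite (_ : k.+2%:R * _ = theta * (k.+2%:R * negbin (alpha - 1) k.+2) * z ^+ k.+1); last by ring.
by rewrite h; ring.
Unshelve. all: by end_near. Qed.

Lemma cvg_mlcoef0 : series (fun n => theta * negbin alpha n.+1 * z ^+ n) @ \oo --> (1 - theta) / z.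
Proof.
have /andP[z0 z1] := z01; have zn : z != 0 by rewrite gt_eqF.
have h : theta / z * (pseries (negbin alpha) z K.+1 - 1)
   @[K --> \oo] --> theta / z * (eta `^ (- alpha) - 1).
  apply: cvgM; first exact: cvg_cst.
  by apply: cvgB; [rewrite (cvg_shiftS (pseries _ _))|exact: cvg_cst].
have -> : (1 - theta) / z = theta / z * (eta `^ (- alpha) - 1).
  transitivity ((theta * eta `^ (- alpha) - theta) / z); last by field.
  by rewrite thetaN; field.
move: h; apply: cvg_trans; apply: near_eq_cvg; near=> K.
rewrite /pseries /series /= big_nat_recl // negbin0 expr0 mulr1 addrAC subrr add0r mulr_sumr.
by apply: eq_bigr => k _; rewrite exprS; field.
Unshelve. all: by end_near. Qed.

End DiscreteMittagLeffler.

(** * The four discrete inequalities *)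

Section DiscreteInequalities.
Variable R : realType.
Variables (alpha eta : R).
Hypothesis alpha_gt0 : 0 < alpha.
Hypothesis eta01 : 0 < eta < 1.

Let theta := eta `^ alpha.
Let z := 1 - eta.
Let z_gt0 : 0 < z. Proof. by have := eta01; rewrite /z; lra. Qed.
Let theta_gt0 : 0 < theta. Proof. by have /andP[e0 _] := eta01; rewrite powR_gt0. Qed.

Variables (I : finType) (c : I -> R) (m : I -> nat).

Local Notation T := (mlseq alpha eta).
Let P := \sum_i c i * z ^- (m i).+1.

Let cvg_mlcoefM0 : alpha <= 1 ->
  series (fun n => n.+1%:R * (theta * negbin alpha n.+1 * z ^+ n)) @ \oo --> alpha / eta.
Proof.
move=> a1; have /andP[e0 e1] := eta01.
have h : theta * alpha * pseries (negbin (alpha + 1)) z K @[K --> \oo] -->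
   theta * alpha * eta `^ (- (alpha + 1)).
  apply: cvgM; first exact: cvg_cst.
  have -> : eta = 1 - z by rewrite /z; ring.
  apply: binomial_series; first by have := alpha_gt0; lra.
  by rewrite (ltW z_gt0) /z; lra.
have -> : alpha / eta = theta * alpha * eta `^ (- (alpha + 1)).
  rewrite opprD powRD ?(gt_eqF e0) ?implybT // powRN powR_inv1 ?(ltW e0) // -/theta.
  by field; rewrite (gt_eqF e0) (gt_eqF theta_gt0).
move: h; apply: cvg_trans; apply: near_eq_cvg; near=> K.
rewrite /pseries /series /= mulr_sumr; apply: eq_bigr => k _.
rewrite (_ : k.+1%:R * _ = theta * (k.+1%:R * negbin alpha k.+1) * z ^+ k); last by ring.
by rewrite negbin_shift; ring.
Unshelve. all: by end_near. Qed.

Let form0_mlcoef K (y : nat -> R) : form0 (1 - theta) (mlcoef alpha eta) K y y =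
  (1 - theta) * y 0%N ^+ 2 + theta *
   \sum_(i < K) \sum_(j < K) negbin (alpha - 1) (i + j + 0).+2 * y i.+1 * y j.+1.
Proof.
rewrite /form0; congr (_ + _); first by ring.
rewrite mulr_sumr; apply: eq_bigr => i _; rewrite mulr_sumr; apply: eq_bigr => j _.
by rewrite /mlcoef /= add0r addn0 -!mulrA.
Qed.

Let uE : (1 - theta) * T 1 0 = 1. Proof. by apply: mlseq0. Qed.

(** For alpha <= 1 the Hankel block of c_n(alpha - 1) is negative semidefinite, and the only
    positive square is (1 - theta) y_0^2: Lorentz signature. *)
Lemma mlseq_gram_le : alpha <= 1 ->
  z * alpha * (\sum_i \sum_j c i * c j * T 1 (m i + m j).+2) <= P ^+ 2.
Proof.
move=> a1; have a2 : alpha <= 2 by lra.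
have W : 0 < (0 + 1 * z) * alpha by rewrite add0r mul1r mulr_gt0.
have sgn : (forall n, 0 <= mlcoef alpha eta n.+1) \/ (forall n, mlcoef alpha eta n.+1 <= 0).
  right => n; rewrite /mlcoef /= add0r mulr_ge0_le0 // ?(ltW theta_gt0) //.
  by apply: negbin_le0; have := alpha_gt0; lra.
have := lorentz_pencil_ineq uE (mlseqS alpha_gt0 eta01) z_gt0
  (cvg_mlcoef alpha_gt0 eta01 a2) sgn (cvg_mlcoefM alpha_gt0 eta01 a2) c m W.
rewrite add0r mul1r.
under eq_bigr do under eq_bigr do rewrite mul0r add0r mul1r.
under [X in X ^+ 2]eq_bigr do rewrite mul0r add0r mul1r.
apply => K y y0; rewrite /pencil mul0r add0r mul1r form0_mlcoef y0 expr0n mulr0 add0r.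
rewrite mulr_ge0_le0 ?(ltW theta_gt0) //.
by apply: (negbin_Hankel_le0 0 K (fun i => y i.+1)); have := alpha_gt0; lra.
Qed.

(** The same block is positive semidefinite once alpha - 1 lies in [0, 1]. *)
Lemma mlseq_gram_ge : 1 <= alpha <= 2 ->
  P ^+ 2 <= z * alpha * (\sum_i \sum_j c i * c j * T 1 (m i + m j).+2).
Proof.
move=> /andP[a1 a2].
have W : 0 < (0 + 1 * z) * alpha by rewrite add0r mul1r mulr_gt0.
have sgn : (forall n, 0 <= mlcoef alpha eta n.+1) \/ (forall n, mlcoef alpha eta n.+1 <= 0).
  left => n; rewrite /mlcoef /= add0r mulr_ge0 // ?(ltW theta_gt0) //.
  by apply: negbin_ge0; lra.
have := psd_pencil_ineq uE (mlseqS alpha_gt0 eta01) z_gt0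
  (cvg_mlcoef alpha_gt0 eta01 a2) sgn (cvg_mlcoefM alpha_gt0 eta01 a2) c m W.
rewrite add0r mul1r.
under [X in _ <= _ * X]eq_bigr do under eq_bigr do rewrite mul0r add0r mul1r.
under [X in X ^+ 2]eq_bigr do rewrite mul0r add0r mul1r.
apply => K y; rewrite /pencil mul0r add0r mul1r form0_mlcoef.
have theta_le1 : theta <= 1.
  have <- : 1 `^ alpha = 1 :> R by rewrite powR1.
  by have /andP[e0 e1] := eta01; rewrite ge0_ler_powR ?nnegrE ?ltW.
apply: addr_ge0; first by rewrite mulr_ge0 ?sqr_ge0 ?subr_ge0.
apply: mulr_ge0; first exact: ltW.
have := @negbin_Hankel_ge0 R (alpha - 1) 1 K (fun i => y i.+1).
under eq_bigr do under eq_bigr do rewrite addn1.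
under [X in _ -> 0 <= X]eq_bigr do under eq_bigr do rewrite addn0.
by apply; lra.
Qed.

(** The differences obey the recursion [mlseq0S], whose full Hankel matrix of c_(n+1)(alpha) is
    positive semidefinite for alpha <= 1. *)
Lemma mlseq_diff_gram_ge : alpha <= 1 ->
  (P / z) ^+ 2 <= alpha / eta * (\sum_i \sum_j c i * c j * T 0 (m i + m j).+3).
Proof.
move=> a1; have a2 : alpha <= 2 by lra.
have /andP[e0 e1] := eta01.
have W : 0 < (1 + 0 * z) * (alpha / eta) by rewrite mul0r addr0 mul1r divr_gt0.
pose b n := theta * negbin alpha n.+1.
have sgn : (forall n, 0 <= b n.+1) \/ (forall n, b n.+1 <= 0).
  by left => n; rewrite mulr_ge0 ?(ltW theta_gt0) // negbin_ge0 // ltW.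
have u0 : (1 - theta) * T 0 0 = 1 by apply: mlseq0.
have := psd_pencil_ineq u0 (mlseq0S alpha_gt0 eta01) z_gt0
  (cvg_mlcoef0 alpha_gt0 eta01 a2) sgn (cvg_mlcoefM0 a1) c m W.
rewrite mul0r addr0 mul1r.
under [X in _ <= _ * X]eq_bigr do under eq_bigr do rewrite mul0r addr0 mul1r.
under [X in X ^+ 2]eq_bigr do rewrite mul0r addr0 mul1r.
have -> : P / z = \sum_i c i * z ^- (m i).+2.
  rewrite mulr_suml; apply: eq_bigr => i _; rewrite [z ^+ (m i).+2]exprSr invfM; ring.
apply => K y; rewrite /pencil mul0r addr0 mul1r /form1.
rewrite (_ : \sum_(_ < _) _ = theta *
    \sum_(i < K.+1) \sum_(j < K.+1) negbin alpha (i + j + 0).+1 * y i * y j).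
  rewrite mulr_ge0 ?(ltW theta_gt0) //.
  by apply: negbin_Hankel_ge0; rewrite a1 ltW.
rewrite mulr_sumr; apply: eq_bigr => i _; rewrite mulr_sumr; apply: eq_bigr => j _.
by rewrite addn0 -!mulrA.
Qed.

(** On vectors with zeroth entry 0, [form1] minus [form0] has as entries the differences of theta
    c_n(alpha - 1), that is theta c_n(alpha - 2), and alpha - 2 lies in [-1, 0]. *)
Lemma mlseq_diff_gram_le : 1 <= alpha <= 2 ->
  alpha / eta * (\sum_i \sum_j c i * c j * T 0 (m i + m j).+3) <= (P / z) ^+ 2.
Proof.
move=> /andP[a1 a2]; have /andP[e0 e1] := eta01.
have zE : 1 + -1 * z = eta by rewrite /z; ring.
have W : 0 < (1 + -1 * z) * alpha by rewrite zE mulr_gt0.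
have sgn : (forall n, 0 <= mlcoef alpha eta n.+1) \/ (forall n, mlcoef alpha eta n.+1 <= 0).
  left => n; rewrite /mlcoef /= add0r mulr_ge0 // ?(ltW theta_gt0) //.
  by apply: negbin_ge0; lra.
have := lorentz_pencil_ineq uE (mlseqS alpha_gt0 eta01) z_gt0
  (cvg_mlcoef alpha_gt0 eta01 a2) sgn (cvg_mlcoefM alpha_gt0 eta01 a2) c m W.
rewrite zE.
have -> : \sum_i \sum_j c i * c j * (1 * T 1 (m i + m j).+3 + -1 * T 1 (m i + m j).+2)
    = \sum_i \sum_j c i * c j * T 0 (m i + m j).+3.
  apply: eq_bigr => i _; apply: eq_bigr => j _.
  by rewrite mul1r mulN1r mlseq_diff.
have -> : \sum_i c i * (1 * z ^- (m i).+2 + -1 * z ^- (m i).+1) = eta * (P / z).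
  rewrite mulr_suml mulr_sumr; apply: eq_bigr => i _.
  rewrite [z ^+ (m i).+2]exprSr invfM (_ : eta = 1 - z); last by rewrite /z; ring.
  by rewrite mulrBl mul1r [z * _]mulrCA [z * _]mulrC mulVf ?gt_eqF //; ring.
set S := \sum_i _; move=> h.
(* For (p, q) = (1, -1) the pairing with the geometric vector is eta P / z; its square supplies the
   eta^2 divided out at the end. *)
have {}h : eta * alpha * S <= (eta * (P / z)) ^+ 2.
  apply: h => K y y0; rewrite /pencil mul1r mulN1r.
  rewrite /form1 /form0 y0 big_ord_recl /=.
  rewrite [X in X + _ - _]big1 ?add0r; last by move=> j _; rewrite y0 mulr0 mul0r.
  rewrite mulr0 add0r -sumrB.
  rewrite (_ : \sum_(_ < _) _ = theta *
      \sum_(i < K) \sum_(j < K) negbin (alpha - 2) (i + j + 1).+2 * y i.+1 * y j.+1).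
    rewrite mulr_ge0_le0 ?(ltW theta_gt0) //.
    by apply: (negbin_Hankel_le0 1 K (fun i => y i.+1)); lra.
  rewrite mulr_sumr; apply: eq_bigr => i _.
  rewrite big_ord_recl y0 mulr0 add0r -sumrB mulr_sumr; apply: eq_bigr => j _.
  rewrite /bump /= !add1n addn1 addSn addnS /mlcoef /= !add0r.
  rewrite (_ : alpha - 2 = alpha - 1 - 1); last by ring.
  by rewrite -(negbin_diff (alpha - 1)) /bump /= !add1n -/theta; ring.
rewrite exprMn expr2 in h.
rewrite -(ler_pM2l (mulr_gt0 e0 e0)); apply: le_trans h.
by rewrite le_eqVlt; apply/orP; left; apply/eqP; field; rewrite gt_eqF.
Qed.

End DiscreteInequalities.

(** * The scaling limit *)

Section ScalingLimit.
Variable R : realType.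

(** With y = 1 / (n + 2) the ratio of consecutive values is (1 - y)^p (1 + p y) <= e^(-p y) e^(p y)
    = 1. Monotonicity gives a bound by the value at n0, uniform in n >= n0. *)
Lemma negbin_powR_decr (p : R) n : 0 < p ->
  n.+2%:R `^ (- p) * negbin (p + 1) n.+2 <= n.+1%:R `^ (- p) * negbin (p + 1) n.+1.
Proof.
move=> p0; have m0 : 0 < n.+1%:R :> R by [].
have m1 : 0 < n.+2%:R :> R by [].
have p1 : 0 < p + 1 by lra.
have c0 := negbin_gt0 n.+1 p1.
pose y : R := n.+2%:R^-1.
have y0 : 0 < y by rewrite invr_gt0.
have yE : n.+1%:R = n.+2%:R * (1 - y).
  by rewrite mulrBr mulfV ?gt_eqF // -[n.+2%:R]natr1; ring.
have y1 : 0 < 1 - y by rewrite -(pmulr_rgt0 _ m1) -yE.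
have h : (1 - y) `^ p * (1 + p * y) <= 1.
  apply: le_trans (_ : expR (- y) `^ p * expR (p * y) <= _).
    apply: ler_pM; rewrite ?powR_ge0 ?addr_ge0 ?mulr_ge0 ?(ltW p0) ?(ltW y0) ?expR_ge1Dx //.
    by rewrite ge0_ler_powR ?nnegrE ?expR_ge0 ?(ltW p0) ?(ltW y1) ?expR_ge1Dx.
  by rewrite -expRM -expRD mulNr [y * p]mulrC addNr expR0.
have -> : negbin (p + 1) n.+2 = (1 + p * y) * negbin (p + 1) n.+1.
  apply: (mulfI (x := n.+2%:R)); first by rewrite gt_eqF.
  rewrite negbinS mulrA; congr (_ * _).
  by rewrite mulrDr mulrCA /y mulfV ?gt_eqF // -[n.+2%:R]natr1; ring.
rewrite yE powRM ?(ltW m1) ?(ltW y1) // mulrA ler_pM2r // ler_pM2l ?powR_gt0 //.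
by rewrite powRN -[X in _ <= X]div1r ler_pdivlMr ?powR_gt0 // mulrC.
Qed.

(** The identity (p + n) c_n(p) = p c_n(p + 1) brings in the monotone quantity. The factor n0^(-p)
    beats a given exponential in p once n0 is large, and the rest is polynomial in p. *)
Lemma negbin_powR_dom (p : R) n0 n : 0 < p -> (0 < n0 <= n)%N ->
  n%:R `^ (1 - p) * negbin p n <= p * n0%:R `^ (- p) * (p + 1) ^+ n0.
Proof.
move=> p0 /andP[n0_gt0 n0n].
have n_gt0 : (0 < n)%N by exact: leq_trans n0n.
have m0 : 0 < n%:R :> R by rewrite ltr0n.
have p1 : 0 < p + 1 by lra.
have decr : n%:R `^ (- p) * negbin (p + 1) n <= n0%:R `^ (- p) * negbin (p + 1) n0.
  case: n0 n0_gt0 n0n => // k _; case: n n_gt0 {m0} => // l _; rewrite ltnS.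
  elim: l => [|l IH]; first by rewrite leqn0 => /eqP ->.
  rewrite leq_eqVlt => /orP[/eqP -> //|]; rewrite ltnS => /IH.
  exact: le_trans (negbin_powR_decr l p0).
apply: le_trans (_ : p * (n%:R `^ (- p) * negbin (p + 1) n) <= _); last first.
  rewrite -mulrA ler_pM2l //; apply: le_trans decr _.
  by rewrite ler_wpM2l ?powR_ge0 // negbin_le // ltW.
rewrite powRD ?(gt_eqF m0) ?implybT // powRr1 ?(ltW m0) // [_ * n%:R `^ (- p)]mulrC.
rewrite -mulrA [X in _ <= X]mulrCA ler_wpM2l ?powR_ge0 //.
have e : (p + n%:R) * negbin p n = p * negbin (p + 1) n by rewrite -negbinS negbin_shift.
by rewrite -e ler_wpM2r ?(ltW (negbin_gt0 _ p0)) // lerDr ltW.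
Qed.

Lemma cvg_negbin_powR (p : R) (n : nat -> nat) : 0 < p -> n @ \oo --> \oo ->
  (n N)%:R `^ (1 - p) * negbin p (n N) @[N --> \oo] --> (Gamma p)^-1.
Proof.
move=> p0 noo; have G0 := Gamma_gt0 p0.
have : k.+1%:R `^ (1 - p) * negbin p k.+1 @[k --> \oo] --> (Gamma p)^-1.
  have h : negbin p k.+1 * k.+1%:R `^ (1 - p) * Gamma p * (Gamma p)^-1
      @[k --> \oo] --> 1 * (Gamma p)^-1.
    by apply: cvgM; [exact: cvg_negbin_Gamma|exact: cvg_cst].
  rewrite mul1r in h; move: h; apply: cvg_trans; apply: near_eq_cvg; near=> k.
  by rewrite mulfK ?gt_eqF // mulrC.
rewrite (cvg_shiftS (fun k => k%:R `^ (1 - p) * negbin p k)).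
exact: cvg_comp.
Unshelve. all: by end_near. Qed.

Variables (alpha c x : R).
Hypothesis alpha_gt0 : 0 < alpha.
Hypothesis c_gt0 : 0 < c.
Hypothesis x_gt0 : 0 < x.

(* [mlg a a] is the derivative of [mlg a 1]. *)
Definition mlg (a b y : R) : R := y `^ (b - 1) * mittag_leffler2 a b (y `^ a).

(** With p = alpha k + c, the k-th term is (eta n)^(p-1) times n^(1-p) c_n(p), and tends to x^(p-1)
    / Gamma(p); [tannery] sums the limits. *)
Lemma cvg_mlseq_mlg (eta : nat -> R) (n : nat -> nat) :
  (forall N, 0 < eta N < 1) -> n @ \oo --> \oo ->
  eta N * (n N)%:R @[N --> \oo] --> x ->
  eta N `^ (c - 1) * mlseq alpha (eta N) c (n N) @[N --> \oo] --> mlg alpha c x.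
Proof.
move=> eta01 noo nx; have x0 := x_gt0.
pose p k : R := alpha * k%:R + c.
have p0 k : 0 < p k by apply: ltr_wpDl => //; rewrite mulr_ge0 // ltW.
pose a N k := eta N `^ (p k - 1) * negbin (p k) (n N).
pose l k := x `^ (p k - 1) / Gamma (p k).
have e0 N : 0 < eta N by have /andP[] := eta01 N.
have aE N : eta N `^ (c - 1) * mlseq alpha (eta N) c (n N) = limn (series (a N)).
  have h : eta N `^ (c - 1) * pseries (fun k => negbin (alpha * k%:R + c) (n N)) (eta N `^ alpha) K
      @[K --> \oo] --> eta N `^ (c - 1) * mlseq alpha (eta N) c (n N).
    by apply: cvgM; [exact: cvg_cst|apply: cvg_mlseq => //; exact: ltW].
  apply/esym/cvg_lim => //; move: h; apply: cvg_trans; apply: near_eq_cvg; near=> K.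
  rewrite /pseries /series /= mulr_sumr; apply: eq_bigr => k _.
  rewrite mulrCA mulrC /a; congr (_ * _).
  rewrite -powR_mulrn ?powR_ge0 // -powRrM -powRD ?(gt_eqF (e0 N)) ?implybT //.
  by congr (_ `^ _); rewrite /p; ring.
have al k : a N k @[N --> \oo] --> l k.
  have h : (eta N * (n N)%:R) `^ (p k - 1) * ((n N)%:R `^ (1 - p k) * negbin (p k) (n N))
      @[N --> \oo] --> l k.
    by apply: cvgM; [exact: cvg_powR_seq|exact: cvg_negbin_powR].
  move: h; apply: cvg_trans; apply: near_eq_cvg; near=> N.
  have nN : 0 < (n N)%:R :> R by rewrite ltr0n; near: N; move/cvgnyPgt: noo; exact.
  rewrite /a powRM ?(ltW (e0 N)) ?(ltW nN) // -!mulrA; congr (_ * _).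
  by rewrite mulrA -powRD ?(gt_eqF nN) ?implybT // addrC subrKA subrr powRr0 mul1r.
(* As eta n stays below x + 1, the choice n0 > x + 1 makes ((x + 1) / n0)^p geometric in k, with
   ratio t < 1; rho, between t and 1, absorbs the polynomial factor. *)
have [n0 n0x] : exists n0 : nat, x + 1 < n0%:R.
  by exists (Num.bound (x + 1)); apply: archi_boundP; lra.
have n0_gt0 : (0 < n0)%N by rewrite -(ltr0n R); apply: lt_trans n0x; lra.
have n0R : 0 < n0%:R :> R by rewrite ltr0n.
pose q := (x + 1) / n0%:R.
have q0 : 0 < q by rewrite divr_gt0 //; lra.
have q1 : q < 1 by rewrite ltr_pdivrMr // mul1r.
pose t := q `^ alpha.
have t0 : 0 < t by exact: powR_gt0.
have t1 : t < 1.
  have <- : 1 `^ alpha = 1 :> R by rewrite powR1.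
  by rewrite gt0_ltr_powR // nnegrE ltW.
pose rho := (1 + t) / 2.
have [C hC] := @geo_bounded_affine_exp R (c + 1) alpha rho n0.+1 ltac:(rewrite /rho; lra).
have rho0 : 0 < rho by rewrite /rho; lra.
pose D := 2 / x * q `^ c * C.
have aD : \forall N \near \oo, forall k, `|a N k| <= D * (t / rho) ^+ k.
  have hx : \forall N \near \oo, x / 2 < eta N * (n N)%:R.
    by apply: (cvgr_gt x) => //; lra.
  have hx1 : \forall N \near \oo, eta N * (n N)%:R < x + 1.
    by apply: (cvgr_lt x) => //; lra.
  near=> N; move=> k.
  have n0n : (n0 <= n N)%N by near: N; move/cvgnyPge: noo; exact.
  have nN : 0 < (n N)%:R :> R by rewrite ltr0n (leq_trans n0_gt0).
  have b1 : x / 2 < eta N * (n N)%:R by near: N.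
  have b2 : eta N * (n N)%:R < x + 1 by near: N.
  have b0 : 0 < eta N * (n N)%:R by rewrite mulr_gt0.
  rewrite ger0_norm; last by rewrite /a mulr_ge0 ?powR_ge0 ?(ltW (negbin_gt0 _ _)).
  have -> : a N k = (eta N * (n N)%:R) `^ (p k - 1) * ((n N)%:R `^ (1 - p k) * negbin (p k) (n N)).
    rewrite /a powRM ?(ltW (e0 N)) ?(ltW nN) // -!mulrA; congr (_ * _).
    by rewrite mulrA -powRD ?(gt_eqF nN) ?implybT // addrC subrKA subrr powRr0 mul1r.
  have d1 : (eta N * (n N)%:R) `^ (p k - 1) <= 2 / x * (x + 1) `^ (p k).
    rewrite powRB ?(gt_eqF b0) ?implybT // powRr1 ?(ltW b0) // mulrC ler_pM ?invr_ge0 ?powR_ge0 ?(ltW b0) //.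
      by rewrite -[2 / x]invrK lef_pV2 ?posrE ?invr_gt0 ?divr_gt0 // invf_div ltW.
    by rewrite ge0_ler_powR ?nnegrE ?(ltW (p0 k)) ?(ltW b0) ?(ltW b2) //; lra.
  have d2 := @negbin_powR_dom (p k) n0 (n N) (p0 k) ltac:(by rewrite n0_gt0 n0n).
  apply: le_trans (ler_pM (powR_ge0 _ _) _ d1 d2) _.
    by rewrite mulr_ge0 ?powR_ge0 ?(ltW (negbin_gt0 _ _)).
  have qE : (x + 1) `^ p k * n0%:R `^ (- p k) = q `^ c * t ^+ k.
    rewrite -mulN1r powRrM powR_inv1 ?(ltW n0R) // -powRM ?invr_ge0 ?(ltW n0R) //; last by lra.
    rewrite -/q /p powRD ?(gt_eqF q0) ?implybT // mulrC; congr (_ * _).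
    by rewrite -powR_mulrn ?powR_ge0 // -powRrM.
  rewrite [X in X <= _](_ : _ = 2 / x * q `^ c * t ^+ k * (p k * (p k + 1) ^+ n0)); last first.
    transitivity (2 / x * ((x + 1) `^ p k * n0%:R `^ (- p k)) * (p k * (p k + 1) ^+ n0)); first by ring.
    by rewrite qE; ring.
  have hk : p k * (p k + 1) ^+ n0 * rho ^+ k <= C.
    apply: le_trans (hC k); rewrite ler_wpM2r ?exprn_ge0 ?(ltW rho0) //.
    apply: le_trans (ler_norm _); rewrite exprS (_ : c + 1 + alpha * k%:R = p k + 1); last by rewrite /p; ring.
    have pk := ltW (p0 k); apply: ler_wpM2r; first by rewrite exprn_ge0 // addr_ge0.
    by rewrite lerDl.
  have e2 : 0 <= 2 / x * q `^ c by rewrite mulr_ge0 ?powR_ge0 ?divr_ge0 ?ltW.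
  rewrite /D expr_div_n -!(mulrA (2 / x * q `^ c)) ler_wpM2l //.
  by rewrite [X in _ <= X]mulrA ler_pdivlMr ?exprn_gt0 // -mulrA [C * _]mulrC ler_wpM2l // exprn_ge0 ?(ltW t0).
have r01 : 0 <= t / rho < 1.
  by rewrite divr_ge0 ?(ltW t0) ?(ltW rho0) //= ltr_pdivrMr // mul1r /rho; lra.
have lim := tannery r01 al aD.
have lD k : `|l k| <= D * (t / rho) ^+ k.
  apply: (cvgr_to_le (cvg_norm (al k))); near=> N.
  have : forall k, `|a N k| <= D * (t / rho) ^+ k by near: N.
  exact.
have lE : mlg alpha c x = limn (series l).
  have xc : x `^ (c - 1) != 0 by rewrite gt_eqF // powR_gt0.
  pose S K := series (fun k => (x `^ alpha) ^+ k / Gamma (c + alpha * k%:R)) K.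
  have lS K : S K = (x `^ (c - 1))^-1 * series l K.
    rewrite /S /series /= mulr_sumr; apply: eq_bigr => k _.
    rewrite /l /p [c + _]addrC mulrA; congr (_ / _).
    rewrite -powR_mulrn ?powR_ge0 // -powRrM -addrA (powRD (r := alpha * k%:R)) ?(gt_eqF x0) ?implybT //.
    by rewrite [in RHS]mulrCA mulVf // mulr1.
  have cS : S @ \oo --> (x `^ (c - 1))^-1 * limn (series l).
    rewrite (_ : S = fun K => (x `^ (c - 1))^-1 * series l K); last exact/funext.
    by apply: cvgM; [exact: cvg_cst|exact: (geometric_dom_cvg r01 lD)].
  rewrite /mlg /mittag_leffler2 -/S.
  have -> : limn S = (x `^ (c - 1))^-1 * limn (series l) by exact: cvg_lim.
  by rewrite mulrA mulfV // mul1r.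
rewrite lE; move: lim; apply: cvg_trans; apply: near_eq_cvg; near=> N.
by rewrite aE.
Unshelve. all: by end_near. Qed.

End ScalingLimit.

(** * Positive definiteness on commensurable grids *)

Section GridPositivity.
Variable R : realType.

(** Only points with a common step h are tested: for eta = h / K each h M is exactly K M discrete
    steps, and finite differences need no other points. *)
Definition grid_psd (phi : R -> R) := forall (I : finType) (c : I -> R) (M : I -> nat) (h : R),
  0 < h -> (forall i, (0 < M i)%N) ->
  0 <= \sum_i \sum_j c i * c j * phi (h * (M i + M j)%:R).

(** 1 + y <= e^y at y = -eta and y = eta / (1 - eta) gives e^(eta n) <= (1 - eta)^(-n) <= e^(eta n /
    (1 - eta)). *)
Lemma cvg_geom_expR (eta : nat -> R) (n : nat -> nat) (x : R) :
  (forall N, 0 < eta N < 1) -> eta @ \oo --> (0 : R) ->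
  eta N * (n N)%:R @[N --> \oo] --> x ->
  (1 - eta N) ^- n N @[N --> \oo] --> expR x.
Proof.
move=> eta01 eta0 nx.
have cE (u : nat -> R) (l : R) : u @ \oo --> l -> expR (u N) @[N --> \oo] --> expR l.
  move=> ul; apply: (derivable_cvg_seq _ ul).
  exact: is_derive_derivable (is_derive_expR l).
have l1 := cE _ _ nx.
have l2 : expR (eta N * (n N)%:R / (1 - eta N)) @[N --> \oo] --> expR x.
  apply: cE; rewrite -[X in _ --> X]mulr1; apply: cvgM => //.
  have e : 1 = (1 - 0)^-1 :> R by rewrite subr0 invr1.
  rewrite [X in _ --> X]e; apply: cvgV; first by rewrite subr0 oner_eq0.
  by apply: cvgB => //; exact: cvg_cst.
apply: (squeeze_cvgr _ l1 l2); near=> N; have /andP[e0 e1] := eta01 N.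
have z0 : 0 < 1 - eta N by rewrite subr_gt0.
rewrite mulrAC ![_ * (n N)%:R]mulrC !expRM_natl -exprVn.
apply/andP; split; rewrite lerXn2r ?nnegrE ?expR_ge0 ?invr_ge0 ?(ltW z0) //.
  by rewrite -[expR _]invrK -expRN lef_pV2 ?posrE ?expR_gt0 // expR_ge1Dx.
apply: le_trans (expR_ge1Dx _); rewrite le_eqVlt; apply/orP; left; apply/eqP.
by field; rewrite gt_eqF.
Unshelve. all: by end_near. Qed.

Section Grid.
Variables (alpha h : R) (I : finType) (c : I -> R) (M : I -> nat).
Hypothesis alpha_gt0 : 0 < alpha.
Hypothesis h_gt0 : 0 < h.
Hypothesis M_gt0 : forall i, (0 < M i)%N.

(** The offset keeps eta below 1 from N = 0 on. The predecessor in m cancels the successors of the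
    discrete inequalities: (m N i).+1 is exactly (N + k0) M i. *)
Let k0 := (Num.bound h).+1.
Let eta N : R := h / (N + k0)%:R.
Let m N i := ((N + k0) * M i).-1.

Let k0N N : 0 < (N + k0)%:R :> R. Proof. by rewrite ltr0n addnS. Qed.

Let eta01 N : 0 < eta N < 1.
Proof.
rewrite divr_gt0 //= ltr_pdivrMr // mul1r.
apply: lt_trans (archi_boundP (ltW h_gt0)) _.
by rewrite ltr_nat /k0 addnS ltnS leq_addl.
Qed.

Let eta_cvg0 : eta @ \oo --> (0 : R).
Proof.
have : h * N.+1%:R^-1 @[N --> \oo] --> h * 0.
  by apply: cvgM; [exact: cvg_cst|exact: cvg_harmonic].
rewrite mulr0 => l.
have c0 : (fun _ : nat => 0 : R) @ \oo --> (0 : R) by exact: cvg_cst.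
apply: (squeeze_cvgr _ c0 l); near=> N; have /andP[e0 _] := eta01 N.
rewrite (ltW e0) /= ler_pM2l // lef_pV2 ?posrE // ler_nat /k0 addnS ltnS leq_addr //.
Unshelve. all: by end_near. Qed.

Let mS N i : (m N i).+1 = ((N + k0) * M i)%N.
Proof. by rewrite prednK // muln_gt0 M_gt0 addnS. Qed.

Let P N := \sum_i c i * (1 - eta N) ^- (m N i).+1.
Let E := \sum_i c i * expR (h * (M i)%:R).

Let cvg_z : 1 - eta N @[N --> \oo] --> (1 : R).
Proof. by rewrite -[X in _ --> X]subr0; apply: cvgB => //; exact: cvg_cst. Qed.

Let cvg_P : P @ \oo --> E.
Proof.
apply: cvg_sumr => i; apply: cvgM; first exact: cvg_cst.
apply: cvg_geom_expR => //.
have : (fun _ : nat => h * (M i)%:R) @ \oo --> h * (M i)%:R by exact: cvg_cst.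
apply: cvg_trans; apply: near_eq_cvg; near=> N.
have := k0N N; rewrite mS natrM /eta; move: (N + k0)%:R => K K0; field; exact: lt0r_neq0.
Unshelve. all: by end_near. Qed.

Let cvg_infty (k d : nat) : (0 < k)%N -> ((N + k0) * k + d)%N @[N --> \oo] --> \oo.
Proof.
move=> k_gt0; apply/cvgnyPge => A; near=> N.
rewrite (@leq_trans N) //; first by near: N; exact: nbhs_infty_ge.
by rewrite (leq_trans (leq_addr k0 N)) // (leq_trans _ (leq_addr _ _)) // leq_pmulr.
Unshelve. all: by end_near. Qed.

Let cvg_etaM (k d : nat) : eta N * ((N + k0) * k + d)%:R @[N --> \oo] --> h * k%:R.
Proof.
have : h * k%:R + eta N * d%:R @[N --> \oo] --> h * k%:R + 0 * d%:R.
  by apply: cvgD; [exact: cvg_cst|apply: cvgM => //; exact: cvg_cst].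
rewrite mul0r addr0; apply: cvg_trans; apply: near_eq_cvg; near=> N.
rewrite natrD natrM mulrDr; congr (_ + _).
have := k0N N; rewrite /eta; move: (N + k0)%:R => K K0; field; exact: lt0r_neq0.
Unshelve. all: by end_near. Qed.

Let MM i j : (0 < M i + M j)%N. Proof. by rewrite addn_gt0 M_gt0. Qed.
Let hMM i j : 0 < h * (M i + M j)%:R. Proof. by rewrite mulr_gt0 // ltr0n. Qed.

Let cvg_gram : \sum_i \sum_j c i * c j * mlseq alpha (eta N) 1 (m N i + m N j).+2
  @[N --> \oo] --> \sum_i \sum_j c i * c j * mlg alpha 1 (h * (M i + M j)%:R).
Proof.
apply: cvg_sumr => i; apply: cvg_sumr => j; apply: cvgM; first exact: cvg_cst.
have := @cvg_mlseq_mlg R alpha 1 (h * (M i + M j)%:R) alpha_gt0 ltr01 (hMM i j)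
  eta (fun N => (N + k0) * (M i + M j) + 0)%N eta01 (cvg_infty 0 (MM i j)) (@cvg_etaM _ 0).
apply: cvg_trans; apply: near_eq_cvg; near=> N.
by rewrite subrr powRr0 mul1r addn0 -addSn -addnS !mS mulnDr.
Unshelve. all: by end_near. Qed.

(** 1 / eta times the sequence at c = 0 is eta^(alpha - 1) times the one at c = alpha, whose scaling
    limit is known; the extra step in the index disappears in the limit. *)
Let cvg_diff_gram :
  (eta N)^-1 * (\sum_i \sum_j c i * c j * mlseq alpha (eta N) 0 (m N i + m N j).+3)
  @[N --> \oo] --> \sum_i \sum_j c i * c j * mlg alpha alpha (h * (M i + M j)%:R).
Proof.
have : \sum_i \sum_j c i * c j * (eta N `^ (alpha - 1) * mlseq alpha (eta N) alpha (m N i + m N j).+3)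
  @[N --> \oo] --> \sum_i \sum_j c i * c j * mlg alpha alpha (h * (M i + M j)%:R).
  apply: cvg_sumr => i; apply: cvg_sumr => j; apply: cvgM; first exact: cvg_cst.
  have := @cvg_mlseq_mlg R alpha alpha (h * (M i + M j)%:R) alpha_gt0 alpha_gt0 (hMM i j)
    eta (fun N => (N + k0) * (M i + M j) + 1)%N eta01 (cvg_infty 1 (MM i j)) (@cvg_etaM _ 1).
  apply: cvg_trans; apply: near_eq_cvg; near=> N.
  by rewrite addn1 mulnDr -!mS addSn addnS.
apply: cvg_trans; apply: near_eq_cvg; near=> N; have /andP[e0 e1] := eta01 N.
rewrite mulr_sumr; apply: eq_bigr => i _; rewrite mulr_sumr; apply: eq_bigr => j _.
rewrite -mlseq_shift // powRB ?(gt_eqF e0) ?implybT // powRr1 ?(ltW e0) //.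
ring.
Unshelve. all: by end_near. Qed.

Let cvg_lhs : (1 - eta N) * alpha * (\sum_i \sum_j c i * c j * mlseq alpha (eta N) 1 (m N i + m N j).+2)
  @[N --> \oo] --> alpha * (\sum_i \sum_j c i * c j * mlg alpha 1 (h * (M i + M j)%:R)).
Proof.
have l : (1 - eta N) * alpha @[N --> \oo] --> 1 * alpha.
  by apply: cvgM; [exact: cvg_z|exact: cvg_cst].
by rewrite mul1r in l; apply: cvgM l cvg_gram.
Qed.

Let cvg_P2 : P N ^+ 2 @[N --> \oo] --> E ^+ 2.
Proof. by rewrite expr2; under eq_fun do rewrite expr2; exact: (cvgM cvg_P cvg_P). Qed.

Let cvg_Pz2 : (P N / (1 - eta N)) ^+ 2 @[N --> \oo] --> E ^+ 2.
Proof.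
have l : P N / (1 - eta N) @[N --> \oo] --> E.
  rewrite -[X in _ --> X]mulr1 -[X in _ * X]invr1; apply: cvgM; first exact: cvg_P.
  by apply: cvgV; [rewrite oner_eq0|exact: cvg_z].
by rewrite expr2; under eq_fun do rewrite expr2; exact: (cvgM l l).
Qed.

Let cvg_rhs : alpha / eta N * (\sum_i \sum_j c i * c j * mlseq alpha (eta N) 0 (m N i + m N j).+3)
  @[N --> \oo] --> alpha * (\sum_i \sum_j c i * c j * mlg alpha alpha (h * (M i + M j)%:R)).
Proof.
under eq_fun do rewrite -mulrA.
by apply: cvgM; [exact: cvg_cst|exact: cvg_diff_gram].
Qed.

Let E2 : E ^+ 2 = \sum_i \sum_j c i * c j * expR (h * (M i + M j)%:R).
Proof.
rewrite expr2 big_distrlr /=; apply: eq_bigr => i _; apply: eq_bigr => j _.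
by rewrite natrD mulrDr expRD mulrACA.
Qed.

Let gramB (phi psi : R -> R) (x : R) :
  x * (\sum_i \sum_j c i * c j * phi (h * (M i + M j)%:R)) -
    (\sum_i \sum_j c i * c j * psi (h * (M i + M j)%:R)) =
  \sum_i \sum_j c i * c j * (x * phi (h * (M i + M j)%:R) - psi (h * (M i + M j)%:R)).
Proof.
rewrite mulr_sumr -sumrB; apply: eq_bigr => i _; rewrite mulr_sumr -sumrB.
by apply: eq_bigr => j _; ring.
Qed.

Lemma mlg1_gram_le : alpha <= 1 ->
  \sum_i \sum_j c i * c j * (alpha * mlg alpha 1 (h * (M i + M j)%:R) - expR (h * (M i + M j)%:R)) <= 0.
Proof.
move=> a1; rewrite -gramB -E2 subr_le0.
apply: (ler_cvg_to cvg_lhs cvg_P2); near=> N.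
exact: mlseq_gram_le.
Unshelve. all: by end_near. Qed.

Lemma mlg1_gram_ge : 1 <= alpha <= 2 ->
  0 <= \sum_i \sum_j c i * c j * (alpha * mlg alpha 1 (h * (M i + M j)%:R) - expR (h * (M i + M j)%:R)).
Proof.
move=> a12; rewrite -gramB -E2 subr_ge0.
apply: (ler_cvg_to cvg_P2 cvg_lhs); near=> N.
exact: mlseq_gram_ge.
Unshelve. all: by end_near. Qed.

Lemma mlga_gram_ge : alpha <= 1 ->
  0 <= \sum_i \sum_j c i * c j * (alpha * mlg alpha alpha (h * (M i + M j)%:R) - expR (h * (M i + M j)%:R)).
Proof.
move=> a1; rewrite -gramB -E2 subr_ge0.
apply: (ler_cvg_to cvg_Pz2 cvg_rhs); near=> N.
exact: mlseq_diff_gram_ge.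
Unshelve. all: by end_near. Qed.

Lemma mlga_gram_le : 1 <= alpha <= 2 ->
  \sum_i \sum_j c i * c j * (alpha * mlg alpha alpha (h * (M i + M j)%:R) - expR (h * (M i + M j)%:R)) <= 0.
Proof.
move=> a12; rewrite -gramB -E2 subr_le0.
apply: (ler_cvg_to cvg_rhs cvg_Pz2); near=> N.
exact: mlseq_diff_gram_le.
Unshelve. all: by end_near. Qed.

End Grid.
End GridPositivity.

(** * Towers of derivatives and finite differences *)

Section Towers.
Variable R : realType.
Implicit Types (phi : nat -> R -> R) (f : R -> R) (x h : R).

Definition tower phi := forall n x, 0 < x -> is_derive x (1 : R) (phi n) (phi n.+1 x).

Lemma tower_derive1n phi f : tower phi -> (forall x, 0 < x -> f x = phi 0%N x) ->
  forall n x, 0 < x -> derivable f^`(n)%classic x 1 /\ f^`(n)%classic x = phi n x.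
Proof.
move=> tphi f0; have main n : forall x, 0 < x -> f^`(n)%classic x = phi n x.
  elim: n => [|n IH] x x0; first exact: f0.
  rewrite derive1nS derive1E -(@derive_val _ _ _ _ _ _ _ (tphi n x x0)).
  apply: near_eq_derive; near=> y; apply: IH; near: y; exact: lt_nbhsr.
move=> n x x0; split; last exact: main.
have [d _] := tphi n x x0; apply: near_eq_derivable d.
by near=> y; apply/esym/main; near: y; exact: lt_nbhsr.
Unshelve. all: by end_near. Qed.

Lemma tower_completely_monotonic phi f : tower phi -> (forall x, 0 < x -> f x = phi 0%N x) ->
  (forall n x, 0 < x -> 0 <= (-1) ^+ n * phi n x) -> completely_monotonic f.
Proof.
by move=> tphi f0 sgn n x x0; have [d ->] := tower_derive1n tphi f0 n x0; split=> //; exact: sgn.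
Qed.

Lemma towerB phi psi : tower phi -> tower psi -> tower (fun n x => phi n x - psi n x).
Proof. by move=> tphi tpsi n x x0; apply: is_deriveB; [exact: tphi|exact: tpsi]. Qed.

Lemma towerZ (k : R) phi : tower phi -> tower (fun n x => k * phi n x).
Proof. by move=> tphi n x x0; apply: is_deriveZ; exact: tphi. Qed.

Lemma tower_shift phi : tower phi -> tower (fun n => phi n.+1).
Proof. by move=> tphi n x x0; exact: tphi. Qed.

Definition fdiff h f x : R := f (x + h) - f x.

Lemma tower_fdiff h phi : 0 <= h -> tower phi -> tower (fun n => fdiff h (phi n)).
Proof.
move=> h0 tphi n x x0; apply: is_deriveB; last exact: tphi.
have xh0 : 0 < x + h by rewrite ltr_wpDr.
have := @is_derive1_comp _ (phi n) (fun y : R => y + h) x _ 1 (tphi n _ xh0) _.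
rewrite mulr1; apply; rewrite -[X in is_derive _ _ _ X]addr0; exact: is_deriveD.
Qed.

Lemma fdiff_mean_value phi n x h : tower phi -> 0 < x -> 0 < h ->
  exists2 y, x <= y <= x + n%:R * h & iter n (fdiff h) (phi 0%N) x = h ^+ n * phi n y.
Proof.
move=> + x0 h0; elim: n phi => [|n IH] phi tphi.
  by exists x; rewrite ?mul0r ?addr0 ?lexx //= mul1r.
have [y /andP[xy yx]] := IH _ (tower_fdiff (ltW h0) tphi).
rewrite iterSr => ->.
have y0 : 0 < y by exact: lt_le_trans xy.
have [|||w] := @MVT _ (phi n) (phi n.+1) y (y + h).
- by rewrite ltrDl.
- by move=> w; rewrite in_itv /= => /andP[yw _]; apply: tphi; exact: lt_trans yw.
- apply: derivable_within_continuous => w; rewrite in_itv /= => /andP[yw _].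
  exact: is_derive_derivable (tphi n w (lt_le_trans y0 yw)).
rewrite in_itv /= => /andP[yw wy]; rewrite addrAC subrr add0r => e.
exists w; last by rewrite /fdiff e exprSr; ring.
rewrite (le_trans xy (ltW yw)) /= -natr1 mulrDl mul1r addrA.
by rewrite (le_trans (ltW wy)) // lerD2r.
Qed.

(** A difference of order n is a positive multiple of the n-th derivative at a nearby point; these
    points converge to x and [phi n] is continuous. One sequence of steps is enough. *)
Lemma tower_sign phi n x (s : R) (h : nat -> R) : tower phi -> 0 < x ->
  (forall k, 0 < h k) -> h @ \oo --> (0 : R) ->
  (forall k, 0 <= s * iter n (fdiff (h k)) (phi 0%N) x) -> 0 <= s * phi n x.
Proof.
move=> tphi x0 h0 hl sgn.
have yP k : exists y, x <= y <= x + n%:R * h k /\ 0 <= s * phi n y.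
  have [y xy e] := fdiff_mean_value n tphi x0 (h0 k); exists y; split => //.
  by have := sgn k; rewrite e mulrCA pmulr_rge0 // exprn_gt0.
pose y k := sval (cid (yP k)).
have yx k : x <= y k <= x + n%:R * h k /\ 0 <= s * phi n (y k) := svalP (cid (yP k)).
have yl : y @ \oo --> x.
  have c1 : (fun _ : nat => x) @ \oo --> x by exact: cvg_cst.
  have c2 : x + n%:R * h k @[k --> \oo] --> x + n%:R * 0.
    by apply: cvgD; [exact: cvg_cst|apply: cvgM => //; exact: cvg_cst].
  rewrite mulr0 addr0 in c2; apply: (squeeze_cvgr _ c1 c2); near=> k.
  by have [] := yx k.
have l : s * phi n (y k) @[k --> \oo] --> s * phi n x.
  apply: cvgM; first exact: cvg_cst.
  exact: (derivable_cvg_seq (is_derive_derivable (tphi n x x0)) yl).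
by apply: (cvgr_to_ge l); near=> k; have [] := yx k.
Unshelve. all: by end_near. Qed.

Lemma iter_fdiff_weights n : exists c : nat -> R, forall f x h,
  iter n (fdiff h) f x = \sum_(i < n.+1) c i * f (x + i%:R * h).
Proof.
elim: n => [|n [c IH]].
  by exists (fun=> 1) => f x h; rewrite big_ord1 mul0r addr0 mul1r.
exists (fun i => (if i is i'.+1 then c i' else 0) - (if (i <= n)%N then c i else 0)) => f x h.
rewrite iterS /fdiff !IH.
under [RHS]eq_bigr do rewrite mulrBl.
rewrite sumrB; congr (_ - _).
  rewrite [RHS]big_ord_recl mul0r add0r; apply: eq_bigr => i _.
  by rewrite /= -natr1 mulrDl mul1r [i%:R * h + h]addrC addrA.
rewrite [RHS]big_ord_recr /= ltnn mul0r addr0; apply: eq_bigr => i _.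
by rewrite -ltnS ltn_ord.
Qed.

(** A difference of order 2n at x is the sum of c_i c_j f(x + (i + j) h), with the weights of order
    n. The step x / (2m) makes x = 2 m h, so each point is h ((m + i) + (m + j)). *)
Lemma grid_psd_fdiff f n x m : grid_psd f -> 0 < x -> (0 < m)%N ->
  0 <= iter (n + n) (fdiff (x / (2 * m)%:R)) f x.
Proof.
move=> psd x0 m0; set h := x / _.
have m2 : 0 < (2 * m)%:R :> R by rewrite ltr0n muln_gt0.
have h0 : 0 < h by rewrite divr_gt0.
have [c cE] := iter_fdiff_weights n.
have := psd 'I_n.+1 (fun i => c i) (fun i => m + i)%N h h0.
rewrite iterD cE => /(_ _)/le_trans; apply.
  by move=> i; rewrite addn_gt0 m0.
rewrite le_eqVlt; apply/orP; left; apply/eqP; apply: eq_bigr => i _.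
rewrite cE mulr_sumr; apply: eq_bigr => j _; rewrite mulrA; congr (_ * f _).
rewrite [in RHS](_ : x = h * (2 * m)%:R); last by rewrite /h divfK // gt_eqF.
by rewrite mul2n -addnn !natrD; ring.
Qed.

Lemma grid_psd_tower phi n x : tower phi -> grid_psd (phi 0%N) -> 0 < x ->
  0 <= phi (n + n)%N x.
Proof.
move=> tphi psd x0; rewrite -[phi _ _]mul1r.
apply: (@tower_sign phi (n + n)%N x 1 (fun k => x / (2 * k.+1)%:R) tphi x0).
- by move=> k; rewrite divr_gt0 // ltr0n muln_gt0.
- have : x / 2 * k.+1%:R^-1 @[k --> \oo] --> x / 2 * 0.
    by apply: cvgM; [exact: cvg_cst|exact: cvg_harmonic].
  rewrite mulr0; apply: cvg_trans; apply: near_eq_cvg; near=> k.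
  by rewrite natrM invfM mulrA.
by move=> k; rewrite mul1r; exact: grid_psd_fdiff.
Unshelve. all: by end_near. Qed.

(** Even derivatives of phi and of -phi' are nonnegative, which covers both parities. *)
Lemma grid_psd_alternating phi : tower phi ->
  grid_psd (phi 0%N) -> grid_psd (fun x => - phi 1%N x) ->
  forall n x, 0 < x -> 0 <= (-1) ^+ n * phi n x.
Proof.
move=> tphi psd0 psd1 n x x0; rewrite -(odd_double_half n) -addnn.
case: (odd n); last first.
  rewrite add0n exprD -expr2 sqrr_sign mul1r; exact: grid_psd_tower.
rewrite add1n exprS exprD -expr2 sqrr_sign mulr1 mulN1r.
have t1 := towerZ (-1) (tower_shift tphi).
have := @grid_psd_tower _ n./2 x t1.
rewrite mulN1r; apply => //.
rewrite (_ : (fun x => -1 * phi 1%N x) = (fun x => - phi 1%N x)) //.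
by apply/funext => y; rewrite mulN1r.
Qed.

End Towers.

(** * Derivatives of generalised power series and of Mittag-Leffler functions *)

Section PowerSeriesTower.
Variable R : realType.
Implicit Types (u : nat -> R) (a b e x y z : R).

Definition entire u := forall rho : R, 0 < rho -> geo_bounded u rho.

Lemma entire_cvg u z : entire u -> cvgn (pseries u z).
Proof.
move=> eu; have z1 : 0 < `|z| + 1 by rewrite ltr_wpDl.
by apply: (geo_bounded_cvg (eu _ z1)); rewrite ltrDl.
Qed.

Lemma entire_affine u (A B : R) : entire u -> entire (fun k => (A + B * k%:R) * u k).
Proof.
move=> eu rho r0; apply: (@geo_bounded_affine _ _ (rho + 1)); first by lra.
by apply: eu; lra.
Qed.

(** Series of u_k y^(a k + e), a class closed under differentiation: the exponent e drops by one and
    u_k is multiplied by a k + e. *)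
Definition gpseries a e u y : R := y `^ e * limn (pseries u (y `^ a)).

Lemma pseries_affine u (A B z : R) : entire u ->
  limn (pseries (fun k => (A + B * k%:R) * u k) z) =
  A * limn (pseries u z) + B * (z * limn (pseries (pseries_diffs u) z)).
Proof.
move=> eu.
have ed : entire (pseries_diffs u).
  move=> rho r0; apply: (@geo_bounded_diffs _ _ (rho + 1)); first by lra.
  by apply: eu; lra.
apply: cvg_lim => //; rewrite -cvg_shiftS.
have : A * pseries u z K.+1 + B * (z * pseries (pseries_diffs u) z K) @[K --> \oo] -->
  A * limn (pseries u z) + B * (z * limn (pseries (pseries_diffs u) z)).
  apply: cvgD; apply: cvgM; try exact: cvg_cst.
    by rewrite (cvg_shiftS (pseries u z)); exact: entire_cvg.
  by apply: cvgM; [exact: cvg_cst|exact: entire_cvg].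
apply: cvg_trans; apply: near_eq_cvg; near=> K.
have -> : z * pseries (pseries_diffs u) z K = \sum_(0 <= k < K.+1) k%:R * u k * z ^+ k.
  rewrite /pseries /series /= big_nat_recl // !mul0r add0r mulr_sumr.
  by apply: eq_bigr => k _; rewrite /pseries_diffs exprS; ring.
rewrite /pseries /series /= !mulr_sumr -big_split /=.
by apply: eq_bigr => k _; ring.
Unshelve. all: by end_near. Qed.

Lemma is_derive_gpseries a e u y : entire u -> 0 < y ->
  is_derive y (1 : R) (gpseries a e u) (gpseries a (e - 1) (fun k => (e + a * k%:R) * u k) y).
Proof.
move=> eu y0; have ya0 : 0 < y `^ a by exact: powR_gt0.
have z1 : 0 < `|y `^ a| + 1 by rewrite ltr_wpDl.
have d1 : is_derive (y `^ a) (1 : R) (fun x => limn (pseries u x))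
    (limn (pseries (pseries_diffs u) (y `^ a))).
  by apply: (is_derive_pseries (eu _ z1)); rewrite ltrDl.
have d2 := @is_derive1_comp _ (fun x => limn (pseries u x)) (fun x => x `^ a) y _ _ d1 (is_derive1_powR a y0).
have := is_deriveM (is_derive1_powR e y0) d2.
congr (is_derive _ _ _ _); rewrite /GRing.scale /= /gpseries pseries_affine //.
rewrite !powRB ?(gt_eqF y0) ?implybT // powRr1 ?(ltW y0) //.
by field; rewrite gt_eqF.
Qed.

Fixpoint gpcoef a e u n k : R :=
  if n is n'.+1 then (e - n'%:R + a * k%:R) * gpcoef a e u n' k else u k.

Lemma entire_gpcoef a e u n : entire u -> entire (gpcoef a e u n).
Proof. by move=> eu; elim: n => [//|n IH]; exact: entire_affine. Qed.

Lemma tower_gpseries a e u : entire u ->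
  tower (fun n => gpseries a (e - n%:R) (gpcoef a e u n)).
Proof.
move=> eu n x x0; rewrite -natr1 opprD addrA.
exact: (is_derive_gpseries _ _ (entire_gpcoef _ _ _ eu)).
Qed.

Definition mlcf a b k : R := (Gamma (b + a * k%:R))^-1.

Lemma entire_mlcf a b : 0 < a -> 0 < b -> entire (mlcf a b).
Proof.
move=> a0 b0 rho r0; pose A := rho `^ a^-1.
have A0 : 0 < A by exact: powR_gt0.
exists ((A `^ b * expR (- (A + 1)) / (A + 1))^-1) => k.
have s0 : 0 < b + a * k%:R by rewrite ltr_wpDr // mulr_ge0 // ltW.
have G0 := Gamma_gt0 s0.
rewrite /mlcf ger0_norm ?invr_ge0 ?(ltW G0) // mulrC ler_pdivrMr //.
have c0 : 0 < A `^ b * expR (- (A + 1)) / (A + 1).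
  by rewrite divr_gt0 ?mulr_gt0 ?powR_gt0 ?expR_gt0 // addr_gt0.
rewrite ler_pdivlMl //; apply: le_trans (Gamma_lower s0 A0).
rewrite powRD ?(gt_eqF A0) ?implybT // powRrM.
have -> : A `^ a = rho by rewrite -powRrM mulVf ?gt_eqF // powRr1 // ltW.
rewrite powR_mulrn ?(ltW r0) // le_eqVlt; apply/orP; left; apply/eqP.
ring.
Qed.

Lemma mittag_leffler2E a b z : mittag_leffler2 a b z = limn (pseries (mlcf a b) z).
Proof.
rewrite /mittag_leffler2 /pseries; congr (limn (series _)).
by apply/funext => k; rewrite mulrC.
Qed.

Lemma mlgE a b y : mlg a b y = gpseries a (b - 1) (mlcf a b) y.
Proof. by rewrite /mlg mittag_leffler2E. Qed.

(** From s / Gamma(s + 1) = 1 / Gamma(s) at s = b - 1 + a k. The term k = 0 is kept apart because s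
    may be 0 there; it vanishes for b = 1. *)
Lemma gpseries_mlcf_shift a b y : 0 < a -> 1 <= b -> 0 < y ->
  gpseries a (- 1) (fun k => (b - 1 + a * k%:R) * mlcf a b k) y =
  (b - 1) / y * (Gamma b)^-1 + gpseries a (a - 1) (mlcf a (a + b - 1)) y.
Proof.
move=> a0 b1 y0; have b0 : 0 < b by lra.
have ab0 : 0 < a + b - 1 by lra.
have ec := entire_mlcf a0 b0.
have ea : entire (fun k => (b - 1 + a * k%:R) * mlcf a b k) by exact: entire_affine.
rewrite /gpseries; have -> : limn (pseries (fun k => (b - 1 + a * k%:R) * mlcf a b k) (y `^ a)) =
    (b - 1) * (Gamma b)^-1 + y `^ a * limn (pseries (mlcf a (a + b - 1)) (y `^ a)).
  apply: cvg_lim => //; rewrite -cvg_shiftS.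
  have : (b - 1) * (Gamma b)^-1 + y `^ a * pseries (mlcf a (a + b - 1)) (y `^ a) K
     @[K --> \oo] --> (b - 1) * (Gamma b)^-1 + y `^ a * limn (pseries (mlcf a (a + b - 1)) (y `^ a)).
    apply: cvgD; first exact: cvg_cst.
    by apply: cvgM; [exact: cvg_cst|apply: entire_cvg; exact: entire_mlcf].
  apply: cvg_trans; apply: near_eq_cvg; near=> K.
  rewrite /pseries /series /= big_nat_recl // mulr0 addr0 expr0 mulr1 /mlcf mulr0 addr0.
  congr (_ + _); rewrite mulr_sumr; apply: eq_bigr => k _.
  have s0 : 0 < b - 1 + a * k.+1%:R by rewrite ltr_wpDl ?subr_ge0 // mulr_gt0.
  have G0 := Gamma_gt0 s0.
  rewrite (_ : b + a * k.+1%:R = b - 1 + a * k.+1%:R + 1); last by ring.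
  rewrite GammaS // (_ : a + b - 1 + a * k%:R = b - 1 + a * k.+1%:R); last by rewrite -natr1; ring.
  rewrite exprS; move: (b - 1 + _) s0 G0 => s s0; move: (Gamma s) => g g0.
  by field; rewrite (gt_eqF g0) (gt_eqF s0).
rewrite mulrDr powRB ?(gt_eqF y0) ?implybT // powR_inv1 ?(ltW y0) // powRr1 ?(ltW y0) //.
by rewrite /gpseries; ring.
Unshelve. all: by end_near. Qed.

Lemma mlg1E a y : 0 < y -> mlg a 1 y = mittag_leffler a (y `^ a).
Proof. by move=> y0; rewrite /mlg subrr powRr0 mul1r. Qed.

Definition mlg1_tower a n := gpseries a (0 - n%:R) (gpcoef a 0 (mlcf a 1) n).

Lemma mlg1_tower0 a y : mlg1_tower a 0 y = mlg a 1 y.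
Proof. by rewrite /mlg1_tower mlgE !subrr. Qed.

Lemma mlg1_tower1 a y : 0 < a -> 0 < y -> mlg1_tower a 1 y = mlg a a y.
Proof.
move=> a0 y0; have := gpseries_mlcf_shift a0 (lexx 1) y0.
rewrite subrr mul0r mul0r add0r addrK -mlgE => <-.
rewrite /mlg1_tower sub0r; congr (gpseries _ _ _ _).
by apply/funext => k /=; rewrite subrr.
Qed.

Lemma tower_mlg1 a : 0 < a -> tower (mlg1_tower a).
Proof. by move=> a0; apply: tower_gpseries; exact: entire_mlcf. Qed.

Lemma mlg11 y : 0 < y -> mlg 1 1 y = expR y.
Proof.
move=> y0; rewrite mlg1E // powRr1 ?(ltW y0) // /mittag_leffler /mittag_leffler2.
rewrite expRE; congr (limn (series _)); apply/funext => k.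
by rewrite mul1r nat1r Gamma_natS mulrC.
Qed.

(** F' + (b - 1) F / y multiplies the coefficient of y^(a k) by a k + b - 1, which lowers the
    argument of Gamma by one; subtracting the value at 0 removes exactly the term k = 0. *)
Lemma Lop_mlF a b y : 0 < a -> 1 < b -> 0 < y ->
  Lop b (mlF a b) y = gpseries a (a - 1) (mlcf a (a + b - 1)) y.
Proof.
move=> a0 b1 y0; have b0 : 0 < b by lra.
have ec := entire_mlcf a0 b0.
have FE x : 0 < x -> mlF a b x = gpseries a 0 (mlcf a b) x.
  by move=> x0; rewrite /mlF mittag_leffler2E /gpseries powRr0 mul1r.
have d : is_derive y (1 : R) (mlF a b) (gpseries a (0 - 1) (fun k => (0 + a * k%:R) * mlcf a b k) y).
  apply: near_eq_is_derive (is_derive_gpseries a 0 ec y0).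
  by near=> x; apply/esym/FE; near: x; exact: lt_nbhsr.
rewrite /Lop derive1E (@derive_val _ _ _ _ _ _ _ d) mlF0 // FE //.
have := gpseries_mlcf_shift a0 (ltW b1) y0.
rewrite /gpseries !pseries_affine // => h.
rewrite sub0r powRr0 mul1r mul0r add0r.
have h' := esym h; rewrite addrC in h'; move/(canRL (addrK _)): h' => ->.
by rewrite powR_inv1 ?(ltW y0) //; ring.
Unshelve. all: by end_near. Qed.

End PowerSeriesTower.

(** * Beta averages *)

Section Averages.
Variable R : realType.
Local Notation mu := (@lebesgue_measure R).
Implicit Types (a b c x s : R).

Lemma nneseries_EFin (u : nat -> R) (l : R) : series u @ \oo --> l ->
  (\sum_(0 <= k <oo) (u k)%:E)%E = l%:E.
Proof.
move=> ul; apply: cvg_lim; first exact: ereal_hausdorff.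
rewrite (_ : (fun n => _) = (fun n => (series u n)%:E)); last first.
  by apply/funext => n; rewrite /series /= sumEFin.
by apply: cvg_EFin => //; near=> n.
Unshelve. all: by end_near. Qed.

Lemma cvg_mlg_series a c x : 0 < a -> 0 < c -> 0 < x ->
  series (fun k => x `^ (a * k%:R + c - 1) / Gamma (a * k%:R + c)) @ \oo --> mlg a c x.
Proof.
move=> a0 c0 x0.
have : x `^ (c - 1) * pseries (mlcf a c) (x `^ a) K @[K --> \oo] --> mlg a c x.
  rewrite /mlg mittag_leffler2E; apply: cvgM; first exact: cvg_cst.
  by apply: entire_cvg; exact: entire_mlcf.
apply: cvg_trans; apply: near_eq_cvg; near=> K.
rewrite /pseries /series /= mulr_sumr; apply: eq_bigr => k _.
have -> : x `^ (a * k%:R + c - 1) = x `^ (c - 1) * (x `^ a) ^+ k.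
  rewrite -powR_mulrn ?powR_ge0 // -powRrM -powRD ?(gt_eqF x0) ?implybT //.
  by congr (_ `^ _); ring.
by rewrite /mlcf (addrC c (a * _)); move: (Gamma _)^-1 => g; ring.
Unshelve. all: by end_near. Qed.

(** The terms are nonnegative, so sum and integral commute, and each Beta integral B(p, b - 1)
    trades Gamma(p) for Gamma(p + b - 1). *)
Lemma integral_mlg_average a c b x : 0 < a -> 0 < c -> 1 < b -> 0 < x ->
  (\int[mu]_(s in `]0%R, 1%R[) ((1 - s) `^ (b - 1 - 1) * mlg a c (s * x))%:E)%E =
  (Gamma (b - 1) * mlg a (c + b - 1) x / x `^ (b - 1))%:E.
Proof.
move=> a0 c0 b1 x0; have b0 : 0 < b - 1 by lra.
have cb0 : 0 < c + b - 1 by lra.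
pose p k : R := a * k%:R + c.
have p0 k : 0 < p k by rewrite ltr_wpDl // mulr_ge0 // ltW.
pose C k := x `^ (p k - 1) / Gamma (p k).
have C0 k : 0 <= C k by rewrite mulr_ge0 ?powR_ge0 // invr_ge0 ltW // Gamma_gt0.
transitivity (\int[mu]_(s in `]0%R, 1%R[) (\sum_(0 <= k <oo) (C k * beta_integrand (p k) (b - 1) s)%:E))%E.
  apply: eq_integral => s; rewrite inE /= in_itv /= => /andP[s0 s1].
  rewrite (@nneseries_EFin _ ((1 - s) `^ (b - 1 - 1) * mlg a c (s * x))) //.
  have : (1 - s) `^ (b - 1 - 1) * series (fun k => (s * x) `^ (p k - 1) / Gamma (p k)) K
      @[K --> \oo] --> (1 - s) `^ (b - 1 - 1) * mlg a c (s * x).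
    by apply: cvgM; [exact: cvg_cst|apply: cvg_mlg_series => //; exact: mulr_gt0].
  apply: cvg_trans; apply: near_eq_cvg; near=> K.
  rewrite /series /= mulr_sumr; apply: eq_bigr => k _.
  by rewrite /C /beta_integrand powRM ?(ltW s0) ?(ltW x0) //; ring.
rewrite integral_nneseries //=; last first.
- by move=> k s _; rewrite lee_fin mulr_ge0 ?beta_integrand_ge0.
- move=> k; apply/measurable_EFinP; apply: measurable_funTS; apply: measurable_funM => //.
  exact: measurable_beta_integrand.
transitivity (\sum_(0 <= k <oo) (C k * beta_integral (p k) (b - 1))%:E)%E.
  apply: eq_eseriesr => k _; under eq_integral do rewrite EFinM.
  rewrite ge0_integralZl_EFin //= ?beta_integral_fin //.
  - by move=> s _; rewrite lee_fin beta_integrand_ge0.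
  - by apply/measurable_EFinP; apply: measurable_funTS; exact: measurable_beta_integrand.
apply: nneseries_EFin.
have : Gamma (b - 1) * series (fun k => x `^ (a * k%:R + (c + b - 1) - 1) /
    Gamma (a * k%:R + (c + b - 1))) K / x `^ (b - 1)
    @[K --> \oo] --> Gamma (b - 1) * mlg a (c + b - 1) x / x `^ (b - 1).
  apply: cvgM; last exact: cvg_cst.
  by apply: cvgM; [exact: cvg_cst|exact: cvg_mlg_series].
apply: cvg_trans; apply: near_eq_cvg; near=> K.
rewrite /series /= mulr_sumr mulr_suml; apply: eq_bigr => k _.
rewrite beta_integralE // /C (_ : a * k%:R + (c + b - 1) = p k + (b - 1)); last by rewrite /p; ring.
have -> : x `^ (p k + (b - 1) - 1) = x `^ (p k - 1) * x `^ (b - 1).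
  rewrite -powRD ?(gt_eqF x0) ?implybT //; congr (_ `^ _); ring.
have G0 : Gamma (p k) != 0 by rewrite gt_eqF // Gamma_gt0.
have X0 : x `^ (b - 1) != 0 by rewrite gt_eqF // powR_gt0.
have G1 : Gamma (p k + (b - 1)) != 0 by rewrite gt_eqF // Gamma_gt0 // addr_gt0.
move: (Gamma (p k)) (Gamma (p k + (b - 1))) (Gamma (b - 1)) G0 G1 => g g' g'' G0 G1.
by field; rewrite G0 G1 X0.
Unshelve. all: by end_near. Qed.

Lemma integrable_mlg_average a c b x : 0 < a -> 0 < c -> 1 < b -> 0 < x ->
  mu.-integrable `]0%R, 1%R[ (EFin \o (fun s => (1 - s) `^ (b - 1 - 1) * mlg a c (s * x))).
Proof.
move=> a0 c0 b1 x0; apply/integrableP; split.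
  apply/measurable_EFinP; apply: measurable_funM.
    by apply: measurable_funTS; exact: measurable_powR_onem.
  apply: open_continuous_measurable_fun; first exact: interval_open.
  move=> s; rewrite inE /= in_itv /= => /andP[s0 s1].
  have sx0 : 0 < s * x by rewrite mulr_gt0.
  have d1 : derivable (mlg a c) (s * x) 1.
    rewrite (_ : mlg a c = gpseries a (c - 1) (mlcf a c)); last by apply/funext => y; rewrite mlgE.
    exact: is_derive_derivable (is_derive_gpseries _ _ (entire_mlcf a0 c0) sx0).
  apply: (@continuous_comp _ _ _ (fun s : R => s * x) (mlg a c)).
    exact: mulrr_continuous.
  by apply: differentiable_continuous; apply/derivable1_diffP.
under eq_integral => s.
  rewrite inE /= in_itv /= => /andP[s0 s1]; rewrite ger0_norm; last first.
    rewrite mulr_ge0 ?powR_ge0 //.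
    have sx0 : 0 < s * x by rewrite mulr_gt0.
    apply: (cvgr_to_ge (cvg_mlg_series a0 c0 sx0)); near=> K.
    apply: sumr_ge0 => k _; rewrite mulr_ge0 ?powR_ge0 // invr_ge0 ltW // Gamma_gt0 //.
    by rewrite ltr_wpDl // mulr_ge0 // ltW.
  over.
by rewrite integral_mlg_average // ltry.
Unshelve. all: by end_near. Qed.

End Averages.

(** * Averages of alternating towers and the incomplete Gamma function *)

Section AveragedTowers.
Variable R : realType.
Local Notation mu := (@lebesgue_measure R).
Local Notation D := (`]0%R, 1%R[%classic : set R).

(** Avoids differentiation under the integral sign: the difference of step h of phi(s x) in x is the
    difference of step s h of phi at s x, whose sign comes from the mean value theorem; [tower_sign]
    then returns to derivatives. *)
Lemma alternating_average (phi psi : nat -> R -> R) (w : R -> R) (C : R) :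
  tower phi -> tower psi -> (forall s, D s -> 0 <= w s) -> 0 <= C ->
  (forall n x, 0 < x -> 0 <= (-1) ^+ n * phi n x) ->
  (forall x, 0 < x -> mu.-integrable D (EFin \o (fun s => w s * phi 0%N (s * x)))) ->
  (forall x, 0 < x -> psi 0%N x = C * \int[mu]_(s in D) (w s * phi 0%N (s * x))) ->
  forall n x, 0 < x -> 0 <= (-1) ^+ n * psi n x.
Proof.
move=> tphi tpsi w0 C0 sgn int psiE n x x0.
pose g h n x s := w s * iter n (fdiff (s * h)) (phi 0%N) (s * x).
have main k h y : 0 < h -> 0 < y -> mu.-integrable D (EFin \o g h k y) /\
    iter k (fdiff h) (psi 0%N) y = C * \int[mu]_(s in D) g h k y s.
  move=> h0; elim: k y => [|k IH] y y0; first by split; [exact: int|exact: psiE].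
  have yh0 : 0 < y + h by rewrite addr_gt0.
  have [i1 e1] := IH _ y0; have [i2 e2] := IH _ yh0.
  have gE s : g h k.+1 y s = g h k (y + h) s - g h k y s.
    by rewrite /g iterS /fdiff mulrBr -mulrDr.
  split.
    rewrite (_ : _ \o _ = ((EFin \o g h k (y + h)%R) \- (EFin \o g h k y))%E).
      by apply: integrableB => //; exact: measurable_itv.
    by apply/funext => s; rewrite /= gE EFinB.
  rewrite iterS {1}/fdiff e1 e2 -mulrBr -RintegralB //.
  by congr (_ * _); apply: eq_Rintegral => s _; rewrite gE.
apply: (@tower_sign _ psi n x ((-1) ^+ n) (fun k => k.+1%:R^-1) tpsi x0).
- by move=> k; rewrite invr_gt0.
- exact: cvg_harmonic.
move=> k; set h : R := k.+1%:R^-1; have h0 : 0 < h by rewrite invr_gt0.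
have [i e] := main n h x h0 x0; rewrite e mulrCA mulr_ge0 // -RintegralZl //.
apply: Rintegral_ge0 => s Ds; have := Ds; rewrite /= in_itv /= => /andP[s0 s1].
have sx0 : 0 < s * x by rewrite mulr_gt0.
have sh0 : 0 < s * h by rewrite mulr_gt0.
rewrite /g; have [y /andP[sy _] ->] := fdiff_mean_value n tphi sx0 sh0.
rewrite (_ : _ * _ = w s * ((s * h) ^+ n * ((-1) ^+ n * phi n y))); last by ring.
apply: mulr_ge0; first exact: w0.
apply: mulr_ge0; first by rewrite exprn_ge0 // ltW.
by apply: sgn; exact: lt_le_trans sy.
Qed.

Lemma mlg_avg (a c b x : R) : 0 < a -> 0 < c -> 1 < b -> 0 < x ->
  \int[mu]_(s in D) ((1 - s) `^ (b - 1 - 1) * mlg a c (s * x)) =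
  Gamma (b - 1) * gpseries a (c - 1) (mlcf a (c + b - 1)) x.
Proof.
move=> a0 c0 b1 x0; rewrite /Rintegral integral_mlg_average //=.
rewrite mlgE /gpseries (_ : c + b - 1 - 1 = c - 1 + (b - 1)); last by ring.
rewrite powRD ?(gt_eqF x0) ?implybT // -mulrA; congr (_ * _).
by field; rewrite gt_eqF // powR_gt0.
Qed.

(** [mlg 1 b] solves y' = y + x^(b-2) / Gamma(b-1), by [gpseries_mlcf_shift]; the factor e^(-x)
    removes the term y. *)
Lemma is_derive_mlg1_expRN (b x : R) : 1 < b -> 0 < x ->
  is_derive x (1 : R) (fun y => mlg 1 b y * expR (- y)) (gamma_fun (b - 1) x / Gamma (b - 1)).
Proof.
move=> b1 x0; have b0 : 0 < b by lra.
have b10 : 0 < b - 1 by lra.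
have d1 : is_derive x (1 : R) (mlg 1 b)
    (gpseries 1 (b - 1 - 1) (fun k => (b - 1 + 1 * k%:R) * mlcf 1 b k) x).
  rewrite (_ : mlg 1 b = gpseries 1 (b - 1) (mlcf 1 b)); last by apply/funext => y; rewrite mlgE.
  exact: is_derive_gpseries (entire_mlcf ltr01 b0) x0.
have := is_deriveM d1 (is_derive_expRN x).
congr (is_derive _ _ _ _); rewrite /GRing.scale /=.
have E : gpseries 1 (b - 1 - 1) (fun k => (b - 1 + 1 * k%:R) * mlcf 1 b k) x =
    x `^ (b - 1) * gpseries 1 (- 1) (fun k => (b - 1 + 1 * k%:R) * mlcf 1 b k) x.
  by rewrite /gpseries mulrA -powRD ?(gt_eqF x0) ?implybT.
rewrite E gpseries_mlcf_shift ?(ltW b1) //.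
rewrite (_ : 1 + b - 1 = b); last by ring.
have -> : Gamma b = (b - 1) * Gamma (b - 1) by rewrite -GammaS // subrK.
rewrite mlgE /gpseries subrr powRr0 mul1r /gamma_fun.
rewrite (powRB (r := b - 1) (s := 1)) ?(gt_eqF x0) ?implybT // powRr1 ?(ltW x0) //.
have G0 := Gamma_gt0 b10; move: (Gamma (b - 1)) G0 => g G0.
by field; rewrite (gt_eqF x0) (gt_eqF b10) (gt_eqF G0).
Qed.

(** The incomplete Gamma term becomes the case alpha = 1 of the Mittag-Leffler term, hence the Beta
    average of e^x; this makes the functions with beta averages of the defect or of its
    derivative. *)
Lemma lower_gammaE (b x : R) : 1 < b -> 0 < x ->
  x `^ (1 - b) * expR x * lower_gamma (b - 1) x =
  Gamma (b - 1) * gpseries 1 0 (mlcf 1 b) x.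
Proof.
move=> b1 x0; have b0 : 0 < b by lra.
have b10 : 0 < b - 1 by lra.
have G0 := Gamma_gt0 b10.
pose F y : R := mlg 1 b y * expR (- y).
pose f y : R := gamma_fun (b - 1) y / Gamma (b - 1).
have mf : measurable_fun setT f.
  by apply: measurable_funM => //; exact: measurable_gamma_fun.
have f0 y : 0 <= f y by rewrite divr_ge0 ?gamma_fun_ge0 // ltW.
have pos (y : R) : `]0, x[%classic y -> 0 < y by rewrite /= in_itv /= => /andP[].
have Fx : F (x - x / n.+3%:R) @[n --> \oo] --> F x.
  apply: derivable_cvg_seq; first exact: is_derive_derivable (is_derive_mlg1_expRN b1 x0).
  rewrite -[X in _ --> X]subr0 -[X in _ - X](mulr0 x).
  by apply: cvgB; [exact: cvg_cst|apply: cvgM; [exact: cvg_cst|exact: cvg_invS3]].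
have x3 : x / n.+3%:R @[n --> \oo] --> (0 : R).
  by rewrite -[X in _ --> X](mulr0 x); apply: cvgM; [exact: cvg_cst|exact: cvg_invS3].
have F0 : F (x / n.+3%:R) @[n --> \oo] --> 0 * limn (pseries (mlcf 1 b) 0) * expR (- 0).
  have ec := entire_mlcf ltr01 b0.
  apply: cvgM.
    under eq_fun do rewrite mlgE /gpseries powRr1 ?divr_ge0 ?(ltW x0) //.
    apply: cvgM; first by apply: cvg_powR_seq0 => // n; rewrite divr_gt0.
    apply: (@derivable_cvg_seq _ (fun y => limn (pseries (mlcf 1 b) y))) => //.
    by apply: is_derive_derivable (is_derive_pseries (ec 1 ltr01) _); rewrite normr0.
  exact: (@derivable_cvg_seq _ (fun y => expR (- y)) _ 0 (is_derive_derivable (is_derive_expRN 0)) x3).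
rewrite !mul0r in F0.
have If : (\int[mu]_(y in `]0%R, x[) (f y)%:E)%E = (F x)%:E.
  apply: (ge0_FTC_exhausts (F := F) (exhausts_0x x0) mf) => [y _|y /pos|y /pos|].
  - exact: f0.
  - exact: is_derive_mlg1_expRN.
  - by move=> y0; apply: derivableM => //; exact: derivable_gamma_fun.
  by rewrite -[X in _ --> X]subr0; apply: cvgB; [exact: Fx|exact: F0].
have Ig : (\int[mu]_(y in `]0%R, x[) (gamma_fun (b - 1) y)%:E)%E = (Gamma (b - 1) * F x)%:E.
  rewrite EFinM -If -ge0_integralZl_EFin ?(ltW G0) //=.
  - apply: eq_integral => y _; rewrite -EFinM /f; congr _%:E.
    by rewrite mulrC divfK // gt_eqF.
  - by move=> y _; rewrite lee_fin.
  - by apply/measurable_EFinP; exact: measurable_funTS.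
have ig : mu.-integrable `]0%R, x[ (EFin \o gamma_fun (b - 1)).
  apply/integrableP; split.
    by apply/measurable_EFinP; apply: measurable_funTS; exact: measurable_gamma_fun.
  under eq_integral do rewrite /= ger0_norm ?gamma_fun_ge0 //.
  by rewrite Ig ltry.
have -> : lower_gamma (b - 1) x = Gamma (b - 1) * F x.
  by rewrite /lower_gamma -Rintegral_itv_bndo_bndc // /Rintegral Ig.
rewrite /F mlgE /gpseries powRr0 mul1r expRN.
rewrite (_ : 1 - b = - (b - 1)); last by ring.
rewrite powRN; field.
by rewrite (gt_eqF (expR_gt0 x)) gt_eqF // powR_gt0.
Qed.

End AveragedTowers.

(** * The defect, its derivative and their averages *)

Section Assembly.
Variable R : realType.
Local Notation mu := (@lebesgue_measure R).
Local Notation D := (`]0%R, 1%R[%classic : set R).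

Lemma tower_expR (k : R) : tower (fun _ x => k * expR x).
Proof. by move=> n x x0; apply: is_deriveZ; exact: is_derive_expR. Qed.

Variable alpha : R.
Hypothesis alpha_gt0 : 0 < alpha.

(** The sign s = 1 serves alpha <= 1 and s = -1 serves 1 <= alpha <= 2, so both halves of the
    theorem share one proof. *)
Definition ml_defect (s : R) n x := s * (alpha^-1 * expR x - mlg1_tower alpha n x).

Lemma tower_ml_defect s : tower (ml_defect s).
Proof.
apply: (@towerZ _ s (fun n x => alpha^-1 * expR x - mlg1_tower alpha n x)).
by apply: towerB; [exact: tower_expR|exact: tower_mlg1].
Qed.

Lemma ml_defect0 s y : ml_defect s 0 y = s * (alpha^-1 * expR y - mlg alpha 1 y).
Proof. by rewrite /ml_defect mlg1_tower0. Qed.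

Lemma ml_defect1 s y : 0 < y ->
  ml_defect s 1 y = s * (alpha^-1 * expR y - mlg alpha alpha y).
Proof. by move=> y0; rewrite /ml_defect mlg1_tower1. Qed.

Lemma grid_psd_scale (k : R) (phi psi : R -> R) : 0 <= k ->
  (forall y, 0 < y -> phi y = k * psi y) -> grid_psd psi -> grid_psd phi.
Proof.
move=> k0 e psd I c M h h0 M0.
rewrite (_ : \sum_i _ = k * \sum_i \sum_j c i * c j * psi (h * (M i + M j)%:R)).
  by rewrite mulr_ge0 ?psd.
rewrite mulr_sumr; apply: eq_bigr => i _; rewrite mulr_sumr; apply: eq_bigr => j _.
by rewrite e ?mulr_gt0 ?ltr0n ?addn_gt0 ?M0 //; ring.
Qed.

Lemma grid_psdN (phi : R -> R) :
  (forall (I : finType) (c : I -> R) (M : I -> nat) (h : R), 0 < h -> (forall i, (0 < M i)%N) ->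
    \sum_i \sum_j c i * c j * phi (h * (M i + M j)%:R) <= 0) -> grid_psd (fun x => - phi x).
Proof.
move=> H I c M h h0 M0; rewrite -oppr_le0 -sumrN.
under eq_bigr do rewrite -sumrN.
under eq_bigr do under eq_bigr do rewrite -mulrN opprK.
exact: H.
Qed.

Lemma ml_defect_alternating s :
  [\/ s = 1 /\ alpha <= 1 | s = -1 /\ 1 <= alpha <= 2] ->
  forall n x, 0 < x -> 0 <= (-1) ^+ n * ml_defect s n x.
Proof.
have a0 : 0 <= alpha^-1 by rewrite invr_ge0 ltW.
have an : alpha != 0 by rewrite gt_eqF.
move=> hs; apply: grid_psd_alternating; first exact: tower_ml_defect.
  case: hs => -[-> ha].
    apply: (grid_psd_scale (psi := fun y => - (alpha * mlg alpha 1 y - expR y)) a0) => [y y0|].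
      by rewrite ml_defect0; move: (expR y) (mlg _ _ _) => E F; field.
    by apply: grid_psdN => I c M h h0 M0; exact: mlg1_gram_le.
  apply: (grid_psd_scale (psi := fun y => alpha * mlg alpha 1 y - expR y) a0) => [y y0|].
    by rewrite ml_defect0; move: (expR y) (mlg _ _ _) => E F; field.
  by move=> I c M h h0 M0; exact: mlg1_gram_ge.
case: hs => -[-> ha].
  apply: (grid_psd_scale (psi := fun y => alpha * mlg alpha alpha y - expR y) a0) => [y y0|].
    by rewrite ml_defect1 //; move: (expR y) (mlg _ _ _) => E F; field.
  by move=> I c M h h0 M0; exact: mlga_gram_ge.
apply: (grid_psd_scale (psi := fun y => - (alpha * mlg alpha alpha y - expR y)) a0) => [y y0|].
  by rewrite ml_defect1 //; move: (expR y) (mlg _ _ _) => E F; field.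
by apply: grid_psdN => I c M h h0 M0; exact: mlga_gram_le.
Qed.

(** Used with c = 1 for the defect itself and c = alpha for its derivative, whose Mittag-Leffler
    part is [mlg alpha alpha]; [mlg 1 1] is the exponential. *)
Lemma completely_monotonic_average (phi : nat -> R -> R) (s c beta : R) (f : R -> R) :
  0 < c -> 1 < beta -> tower phi ->
  (forall n x, 0 < x -> 0 <= (-1) ^+ n * phi n x) ->
  (forall y, 0 < y -> phi 0%N y = s * (alpha^-1 * mlg 1 1 y - mlg alpha c y)) ->
  (forall x, 0 < x -> f x = s * (alpha^-1 * gpseries 1 0 (mlcf 1 beta) x -
     gpseries alpha (c - 1) (mlcf alpha (c + beta - 1)) x)) ->
  completely_monotonic f.
Proof.
move=> c0 b1 tphi sgn phiE fE.
have b0 : 0 < beta by lra.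
have b10 : 0 < beta - 1 by lra.
have cb0 : 0 < c + beta - 1 by lra.
have G0 := Gamma_gt0 b10.
pose T1 n := gpseries 1 (0 - n%:R) (gpcoef 1 0 (mlcf 1 beta) n).
pose Tc n := gpseries alpha (c - 1 - n%:R) (gpcoef alpha (c - 1) (mlcf alpha (c + beta - 1)) n).
pose psi n x := s * (alpha^-1 * T1 n x - Tc n x).
have tpsi : tower psi.
  apply: (@towerZ _ s (fun n x => alpha^-1 * T1 n x - Tc n x)); apply: towerB.
    by apply: (@towerZ _ alpha^-1 T1); apply: tower_gpseries; exact: entire_mlcf.
  by apply: tower_gpseries; exact: entire_mlcf.
have psi0 x : psi 0%N x = s * (alpha^-1 * gpseries 1 0 (mlcf 1 beta) x -
     gpseries alpha (c - 1) (mlcf alpha (c + beta - 1)) x).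
  by rewrite /psi /T1 /Tc /= subr0 (subr0 (c - 1)).
apply: (@tower_completely_monotonic _ psi f tpsi) => [x x0|]; first by rewrite fE // psi0.
pose w r : R := (1 - r) `^ (beta - 1 - 1).
have mD : measurable D by exact: measurable_itv.
pose i1 x r := w r * mlg 1 1 (r * x); pose ic x r := w r * mlg alpha c (r * x).
have int1 x : 0 < x -> mu.-integrable D (EFin \o i1 x) by exact: integrable_mlg_average.
have intc x : 0 < x -> mu.-integrable D (EFin \o ic x) by exact: integrable_mlg_average.
have intZ (k : R) (g : R -> R) : mu.-integrable D (EFin \o g) ->
    mu.-integrable D (EFin \o (fun r => k * g r)).
  move=> ig; rewrite (_ : _ \o _ = (fun r => k%:E * (EFin \o g) r)%E).
    exact: integrableZl.
  by apply/funext => r; rewrite /= EFinM.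
have intB x : 0 < x -> mu.-integrable D (EFin \o (fun r => alpha^-1 * i1 x r - ic x r)).
  move=> x0; rewrite (_ : _ \o _ = ((EFin \o (fun r => alpha^-1 * i1 x r)%R) \- (EFin \o ic x))%E).
    by apply: integrableB => //; [apply: intZ; exact: int1|exact: intc].
  by apply/funext => r; rewrite /= EFinB.
have E x r : 0 < x -> r \in D -> w r * phi 0%N (r * x) = s * (alpha^-1 * i1 x r - ic x r).
  move=> x0; rewrite inE /= in_itv /= => /andP[r0 r1].
  rewrite (phiE _ (mulr_gt0 r0 x0)) /i1 /ic.
  by move: (mlg 1 1 (r * x)) (mlg alpha c (r * x)) => A B; ring.
apply: (@alternating_average _ phi psi w (Gamma (beta - 1))^-1 tphi tpsi) => //.
- by move=> r _; exact: powR_ge0.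
- by rewrite invr_ge0 ltW.
- move=> x x0; apply: (@eq_integrable _ _ _ mu D mD _ _ _ (intZ s _ (intB x x0))) => r rD.
  by rewrite /= E.
move=> x x0; rewrite psi0.
have -> : \int[mu]_(r in D) (w r * phi 0%N (r * x)) =
    \int[mu]_(r in D) (s * (alpha^-1 * i1 x r - ic x r)).
  by apply: eq_Rintegral => r rD; exact: E.
rewrite RintegralZl //; last exact: intB.
rewrite RintegralB //; [|by apply: intZ; exact: int1|exact: intc].
rewrite RintegralZl //; last exact: int1.
have e1 : \int[mu]_(r in D) i1 x r = Gamma (beta - 1) * gpseries 1 0 (mlcf 1 beta) x.
  rewrite (mlg_avg ltr01 ltr01 b1 x0) subrr.
  by rewrite (_ : 1 + beta - 1 = beta); last by ring.
have ec : \int[mu]_(r in D) ic x r =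
    Gamma (beta - 1) * gpseries alpha (c - 1) (mlcf alpha (c + beta - 1)) x.
  exact: (mlg_avg alpha_gt0 c0 b1 x0).
clearbody i1 ic; rewrite e1 ec.
move: (Gamma _) G0 => G G0.
move: (gpseries _ _ _ _) (gpseries _ _ _ _) => A B.
by field; rewrite (gt_eqF alpha_gt0) (gt_eqF G0).
Qed.

Lemma ml_completely_monotonic s (f : R -> R) :
  [\/ s = 1 /\ alpha <= 1 | s = -1 /\ 1 <= alpha <= 2] ->
  (forall x, 0 < x -> f x = s * (expR x / alpha - mittag_leffler alpha (x `^ alpha))) ->
  completely_monotonic f.
Proof.
move=> hs fE; apply: (tower_completely_monotonic (tower_ml_defect s)).
  by move=> x x0; rewrite fE // ml_defect0 mlg1E // [alpha^-1 * _]mulrC.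
exact: ml_defect_alternating.
Qed.

Lemma mlF_completely_monotonic s beta (f : R -> R) :
  [\/ s = 1 /\ alpha <= 1 | s = -1 /\ 1 <= alpha <= 2] -> 1 < beta ->
  (forall x, 0 < x -> f x = s * (x `^ (1 - beta) * expR x * lower_gamma (beta - 1) x
     / (alpha * Gamma (beta - 1)) - mlF alpha beta x)) ->
  completely_monotonic f.
Proof.
move=> hs b1 fE.
apply: (completely_monotonic_average (s := s) ltr01 b1 (tower_ml_defect s) (ml_defect_alternating hs)).
  by move=> y y0; rewrite ml_defect0 mlg11.
move=> x x0; rewrite fE // lower_gammaE //.
have b10 : 0 < beta - 1 by lra.
have -> : mlF alpha beta x = gpseries alpha (1 - 1) (mlcf alpha (1 + beta - 1)) x.
  rewrite /mlF mittag_leffler2E /gpseries subrr powRr0 mul1r.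
  by rewrite (_ : 1 + beta - 1 = beta); last by ring.
have G0 := Gamma_gt0 b10; move: (Gamma _) G0 => G G0.
move: (gpseries _ _ _ _) (gpseries _ _ _ _) => A B.
by field; rewrite (gt_eqF alpha_gt0) (gt_eqF G0).
Qed.

Lemma Lop_mlF_completely_monotonic s beta (f : R -> R) :
  [\/ s = 1 /\ alpha <= 1 | s = -1 /\ 1 <= alpha <= 2] -> 1 < beta ->
  (forall x, 0 < x -> f x = s * (Lop beta (mlF alpha beta) x -
     x `^ (1 - beta) * expR x * lower_gamma (beta - 1) x / (alpha * Gamma (beta - 1)))) ->
  completely_monotonic f.
Proof.
move=> hs b1 fE.
(* The averaged tower is minus the derivative of the defect; its sign -1 completes (-1)^n to
   (-1)^(n+1). *)
apply: (completely_monotonic_average (s := - s) (phi := fun n x => -1 * ml_defect s n.+1 x) alpha_gt0 b1).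
- exact: towerZ (tower_shift (tower_ml_defect s)).
- move=> n x x0; rewrite mulrA mulrN1 -mulN1r -exprS.
  exact: ml_defect_alternating.
- by move=> y y0; rewrite ml_defect1 // mlg11 //; ring.
move=> x x0; rewrite fE // lower_gammaE // Lop_mlF //.
have b10 : 0 < beta - 1 by lra.
have G0 := Gamma_gt0 b10; move: (Gamma _) G0 => G G0.
move: (gpseries _ _ _ _) (gpseries _ _ _ _) => A B.
by field; rewrite (gt_eqF alpha_gt0) (gt_eqF G0).
Qed.

End Assembly.

Theorem theoremB (R : realType) :
  [/\ (forall alpha : R, 0 < alpha <= 1 ->
        completely_monotonic
          (fun x : R => expR x / alpha - mittag_leffler alpha (x `^ alpha))),
      (forall alpha beta : R, 0 < alpha <= 1 -> 1 < beta ->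
        completely_monotonic
          (fun x : R =>
             x `^ (1 - beta) * expR x * lower_gamma (beta - 1) x
               / (alpha * Gamma (beta - 1))
             - mlF alpha beta x) /\
        completely_monotonic
          (fun x : R =>
             Lop beta (mlF alpha beta) x
             - x `^ (1 - beta) * expR x * lower_gamma (beta - 1) x
               / (alpha * Gamma (beta - 1)))),
      (forall alpha : R, 1 <= alpha <= 2 ->
        completely_monotonic
          (fun x : R => mittag_leffler alpha (x `^ alpha) - expR x / alpha))
    & (forall alpha beta : R, 1 <= alpha <= 2 -> 1 < beta ->
        completely_monotonic
          (fun x : R =>
             mlF alpha beta x
             - x `^ (1 - beta) * expR x * lower_gamma (beta - 1) x
               / (alpha * Gamma (beta - 1))) /\
        completely_monotonic
          (fun x : R =>
             x `^ (1 - beta) * expR x * lower_gamma (beta - 1) x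
               / (alpha * Gamma (beta - 1))
             - Lop beta (mlF alpha beta) x))].
Proof.
split.
- move=> alpha /andP[a0 a1].
  apply: (ml_completely_monotonic a0 (s := 1)) => [|x x0]; first by left.
  by rewrite mul1r.
- move=> alpha beta /andP[a0 a1] b1; split.
    apply: (mlF_completely_monotonic a0 (s := 1) _ b1) => [|x x0]; first by left.
    by rewrite mul1r.
  apply: (Lop_mlF_completely_monotonic a0 (s := 1) _ b1) => [|x x0]; first by left.
  by rewrite mul1r.
- move=> alpha a12; have a0 : 0 < alpha by case/andP: a12; lra.
  apply: (ml_completely_monotonic a0 (s := -1)) => [|x x0]; first by right.
  by rewrite mulN1r opprB.
- move=> alpha beta a12 b1; have a0 : 0 < alpha by case/andP: a12; lra.
  split.
    apply: (mlF_completely_monotonic a0 (s := -1) _ b1) => [|x x0]; first by right.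
    by rewrite mulN1r opprB.
  apply: (Lop_mlF_completely_monotonic a0 (s := -1) _ b1) => [|x x0]; first by right.
  by rewrite mulN1r opprB.
Qed.
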